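(* The Dirichlet series $W_d(s)=\sum_{p/q\in\mathcal S}p^{-s}$ and $W_m(s)=\sum_{p/q\in\mathcal S}q^{-s}$ converge absolutely and are analytic for $\Re(s)>1$, and each has a pole of order $1$ at $s=1$. Consequently $\zeta_{\mathrm{WR}(\mathbb Z^2)}(s)=\sum_{\Lambda\in\mathrm{WR}(\mathbb Z^2)}\det(\Lambda)^{-s}$ and $\zeta^m_{\mathrm{WR}(\mathbb Z^2)}(s)=\sum_{\Lambda\in\mathrm{WR}(\mathbb Z^2)}|\Lambda|^{-2s}$ are analytic for $\Re(s)>1$ and each has a pole of order $2$ at $s=1$.
   Context: All lattices are full-rank lattices in $\mathbb R^2$. For a lattice $\Lambda$, $|\Lambda|=\min_{x\in\Lambda\setminus\{0\}}\|x\|$ (Euclidean norm); $\Lambda$ is well-rounded (WR) if its vectors of norm $|\Lambda|$ span $\mathbb R^2$. $\mathrm{WR}(\mathbb Z^2)$ is the set of full-rank WR sublattices of $\mathbb Z^2$. For $q\in\mathbb Z_{>0}$ let $\mathcal S_q=\{p/q\in\mathbb Q\cap(\sqrt3/2,1):\gcd(p,q)=1,\ \sqrt{q^2-p^2}\in\mathbb Z\}$ and $\mathcal S=\bigcup_{q}\mathcal S_q\cup\{1\}$, where $1$ is written as $p/q$ with $p=q=1$; elements of $\mathcal S$ are written in lowest terms (the sums above run over all elements $p/q$ of $\mathcal S$, each once). Pole convention: a Dirichlet series $\sum_{n\ge1}c_nn^{-s}$ has a pole of order $\mu>0$ at the real point $s_0$ if $0<\lim_{s\to s_0^+}|s-s_0|^{\mu}\sum_{n\ge1}|c_nn^{-s}|<\infty$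 ($s$ real); this does not assert analytic continuation. *)

(* Defs.v *)
From Stdlib Require Import Reals Lra Lia ZArith List ClassicalEpsilon.
Import ListNotations.
Open Scope R_scope.

Record C := mkC { Re : R; Im : R }.
Definition Cadd (a b : C) : C := mkC (Re a + Re b) (Im a + Im b).
Definition Csub (a b : C) : C := mkC (Re a - Re b) (Im a - Im b).
Definition Cmul (a b : C) : C :=
  mkC (Re a * Re b - Im a * Im b) (Re a * Im b + Im a * Re b).
Definition Cinv (a : C) : C :=
  mkC (Re a / (Re a ^ 2 + Im a ^ 2)) (- Im a / (Re a ^ 2 + Im a ^ 2)).
Definition Cdiv (a b : C) : C := Cmul a (Cinv b).
Definition Cabs (a : C) : R := sqrt (Re a ^ 2 + Im a ^ 2).
Definition C0 : C := mkC 0 0.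

(* x^{-s} = exp(-s ln x) for real x > 0 and complex s. *)
Definition cpowneg (x : R) (s : C) : C :=
  mkC (exp (- Re s * ln x) * cos (Im s * ln x))
      (- (exp (- Re s * ln x) * sin (Im s * ln x))).

Definition Cdifferentiable (F : C -> C) (s0 : C) : Prop :=
  exists D : C, forall eps : R, 0 < eps -> exists delta : R, 0 < delta /\
    forall h : C, h <> C0 -> Cabs h < delta ->
      Cabs (Csub (Cdiv (Csub (F (Cadd s0 h)) (F s0)) h) D) < eps.

Fixpoint CsumL {T} (f : T -> C) (l : list T) : C :=
  match l with [] => C0 | x :: l' => Cadd (f x) (CsumL f l') end.
Fixpoint RsumL {T} (f : T -> R) (l : list T) : R :=
  match l with [] => 0 | x :: l' => f x + RsumL f l' end.

(* the family (f x)_{x | P x} is summable with sum L (net of finite subsets) *)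
Definition HasSumC {T} (P : T -> Prop) (f : T -> C) (L : C) : Prop :=
  forall eps, 0 < eps -> exists l0 : list T, NoDup l0 /\ Forall P l0 /\
    forall l : list T, NoDup l -> Forall P l -> incl l0 l ->
      Cabs (Csub (CsumL f l) L) < eps.
Definition HasSumR {T} (P : T -> Prop) (f : T -> R) (L : R) : Prop :=
  forall eps, 0 < eps -> exists l0 : list T, NoDup l0 /\ Forall P l0 /\
    forall l : list T, NoDup l -> Forall P l -> incl l0 l ->
      Rabs (RsumL f l - L) < eps.

Definition AbsConvRe1 {T} (P : T -> Prop) (w : T -> R) : Prop :=
  forall s : C, 1 < Re s ->
    exists L : R, HasSumR P (fun x => Cabs (cpowneg (w x) s)) L.

Definition AnalyticRe1 {T} (P : T -> Prop) (w : T -> R) : Prop :=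
  exists F : C -> C,
    (forall s : C, 1 < Re s -> HasSumC P (fun x => cpowneg (w x) s) (F s)) /\
    (forall s : C, 1 < Re s -> Cdifferentiable F s).

(* pole of order mu at s = 1 in the paper's convention:
   0 < lim_{s -> 1+, s real} |s - 1|^mu * sum |c_n n^{-s}| < infinity *)
Definition PoleOrderAt1 {T} (P : T -> Prop) (w : T -> R) (mu : nat) : Prop :=
  exists l : R, 0 < l /\
    forall eps, 0 < eps -> exists delta, 0 < delta /\
      forall (sg L : R), 1 < sg < 1 + delta ->
        HasSumR P (fun x => Rabs (Rpower (w x) (- sg))) L ->
        Rabs ((sg - 1) ^ mu * L - l) < eps.

Definition DirichletProps {T} (P : T -> Prop) (w : T -> R) (mu : nat) : Prop :=
  AbsConvRe1 P w /\ AnalyticRe1 P w /\ PoleOrderAt1 P w mu.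

Definition inS (pq : nat * nat) : Prop :=
  let (p, q) := pq in
  (p = 1%nat /\ q = 1%nat) \/
  (Nat.gcd p q = 1%nat /\
   (* sqrt 3 / 2 < p / q < 1 *)
   (3 * q * q < 4 * p * p)%nat /\ (p < q)%nat /\
   (* sqrt (q^2 - p^2) is an integer *)
   exists r : nat, (r * r + p * p = q * q)%nat).

(* A lattice in Z^2 is represented by its (boolean) membership predicate. *)
Definition ZLat := Z -> Z -> bool.

Definition IsBasis (L : ZLat) (b : (Z * Z) * (Z * Z)) : Prop :=
  let '((u1, u2), (v1, v2)) := b in
  (u1 * v2 - u2 * v1 <> 0)%Z /\
  forall x y : Z, L x y = true <->
    exists a c : Z, x = (a * u1 + c * v1)%Z /\ y = (a * u2 + c * v2)%Z.

Definition IsFullSublattice (L : ZLat) : Prop := exists b, IsBasis L b.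

Definition sqn (x y : Z) : Z := (x * x + y * y)%Z.

(* well-rounded: vectors of minimal norm span R^2 *)
Definition IsWR (L : ZLat) : Prop :=
  exists u1 u2 v1 v2 : Z,
    L u1 u2 = true /\ L v1 v2 = true /\ (u1 * v2 - u2 * v1 <> 0)%Z /\
    sqn u1 u2 = sqn v1 v2 /\
    forall x y : Z, L x y = true -> (x, y) <> (0%Z, 0%Z) ->
      (sqn u1 u2 <= sqn x y)%Z.

Definition WRZ2 (L : ZLat) : Prop := IsFullSublattice L /\ IsWR L.

(* det(L) = |det| of any basis *)
Definition latdet (L : ZLat) : R :=
  let b := epsilon (inhabits ((0%Z, 0%Z), (0%Z, 0%Z))) (IsBasis L) in
  let '((u1, u2), (v1, v2)) := b in IZR (Z.abs (u1 * v2 - u2 * v1)).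

Definition latmin2 (L : ZLat) : R :=
  IZR (epsilon (inhabits 0%Z) (fun m : Z =>
    (exists x y, L x y = true /\ (x, y) <> (0%Z, 0%Z) /\ sqn x y = m) /\
    (forall x y, L x y = true -> (x, y) <> (0%Z, 0%Z) -> (m <= sqn x y)%Z))).

(* Main.v *)
(** Writing [u], [v] for minimal vectors spanning a well-rounded [L] in [Z[i]], the orthogonal
    diagonals [u + v] and [u - v] are, up to sign, [a g] and [i b g] with [a], [b] coprime positive
    integers and [g] in [Z[i]]; minimality says [a^2 < 3 b^2] and [b^2 < 3 a^2], and integrality of
    [u] says [g = 2 h], or [g = (1 + i) h] when [a] and [b] are both odd. Hence [L] corresponds to
    exactly one pair ([(a, b)], [h] modulo units, the swap of [a] and [b] absorbing multiplication
    by [i]), and [det L = p N(h)], [|L|^2 = q N(h)] where [p/q = 2ab / (a^2 + b^2)] in lowest terms.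
    So each zeta function is a product of a sum over the coprime pairs of a cone and of a sum over
    [Z[i]] modulo units. The set [S] is parametrized by the half [b <= a] of the same cone.

    Each factor has a simple pole. In a row [m] of a cone, a Riemann sum with explicit
    antiderivative ([ln] or [atan]) gives [sum_n (m^2 g(n/m))^-1 = c / m + O(1 / m^2)], and
    [sum_m m^(1 - 2s)] has a simple pole. Coprimality is imposed by dividing by
    [sum_(d odd) d^(-2s)], the pairs with both entries even having been left out. *)

From Stdlib Require Import Reals Lra Lia ZArith List Classical ClassicalEpsilon.
From Stdlib Require Import FunctionalExtensionality Znumtheory.
Require Import Defs.
Import ListNotations.
Open Scope R_scope.

Definition eq_dec_classic {T} (x y : T) : {x = y} + {x <> y} :=
  excluded_middle_informative (x = y).

(** * Finite sums over lists *)

Section FiniteSums.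
Context {T : Type}.
Implicit Types (f g : T -> R) (l : list T).

Lemma RsumL_app f l1 l2 : RsumL f (l1 ++ l2) = RsumL f l1 + RsumL f l2.
Proof. induction l1 as [|x l1 IH]; simpl; [lra | rewrite IH; lra]. Qed.

Lemma RsumL_ext f g l : (forall x, In x l -> f x = g x) -> RsumL f l = RsumL g l.
Proof.
  induction l as [|x l IH]; simpl; intros H; [reflexivity|].
  rewrite (H x), IH; auto.
Qed.

Lemma RsumL_le f g l : (forall x, In x l -> f x <= g x) -> RsumL f l <= RsumL g l.
Proof.
  induction l as [|x l IH]; simpl; intros H; [lra|].
  apply Rplus_le_compat; auto.
Qed.

Lemma RsumL_plus f g l : RsumL (fun x => f x + g x) l = RsumL f l + RsumL g l.
Proof. induction l as [|x l IH]; simpl; [lra | rewrite IH; lra]. Qed.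

Lemma RsumL_scal c f l : RsumL (fun x => c * f x) l = c * RsumL f l.
Proof. induction l as [|x l IH]; simpl; [lra | rewrite IH; lra]. Qed.

Lemma RsumL_nonneg f l : (forall x, In x l -> 0 <= f x) -> 0 <= RsumL f l.
Proof.
  induction l as [|x l IH]; simpl; intros H; [lra|].
  apply Rplus_le_le_0_compat; auto.
Qed.

Lemma RsumL_incl f l l' :
  (forall x, In x l' -> 0 <= f x) -> NoDup l -> incl l l' -> RsumL f l <= RsumL f l'.
Proof.
  revert l'; induction l as [|x l IH]; simpl; intros l' H0 Hnd Hi.
  - apply RsumL_nonneg; assumption.
  - apply NoDup_cons_iff in Hnd as [Hx Hnd].
    destruct (in_split x l') as (l1 & l2 & ->); [apply Hi; left; reflexivity|].
    assert (RsumL f l <= RsumL f (l1 ++ l2)).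
    { apply IH; auto.
      - intros y Hy; apply H0; apply in_or_app; apply in_app_or in Hy; simpl; tauto.
      - intros y Hy. assert (Hy' : In y (l1 ++ x :: l2)) by (apply Hi; right; exact Hy).
        apply in_or_app; apply in_app_or in Hy'; simpl in Hy'.
        destruct Hy' as [|[->|]]; tauto. }
    rewrite RsumL_app in *; simpl; lra.
Qed.
End FiniteSums.

Lemma RsumL_map {T U} (h : T -> U) (f : U -> R) l :
  RsumL f (map h l) = RsumL (fun x => f (h x)) l.
Proof. induction l as [|x l IH]; simpl; [reflexivity | rewrite IH; reflexivity]. Qed.

Lemma RsumL_filter {T} (f : T -> R) (b : T -> bool) l :
  RsumL f l = RsumL f (filter b l) + RsumL f (filter (fun x => negb (b x)) l).
Proof.
  induction l as [|x l IH]; simpl; [lra|].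
  destruct (b x); simpl; rewrite IH; lra.
Qed.

Lemma Forall_filter_impl {T} (P : T -> Prop) b (l : list T) :
  Forall P l -> Forall P (filter b l).
Proof.
  rewrite !Forall_forall; intros H x Hx; apply filter_In in Hx; apply H; tauto.
Qed.

Lemma NoDup_map_inj_on {T U} (P : T -> Prop) (h : T -> U) l :
  (forall x y, P x -> P y -> h x = h y -> x = y) ->
  Forall P l -> NoDup l -> NoDup (map h l).
Proof.
  intros Hi; induction l as [|x l IH]; intros HP Hn; simpl; [constructor|].
  apply Forall_cons_iff in HP as [HPx HP]; apply NoDup_cons_iff in Hn as [Hx Hn].
  constructor; auto. intros Hin; apply in_map_iff in Hin as (y & Hy & Hin).
  rewrite Forall_forall in HP. apply Hi in Hy; auto; subst; auto.
Qed.

(** * Sums of nonnegative families *)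

(** For nonnegative terms the net of finite partial sums increases, so its limit is its supremum.
    This form separates the upper bound from the approximation from below, and the two are usually
    proved by different arguments. *)
Definition IsSum {T} (P : T -> Prop) (f : T -> R) (L : R) : Prop :=
  (forall l, NoDup l -> Forall P l -> RsumL f l <= L) /\
  (forall eps, 0 < eps -> exists l, NoDup l /\ Forall P l /\ L - eps < RsumL f l).

Section SumsBasics.
Context {T : Type}.
Implicit Types (P Q : T -> Prop) (f g : T -> R).

Lemma IsSum_HasSumR P f L :
  (forall x, P x -> 0 <= f x) -> IsSum P f L <-> HasSumR P f L.
Proof.
  intros H0; split.
  - intros [Hu Hl] eps He. destruct (Hl eps He) as (l0 & Hn & HP & Hlt).
    exists l0; split; [|split]; auto. intros l Hnl HPl Hi.
    specialize (Hu l Hnl HPl).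
    assert (RsumL f l0 <= RsumL f l).
    { apply RsumL_incl; auto. rewrite Forall_forall in HPl; auto. }
    apply Rabs_def1; lra.
  - intros H; split.
    + intros l Hn HP. apply le_epsilon; intros eps He.
      destruct (H eps He) as (l0 & Hn0 & HP0 & Hc).
      set (l1 := nodup eq_dec_classic (l ++ l0)).
      assert (HP1 : Forall P l1).
      { unfold l1; rewrite Forall_forall; intros x Hx; apply nodup_In in Hx.
        rewrite Forall_forall in HP, HP0. apply in_app_or in Hx as [|]; auto. }
      assert (Hn1 : NoDup l1) by apply NoDup_nodup.
      assert (Hi : incl l0 l1).
      { intros x Hx; apply nodup_In, in_or_app; auto. }
      assert (Hi' : incl l l1).
      { intros x Hx; apply nodup_In, in_or_app; auto. }
      specialize (Hc l1 Hn1 HP1 Hi). apply Rabs_def2 in Hc.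
      assert (RsumL f l <= RsumL f l1).
      { apply RsumL_incl; auto. rewrite Forall_forall in HP1; auto. }
      lra.
    + intros eps He. destruct (H eps He) as (l0 & Hn0 & HP0 & Hc).
      exists l0; split; [|split]; auto.
      specialize (Hc l0 Hn0 HP0 (incl_refl _)). apply Rabs_def2 in Hc; lra.
Qed.

Lemma IsSum_le_of_bound P f L M :
  IsSum P f L -> (forall l, NoDup l -> Forall P l -> RsumL f l <= M) -> L <= M.
Proof.
  intros [_ Hl] H. apply le_epsilon; intros eps He.
  destruct (Hl eps He) as (l & Hn & HP & Hlt). specialize (H l Hn HP); lra.
Qed.

Lemma IsSum_unique P f L1 L2 : IsSum P f L1 -> IsSum P f L2 -> L1 = L2.
Proof.
  intros H1 H2; apply Rle_antisym; eapply IsSum_le_of_bound; eauto;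
    [apply H2 | apply H1].
Qed.

Lemma IsSum_ext P Q f g L :
  (forall x, P x <-> Q x) -> (forall x, P x -> f x = g x) ->
  IsSum P f L -> IsSum Q g L.
Proof.
  intros HPQ Hfg [Hu Hl].
  assert (Hs : forall l, Forall P l -> RsumL f l = RsumL g l).
  { intros l HP; apply RsumL_ext; rewrite Forall_forall in HP; auto. }
  assert (HF : forall l, Forall P l <-> Forall Q l).
  { intros l; rewrite !Forall_forall; firstorder. }
  split.
  - intros l Hn HQ. rewrite <- Hs by (apply HF; exact HQ). apply Hu; auto. apply HF; auto.
  - intros eps He; destruct (Hl eps He) as (l & Hn & HP & Hlt).
    exists l; split; [|split]; auto. apply HF; auto. rewrite <- Hs; auto.
Qed.

Lemma IsSum_of_bound P f M :
  (forall l, NoDup l -> Forall P l -> RsumL f l <= M) ->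
  exists L, IsSum P f L /\ L <= M.
Proof.
  intros H.
  destruct (completeness (fun y => exists l, NoDup l /\ Forall P l /\ y = RsumL f l))
    as [L [HL1 HL2]].
  - exists M; intros y (l & Hn & HP & ->); auto.
  - exists 0, []; split; [constructor | split; [constructor | reflexivity]].
  - exists L; split; [split|].
    + intros l Hn HP; apply HL1; eauto.
    + intros eps He. apply NNPP; intros Hne.
      assert (L <= L - eps); [|lra].
      apply HL2; intros y (l & Hn & HP & ->).
      apply Rnot_lt_le; intros Hlt; apply Hne; exists l; auto.
    + apply HL2; intros y (l & Hn & HP & ->); auto.
Qed.

Lemma IsSum_nonneg P f L : IsSum P f L -> 0 <= L.
Proof. intros [Hu _]. apply (Hu []); constructor. Qed.

Lemma IsSum_ge_term P f L x : IsSum P f L -> P x -> f x <= L.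
Proof.
  intros [Hu _] Hx. assert (H : RsumL f [x] <= L).
  { apply Hu; repeat constructor; simpl; auto. }
  simpl in H; lra.
Qed.

Lemma IsSum_scal P f L c : 0 <= c -> IsSum P f L -> IsSum P (fun x => c * f x) (c * L).
Proof.
  intros Hc [Hu Hl]; split.
  - intros l Hn HP; rewrite RsumL_scal; apply Rmult_le_compat_l; auto.
  - intros eps He.
    destruct (Hl (eps / (c + 1))) as (l & Hn & HP & Hlt); [apply Rdiv_lt_0_compat; lra|].
    exists l; split; [|split]; auto. rewrite RsumL_scal.
    assert (c * (L - RsumL f l) <= c * (eps / (c + 1))) by (apply Rmult_le_compat_l; lra).
    assert (c * (eps / (c + 1)) < eps); [|lra].
    replace (c * (eps / (c + 1))) with (eps * (c / (c + 1))) by (field; lra).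
    rewrite <- (Rmult_1_r eps) at 2. apply Rmult_lt_compat_l; auto.
    apply Rmult_lt_reg_r with (c + 1); [lra|].
    unfold Rdiv; rewrite Rmult_assoc, Rinv_l; lra.
Qed.

Lemma IsSum_finite f l0 :
  NoDup l0 -> (forall x, In x l0 -> 0 <= f x) ->
  IsSum (fun x => In x l0) f (RsumL f l0).
Proof.
  intros Hn0 H0; split.
  - intros l Hn HP; apply RsumL_incl; auto. rewrite Forall_forall in HP; exact HP.
  - intros eps He; exists l0; split; [|split]; auto; [apply Forall_forall; auto | lra].
Qed.

Lemma IsSum_union P Q f L1 L2 :
  (forall x, P x -> Q x -> False) ->
  IsSum P f L1 -> IsSum Q f L2 -> IsSum (fun x => P x \/ Q x) f (L1 + L2).
Proof.
  intros Hd [Hu1 Hl1] [Hu2 Hl2]; split.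
  - intros l Hn HPQ.
    set (b := fun x => if excluded_middle_informative (P x) then true else false).
    rewrite (RsumL_filter f b).
    apply Rplus_le_compat; [apply Hu1 | apply Hu2]; try (apply NoDup_filter; auto);
      rewrite Forall_forall in *; intros x Hx; apply filter_In in Hx as [Hx Hb];
      unfold b in Hb; destruct (excluded_middle_informative (P x)); simpl in Hb;
      try discriminate; auto.
    destruct (HPQ x Hx); tauto.
  - intros eps He.
    destruct (Hl1 (eps / 2)) as (l1 & Hn1 & HP1 & Hlt1); [lra|].
    destruct (Hl2 (eps / 2)) as (l2 & Hn2 & HP2 & Hlt2); [lra|].
    exists (l1 ++ l2); split; [|split].
    + apply NoDup_app; auto. rewrite Forall_forall in HP1, HP2. intros x Hx1 Hx2; exact (Hd x (HP1 x Hx1) (HP2 x Hx2)).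
    + apply Forall_app; split; [revert HP1 | revert HP2]; apply Forall_impl; auto.
    + rewrite RsumL_app; lra.
Qed.
End SumsBasics.

Section SumsMaps.
Context {T U : Type}.

Lemma IsSum_bij (P : T -> Prop) (Q : U -> Prop) (h : T -> U) (g : U -> R) L :
  (forall x, P x -> Q (h x)) ->
  (forall x y, P x -> P y -> h x = h y -> x = y) ->
  (forall y, Q y -> exists x, P x /\ h x = y) ->
  IsSum P (fun x => g (h x)) L <-> IsSum Q g L.
Proof.
  intros HPQ Hinj Hsurj.
  assert (Hf : forall l, NoDup l -> Forall P l ->
     NoDup (map h l) /\ Forall Q (map h l)).
  { intros l Hn HP; split; [eapply NoDup_map_inj_on; eauto|].
    apply Forall_map. eapply Forall_impl; eauto. }
  assert (Hb : forall l', NoDup l' -> Forall Q l' ->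
     exists l, NoDup l /\ Forall P l /\ l' = map h l).
  { induction l' as [|y l' IH]; intros Hn HQ.
    - exists []; repeat constructor.
    - apply NoDup_cons_iff in Hn as [Hy Hn]; apply Forall_cons_iff in HQ as [HQy HQ].
      destruct (IH Hn HQ) as (l & Hnl & HPl & ->).
      destruct (Hsurj y HQy) as (x & Hx & <-).
      exists (x :: l); split; [|split]; auto.
      constructor; auto. intros Hin; apply Hy, in_map; auto. }
  split; intros [Hu Hl]; split.
  - intros l' Hn HQ; destruct (Hb l' Hn HQ) as (l & Hnl & HP & ->).
    rewrite RsumL_map; auto.
  - intros eps He; destruct (Hl eps He) as (l & Hn & HP & Hlt).
    destruct (Hf l Hn HP). exists (map h l); rewrite RsumL_map; auto.
  - intros l Hn HP; destruct (Hf l Hn HP). rewrite <- RsumL_map; auto.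
  - intros eps He; destruct (Hl eps He) as (l' & Hn & HQ & Hlt).
    destruct (Hb l' Hn HQ) as (l & Hnl & HP & ->).
    exists l; rewrite <- RsumL_map; auto.
Qed.

(** Summation by rows: a two-dimensional sum is the sum of its row sums. Lattice points of a cone
    and products of two series are both handled this way. *)
Lemma IsSum_sigma (P : T -> Prop) (Q : T -> U -> Prop) (f : T * U -> R) g L :
  (forall x, P x -> IsSum (Q x) (fun y => f (x, y)) (g x)) ->
  IsSum P g L ->
  IsSum (fun z => P (fst z) /\ Q (fst z) (snd z)) f L.
Proof.
  intros Hg [Hu Hl]; split.
  (* A finite set of pairs meets finitely many rows; induction on the list of these rows peels off
     one row at a time. *)
  - assert (Haux : forall xs, NoDup xs -> Forall P xs -> forall l, NoDup l ->
      Forall (fun z => P (fst z) /\ Q (fst z) (snd z)) l ->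
      (forall z, In z l -> In (fst z) xs) -> RsumL f l <= RsumL g xs).
    { induction xs as [|x xs IH]; intros Hnx HPx l Hn HP Hi.
      - destruct l as [|z l]; [simpl; lra | exfalso; apply (Hi z); left; reflexivity].
      - apply NoDup_cons_iff in Hnx as [Hx Hnx].
        apply Forall_cons_iff in HPx as [HPx HPxs].
        set (b := fun z : T * U => if eq_dec_classic (fst z) x then true else false).
        rewrite (RsumL_filter f b); simpl; apply Rplus_le_compat.
        + set (l1 := filter b l).
          assert (Hb1 : forall z, In z l1 -> In z l /\ fst z = x).
          { intros z Hz; apply filter_In in Hz as [Hz Hb]; unfold b in Hb.
            destruct (eq_dec_classic (fst z) x); [auto | discriminate]. }
          replace (RsumL f l1) with (RsumL (fun y => f (x, y)) (map snd l1)).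
          2:{ rewrite RsumL_map; apply RsumL_ext; intros [x' y] Hz.
              apply Hb1 in Hz as [_ Hz]; simpl in *; subst; reflexivity. }
          apply (Hg x HPx).
          * apply NoDup_map_inj_on with (P := fun z => fst z = x).
            -- intros [x1 y1] [x2 y2]; simpl; intros; subst; reflexivity.
            -- apply Forall_forall; intros z Hz; apply Hb1, Hz.
            -- apply NoDup_filter; auto.
          * apply Forall_map, Forall_forall; intros z Hz; apply Hb1 in Hz as [Hz He].
            rewrite Forall_forall in HP; apply HP in Hz as [_ Hz]; rewrite He in Hz; auto.
        + apply IH; auto.
          * apply NoDup_filter; auto.
          * apply Forall_filter_impl; auto.
          * intros z Hz; apply filter_In in Hz as [Hz Hb].
            apply Hi in Hz as [Hz|Hz]; auto.
            unfold b in Hb; destruct (eq_dec_classic (fst z) x); simpl in Hb;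
              [discriminate | congruence]. }
    intros l Hn HP. set (xs := nodup eq_dec_classic (map fst l)).
    assert (HPx : Forall P xs).
    { apply Forall_forall; intros x Hx; apply nodup_In, in_map_iff in Hx.
      destruct Hx as (z & <- & Hz). rewrite Forall_forall in HP; apply HP, Hz. }
    apply Rle_trans with (RsumL g xs).
    + apply Haux; auto; [apply NoDup_nodup|].
      intros z Hz; apply nodup_In, in_map, Hz.
    + apply Hu; auto; apply NoDup_nodup.
  (* Conversely, half of the tolerance goes to the current row and half to the remaining ones. *)
  - assert (Haux : forall xs, NoDup xs -> Forall P xs -> forall eps, 0 < eps ->
      exists l, NoDup l /\ Forall (fun z => P (fst z) /\ Q (fst z) (snd z)) l /\
        (forall z, In z l -> In (fst z) xs) /\ RsumL g xs - eps < RsumL f l).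
    { induction xs as [|x xs IH]; intros Hnx HPx eps He.
      - exists []; repeat split; try constructor; simpl; auto; lra.
      - apply NoDup_cons_iff in Hnx as [Hx Hnx].
        apply Forall_cons_iff in HPx as [HPx HPxs].
        destruct (IH Hnx HPxs (eps / 2)) as (l & Hn & HP & Hi & Hlt); [lra|].
        destruct (proj2 (Hg x HPx) (eps / 2)) as (ys & Hny & HQ & Hlty); [lra|].
        exists (map (pair x) ys ++ l); split; [|split; [|split]].
        + apply NoDup_app; auto.
          * apply NoDup_map_NoDup_ForallPairs; auto. intros y y' _ _ E; congruence.
          * intros z Hz Hz'; apply in_map_iff in Hz as (y & <- & _).
            apply Hi in Hz'; auto.
        + apply Forall_app; split; auto. apply Forall_map.
          eapply Forall_impl; [|exact HQ]; simpl; auto.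
        + intros z Hz; apply in_app_or in Hz as [Hz|Hz]; [|right; auto].
          apply in_map_iff in Hz as (y & <- & _); left; reflexivity.
        + rewrite RsumL_app, RsumL_map; simpl; lra. }
    intros eps He. destruct (Hl (eps / 2)) as (xs & Hnx & HPx & Hlt); [lra|].
    destruct (Haux xs Hnx HPx (eps / 2)) as (l & Hn & HP & _ & Hlt'); [lra|].
    exists l; split; [|split]; auto; lra.
Qed.
End SumsMaps.

Lemma IsSum_product {T U} (P : T -> Prop) (Q : U -> Prop) (f : T -> R) (g : U -> R) A B :
  (forall x, P x -> 0 <= f x) -> IsSum P f A -> IsSum Q g B ->
  IsSum (fun z => P (fst z) /\ Q (snd z)) (fun z => f (fst z) * g (snd z)) (A * B).
Proof.
  intros H0 HA HB.
  apply (IsSum_sigma P (fun _ => Q)) with (g := fun x => f x * B); simpl.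
  - intros x Hx; apply IsSum_scal; auto.
  - apply IsSum_ext with (P := P) (f := fun x => B * f x); try tauto; [intros; ring|].
    rewrite Rmult_comm. apply IsSum_scal; auto. eapply IsSum_nonneg; eauto.
Qed.

Lemma Rabs_le_between x y : Rabs x <= y -> - y <= x <= y.
Proof. intros H; unfold Rabs in H; destruct (Rcase_abs x); lra. Qed.

(** * Analyticity of Dirichlet series *)

Lemma Cabs_nonneg z : 0 <= Cabs z.
Proof. apply sqrt_pos. Qed.

Lemma Cabs_le_sum z : Cabs z <= Rabs (Re z) + Rabs (Im z).
Proof.
  unfold Cabs. pose proof (Rabs_pos (Re z)); pose proof (Rabs_pos (Im z)).
  rewrite <- (sqrt_pow2 (Rabs (Re z) + Rabs (Im z))) by lra.
  apply sqrt_le_1_alt. rewrite <- (pow2_abs (Re z)), <- (pow2_abs (Im z)). nra.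
Qed.

Lemma Cabs_sqr z : Cabs z * Cabs z = Re z ^ 2 + Im z ^ 2.
Proof. unfold Cabs; apply sqrt_sqrt; nra. Qed.

Lemma Rabs_Re_le z : Rabs (Re z) <= Cabs z.
Proof.
  unfold Cabs; rewrite <- (sqrt_pow2 (Rabs (Re z))) by apply Rabs_pos.
  apply sqrt_le_1_alt. rewrite pow2_abs. nra.
Qed.

Lemma Rabs_Im_le z : Rabs (Im z) <= Cabs z.
Proof.
  unfold Cabs; rewrite <- (sqrt_pow2 (Rabs (Im z))) by apply Rabs_pos.
  apply sqrt_le_1_alt. rewrite pow2_abs. nra.
Qed.

Lemma Cabs_mul a b : Cabs (Cmul a b) = Cabs a * Cabs b.
Proof.
  unfold Cabs, Cmul; simpl Re; simpl Im.
  rewrite <- sqrt_mult by nra. f_equal; ring.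
Qed.

Lemma Cabs_pos h : h <> C0 -> 0 < Cabs h.
Proof.
  intros Hh. destruct (Cabs_nonneg h) as [|E]; auto. exfalso; apply Hh.
  pose proof (Cabs_sqr h) as E2; rewrite <- E in E2.
  destruct h as [a b]; simpl in *; unfold C0; f_equal; nra.
Qed.

Lemma Cabs_div_bound N h B : h <> C0 -> Cabs N <= B * Cabs h -> Cabs (Cdiv N h) <= B.
Proof.
  intros Hh HB. pose proof (Cabs_pos h Hh) as Hp.
  assert (E : Cabs (Cdiv N h) * Cabs h = Cabs N).
  { rewrite <- Cabs_mul. f_equal. pose proof (Cabs_sqr h).
    assert (Re h ^ 2 + Im h ^ 2 <> 0) by nra.
    destruct N, h; unfold Cdiv, Cinv, Cmul; simpl in *; f_equal; field; nra. }
  apply Rmult_le_reg_r with (Cabs h); lra.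
Qed.

Lemma Re_CsumL {T} (f : T -> C) l : Re (CsumL f l) = RsumL (fun x => Re (f x)) l.
Proof. induction l; simpl; congruence. Qed.

Lemma Im_CsumL {T} (f : T -> C) l : Im (CsumL f l) = RsumL (fun x => Im (f x)) l.
Proof. induction l; simpl; congruence. Qed.

Lemma finite_join {T} (P : T -> Prop) l1 l2 :
  Forall P l1 -> Forall P l2 ->
  exists l, NoDup l /\ Forall P l /\ incl l1 l /\ incl l2 l.
Proof.
  intros H1 H2. exists (nodup eq_dec_classic (l1 ++ l2)).
  split; [apply NoDup_nodup|]. split; [|split].
  - rewrite Forall_forall in *; intros x Hx; apply nodup_In, in_app_or in Hx as [|]; auto.
  - intros x Hx; apply nodup_In, in_or_app; auto.
  - intros x Hx; apply nodup_In, in_or_app; auto.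
Qed.

(** * Unconditional sums of dominated real and complex families *)

Section Absolute.
Context {T : Type} (P : T -> Prop).

Lemma HasSumC_parts f L :
  HasSumC P f L <->
  HasSumR P (fun x => Re (f x)) (Re L) /\ HasSumR P (fun x => Im (f x)) (Im L).
Proof.
  split.
  - intros H; split; intros eps He; destruct (H eps He) as (l0 & Hn & HP & Hc);
      exists l0; (split; [|split]); auto; intros l Hn' HP' Hi;
      specialize (Hc l Hn' HP' Hi); eapply Rle_lt_trans; [|exact Hc| |exact Hc].
    + rewrite <- Re_CsumL. apply (Rabs_Re_le (Csub _ _)).
    + rewrite <- Im_CsumL. apply (Rabs_Im_le (Csub _ _)).
  - intros [H1 H2] eps He.
    destruct (H1 (eps / 2)) as (l1 & Hn1 & HP1 & Hc1); [lra|].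
    destruct (H2 (eps / 2)) as (l2 & Hn2 & HP2 & Hc2); [lra|].
    destruct (finite_join P l1 l2) as (l0 & Hn0 & HP0 & Hi1 & Hi2); auto.
    exists l0; split; [|split]; auto. intros l Hn HP Hi.
    specialize (Hc1 l Hn HP (incl_tran Hi1 Hi)).
    specialize (Hc2 l Hn HP (incl_tran Hi2 Hi)).
    eapply Rle_lt_trans; [apply Cabs_le_sum|]; simpl.
    rewrite Re_CsumL, Im_CsumL; lra.
Qed.

Lemma HasSumR_lin a b f g A B :
  HasSumR P f A -> HasSumR P g B -> HasSumR P (fun x => a * f x + b * g x) (a * A + b * B).
Proof.
  intros H1 H2 eps He.
  set (K := Rabs a + Rabs b + 1).
  assert (HK : 0 < K) by (unfold K; pose proof (Rabs_pos a); pose proof (Rabs_pos b); lra).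
  destruct (H1 (eps / K)) as (l1 & Hn1 & HP1 & Hc1); [apply Rdiv_lt_0_compat; lra|].
  destruct (H2 (eps / K)) as (l2 & Hn2 & HP2 & Hc2); [apply Rdiv_lt_0_compat; lra|].
  destruct (finite_join P l1 l2) as (l0 & Hn0 & HP0 & Hi1 & Hi2); auto.
  exists l0; split; [|split]; auto. intros l Hn HP Hi.
  specialize (Hc1 l Hn HP (incl_tran Hi1 Hi)).
  specialize (Hc2 l Hn HP (incl_tran Hi2 Hi)).
  rewrite RsumL_plus, !RsumL_scal.
  replace (a * RsumL f l + b * RsumL g l - (a * A + b * B))
    with (a * (RsumL f l - A) + b * (RsumL g l - B)) by ring.
  eapply Rle_lt_trans; [apply Rabs_triang|]. rewrite !Rabs_mult.
  assert (Rabs a * Rabs (RsumL f l - A) <= Rabs a * (eps / K))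
    by (apply Rmult_le_compat_l; [apply Rabs_pos | lra]).
  assert (Rabs b * Rabs (RsumL g l - B) <= Rabs b * (eps / K))
    by (apply Rmult_le_compat_l; [apply Rabs_pos | lra]).
  assert (eps = Rabs a * (eps / K) + Rabs b * (eps / K) + eps / K)
    by (unfold K in *; field; lra).
  assert (0 < eps / K) by (apply Rdiv_lt_0_compat; lra). lra.
Qed.

Lemma HasSumR_ext f g A :
  (forall x, P x -> f x = g x) -> HasSumR P f A -> HasSumR P g A.
Proof.
  intros E H eps He; destruct (H eps He) as (l0 & Hn & HP & Hc).
  exists l0; split; [|split]; auto. intros l Hn' HP' Hi.
  rewrite <- (RsumL_ext f g); auto. rewrite Forall_forall in HP'; auto.
Qed.

(** Adding the majorant makes the family nonnegative: [f + g] lies between [0] and [2 g], hence has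
    a sum, and [f] is recovered as [(f + g) - g]. *)
Lemma HasSumR_of_abs f g M :
  (forall x, P x -> Rabs (f x) <= g x) -> IsSum P g M -> exists L, HasSumR P f L.
Proof.
  intros H HM.
  assert (H' : forall x, P x -> - g x <= f x <= g x).
  { intros x Hx; apply Rabs_le_between, H, Hx. }
  destruct (IsSum_of_bound P (fun x => f x + g x) (2 * M)) as (A & HA & _).
  { intros l Hn HP. apply Rle_trans with (2 * RsumL g l).
    - rewrite <- RsumL_scal; apply RsumL_le. rewrite Forall_forall in HP.
      intros x Hx; specialize (H' x (HP x Hx)); lra.
    - apply Rmult_le_compat_l; [lra | apply HM; auto]. }
  exists (1 * A + (-1) * M). eapply HasSumR_ext; [|apply HasSumR_lin].
  2:{ apply IsSum_HasSumR; [|exact HA]. intros x Hx; specialize (H' x Hx); simpl; lra. }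
  2:{ apply IsSum_HasSumR; [|exact HM]. intros x Hx; specialize (H' x Hx); lra. }
  intros; simpl; ring.
Qed.

Lemma HasSumR_abs_le f g A M :
  (forall x, P x -> Rabs (f x) <= g x) -> IsSum P g M -> HasSumR P f A -> Rabs A <= M.
Proof.
  intros H HM HA. apply le_epsilon; intros eps He.
  destruct (HA eps He) as (l & Hn & HP & Hc). specialize (Hc l Hn HP (incl_refl _)).
  assert (Rabs (RsumL f l) <= RsumL g l).
  { clear - H HP. induction l as [|x l IH]; simpl; [rewrite Rabs_R0; lra|].
    apply Forall_cons_iff in HP as [Hx HP].
    eapply Rle_trans; [apply Rabs_triang|]. apply Rplus_le_compat; auto. }
  assert (RsumL g l <= M) by (apply HM; auto).
  pose proof (Rabs_triang (A - RsumL f l) (RsumL f l)) as Ht.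
  replace (A - RsumL f l + RsumL f l) with A in Ht by ring.
  rewrite Rabs_minus_sym in Ht. lra.
Qed.

Lemma HasSumC_of_abs (f : T -> C) g M :
  (forall x, P x -> Cabs (f x) <= g x) -> IsSum P g M -> exists L, HasSumC P f L.
Proof.
  intros H HM.
  destruct (HasSumR_of_abs (fun x => Re (f x)) g M) as [A HA]; auto.
  { intros x Hx; eapply Rle_trans; [apply Rabs_Re_le | auto]. }
  destruct (HasSumR_of_abs (fun x => Im (f x)) g M) as [B HB]; auto.
  { intros x Hx; eapply Rle_trans; [apply Rabs_Im_le | auto]. }
  exists (mkC A B); apply HasSumC_parts; auto.
Qed.

(** The factor [2] comes from bounding the real and imaginary parts separately; a constant is of no
    consequence for differentiability. *)
Lemma HasSumC_abs_le (f : T -> C) g A M :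
  (forall x, P x -> Cabs (f x) <= g x) -> IsSum P g M -> HasSumC P f A -> Cabs A <= 2 * M.
Proof.
  intros H HM HA; apply HasSumC_parts in HA as [H1 H2].
  eapply Rle_trans; [apply Cabs_le_sum|].
  apply (HasSumR_abs_le _ g _ M) in H1; auto.
  2:{ intros x Hx; eapply Rle_trans; [apply Rabs_Re_le | auto]. }
  apply (HasSumR_abs_le _ g _ M) in H2; auto.
  2:{ intros x Hx; eapply Rle_trans; [apply Rabs_Im_le | auto]. }
  lra.
Qed.

Lemma HasSumC_remainder f1 f0 d h A1 A0 D :
  HasSumC P f1 A1 -> HasSumC P f0 A0 -> HasSumC P d D ->
  HasSumC P (fun x => Csub (Csub (f1 x) (f0 x)) (Cmul (d x) h))
            (Csub (Csub A1 A0) (Cmul D h)).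
Proof.
  rewrite !HasSumC_parts; intros [R1 I1] [R0 I0] [RD ID]; split; simpl.
  - eapply HasSumR_ext with (f := fun x =>
      1 * (1 * Re (f1 x) + (-1) * Re (f0 x)) + (-1) * (Re h * Re (d x) + - Im h * Im (d x)));
      [intros; ring|].
    replace (Re A1 - Re A0 - (Re D * Re h - Im D * Im h)) with
      (1 * (1 * Re A1 + (-1) * Re A0) + (-1) * (Re h * Re D + - Im h * Im D)) by ring.
    apply HasSumR_lin; apply HasSumR_lin; auto.
  - eapply HasSumR_ext with (f := fun x =>
      1 * (1 * Im (f1 x) + (-1) * Im (f0 x)) + (-1) * (Im h * Re (d x) + Re h * Im (d x)));
      [intros; ring|].
    replace (Im A1 - Im A0 - (Re D * Im h + Im D * Re h)) with
      (1 * (1 * Im A1 + (-1) * Im A0) + (-1) * (Im h * Re D + Re h * Im D)) by ring.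
    apply HasSumR_lin; apply HasSumR_lin; auto.
Qed.
End Absolute.

(** * Quadratic Taylor remainders of the real and complex exponentials *)

Lemma mean_value (f f' : R -> R) a b :
  (forall x, derivable_pt_lim f x (f' x)) ->
  exists c, f b - f a = f' c * (b - a) /\ Rmin a b <= c <= Rmax a b.
Proof.
  intros H. destruct (Rtotal_order a b) as [Hab|[Hab|Hab]].
  - destruct (MVT_cor2 f f' a b Hab) as (c & E & Hc); [intros; apply H|].
    exists c; rewrite Rmin_left, Rmax_right by lra; split; [exact E | lra].
  - subst; exists b; rewrite Rmin_left, Rmax_left by lra; split; [ring | lra].
  - destruct (MVT_cor2 f f' b a Hab) as (c & E & Hc); [intros; apply H|].
    exists c; rewrite Rmin_right, Rmax_left by lra; split; [lra | lra].
Qed.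

Lemma between_0_abs x c : Rmin 0 x <= c <= Rmax 0 x -> Rabs c <= Rabs x.
Proof.
  unfold Rmin, Rmax; destruct (Rle_dec 0 x); intros; unfold Rabs;
  destruct (Rcase_abs c), (Rcase_abs x); lra.
Qed.

Lemma exp_le_exp x y : x <= y -> exp x <= exp y.
Proof. intros [H| ->]; [left; apply exp_increasing; auto | lra]. Qed.

Lemma exp_sub1_bound x : Rabs (exp x - 1) <= Rabs x * exp (Rabs x).
Proof.
  destruct (mean_value exp exp 0 x derivable_pt_lim_exp) as (c & E & Hc).
  rewrite exp_0 in E; rewrite E, Rminus_0_r, Rabs_mult, Rmult_comm.
  apply Rmult_le_compat_l; [apply Rabs_pos|].
  rewrite Rabs_right by (left; apply exp_pos). apply exp_le_exp.
  eapply Rle_trans; [apply Rle_abs | apply between_0_abs, Hc].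
Qed.

Lemma exp_remainder_bound x : Rabs (exp x - 1 - x) <= x ^ 2 * exp (Rabs x).
Proof.
  destruct (mean_value (fun x => exp x - x) (fun x => exp x - 1) 0 x) as (c & E & Hc).
  { intros t; apply derivable_pt_lim_minus; [apply derivable_pt_lim_exp | apply derivable_pt_lim_id]. }
  rewrite exp_0 in E. replace (exp x - 1 - x) with ((exp c - 1) * (x - 0)) by lra.
  rewrite Rminus_0_r, Rabs_mult. apply between_0_abs in Hc.
  pose proof (exp_sub1_bound c). pose proof (exp_le_exp _ _ Hc).
  rewrite <- pow2_abs. pose proof (Rabs_pos c). pose proof (Rabs_pos x).
  pose proof (exp_pos (Rabs c)).
  assert (Rabs c * exp (Rabs c) <= Rabs x * exp (Rabs x)) by nra. nra.
Qed.

Lemma cos_sub1_bound y : Rabs (cos y - 1) <= y ^ 2.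
Proof.
  destruct (mean_value cos (fun t => - sin t) 0 y derivable_pt_lim_cos) as (c & E & Hc).
  destruct (mean_value sin cos 0 c derivable_pt_lim_sin) as (c' & E' & _).
  rewrite cos_0 in E; rewrite sin_0 in E'. apply between_0_abs in Hc.
  rewrite E, Rminus_0_r, Rabs_mult, Rabs_Ropp.
  replace (sin c) with (cos c' * c) by lra. rewrite Rabs_mult, <- (pow2_abs y).
  assert (Rabs (cos c') <= 1) by (apply Rabs_le; pose proof (COS_bound c'); lra).
  pose proof (Rabs_pos c); pose proof (Rabs_pos y); pose proof (Rabs_pos (cos c')).
  assert (Rabs (cos c') * Rabs c <= Rabs y) by nra. nra.
Qed.

Lemma sin_sub_bound y : Rabs (sin y - y) <= 2 * y ^ 2.
Proof.
  destruct (mean_value sin cos 0 y derivable_pt_lim_sin) as (c & E & Hc).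
  rewrite sin_0 in E. apply between_0_abs in Hc.
  replace (sin y - y) with ((cos c - 1) * y) by lra. rewrite Rabs_mult, <- (pow2_abs y).
  pose proof (cos_sub1_bound c) as H1; rewrite <- pow2_abs in H1.
  assert (H2 : Rabs (cos c - 1) <= 2) by (apply Rabs_le; pose proof (COS_bound c); lra).
  pose proof (Rabs_pos c); pose proof (Rabs_pos y); pose proof (Rabs_pos (cos c - 1)).
  assert (Rabs (cos c - 1) <= 2 * Rabs y); [|nra].
  (* For [|y| <= 1] the quadratic bound on [cos c - 1] is at most [|y|]; otherwise the trivial bound
     [2] is at most [2 |y|]. *)
  destruct (Rle_dec (Rabs y) 1); nra.
Qed.

(** This is [|e^z - 1 - z| <= 5 |z|^2 e^|x|] for [z = x + i y]. Real and imaginary parts are split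
    so that only the one-variable remainders enter; the coefficients [2] of [x^2] and [4] of [y^2]
    that result are rounded up to [5]. *)
Lemma Cexp_remainder_bound x y :
  Cabs (mkC (exp x * cos y - 1 - x) (exp x * sin y - y)) <= 5 * (x ^ 2 + y ^ 2) * exp (Rabs x).
Proof.
  eapply Rle_trans; [apply Cabs_le_sum|]; simpl Re; simpl Im.
  replace (exp x * cos y - 1 - x) with ((exp x - 1 - x) + exp x * (cos y - 1)) by ring.
  replace (exp x * sin y - y) with (exp x * (sin y - y) + y * (exp x - 1)) by ring.
  pose proof (exp_remainder_bound x) as H1. pose proof (cos_sub1_bound y) as H2.
  pose proof (sin_sub_bound y) as H3. pose proof (exp_sub1_bound x) as H4.
  assert (H5 : exp x <= exp (Rabs x)) by (apply exp_le_exp, Rle_abs).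
  pose proof (exp_pos x) as H6. pose proof (Rabs_pos x). pose proof (Rabs_pos y).
  assert (G1 : Rabs ((exp x - 1 - x) + exp x * (cos y - 1))
    <= x ^ 2 * exp (Rabs x) + exp (Rabs x) * y ^ 2).
  { eapply Rle_trans; [apply Rabs_triang|]. rewrite Rabs_mult, (Rabs_right (exp x)) by lra.
    apply Rplus_le_compat; auto. apply Rmult_le_compat; try lra. apply Rabs_pos. }
  assert (G2 : Rabs (exp x * (sin y - y) + y * (exp x - 1))
    <= exp (Rabs x) * (2 * y ^ 2) + Rabs y * (Rabs x * exp (Rabs x))).
  { eapply Rle_trans; [apply Rabs_triang|].
    rewrite !Rabs_mult, (Rabs_right (exp x)) by lra.
    apply Rplus_le_compat; apply Rmult_le_compat; try lra; apply Rabs_pos. }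
  assert (G3 : Rabs y * Rabs x <= x ^ 2 + y ^ 2).
  { rewrite <- (pow2_abs x), <- (pow2_abs y). nra. }
  assert (0 < exp (Rabs x)) by apply exp_pos. nra.
Qed.

(** With [z = - h ln w] this is [w^(-s-h) - w^(-s) + h ln w w^(-s) = w^(-s) (e^z - 1 - z)], which
    reduces differentiation of a term to the Taylor remainder of the exponential. *)
Lemma cpowneg_remainder w s h :
  Csub (Csub (cpowneg w (Cadd s h)) (cpowneg w s))
       (Cmul (Cmul (mkC (- ln w) 0) (cpowneg w s)) h) =
  Cmul (cpowneg w s)
    (mkC (exp (- Re h * ln w) * cos (- Im h * ln w) - 1 - (- Re h * ln w))
         (exp (- Re h * ln w) * sin (- Im h * ln w) - (- Im h * ln w))).
Proof.
  unfold cpowneg; simpl.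
  replace (- (Re s + Re h) * ln w) with (- Re s * ln w + - Re h * ln w) by ring.
  replace ((Im s + Im h) * ln w) with (Im s * ln w - (- Im h * ln w)) by ring.
  rewrite exp_plus, cos_minus, sin_minus.
  unfold Csub, Cmul; simpl; f_equal; ring.
Qed.

Lemma Cabs_cpowneg w s : Cabs (cpowneg w s) = Rpower w (- Re s).
Proof.
  unfold Cabs, cpowneg, Rpower; simpl Re; simpl Im.
  set (E := exp (- Re s * ln w)). set (t := Im s * ln w).
  replace ((E * cos t) ^ 2 + (- (E * sin t)) ^ 2) with (E ^ 2).
  - apply sqrt_pow2. left; apply exp_pos.
  - pose proof (sin2_cos2 t) as H; unfold Rsqr in H.
    replace (E ^ 2) with (E ^ 2 * (sin t * sin t + cos t * cos t)) by (rewrite H; ring). ring.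
Qed.

(** Squaring [eta lam <= e^(eta lam)]. For [lam = ln w] it says that [(ln w)^2] is absorbed by the
    small power [w^(2 eta)]. *)
Lemma sqr_le_exp eta lam : 0 < eta -> 0 <= lam -> lam ^ 2 <= exp (2 * eta * lam) / eta ^ 2.
Proof.
  intros He Hl. pose proof (exp_ineq1_le (eta * lam)) as H.
  replace (2 * eta * lam) with (eta * lam + eta * lam) by ring. rewrite exp_plus.
  assert (0 <= eta * lam) by nra.
  assert ((eta * lam) * (eta * lam) <= exp (eta * lam) * exp (eta * lam)) by nra.
  apply Rmult_le_reg_r with (eta ^ 2); [nra|].
  unfold Rdiv; rewrite Rmult_assoc, Rinv_l by nra. nra.
Qed.

(** * Termwise differentiation of a Dirichlet series with weights at least [1] *)

Section Analytic.
Context {T : Type} (P : T -> Prop) (w : T -> R).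
Hypothesis Hw : forall x, P x -> 1 <= w x.
Hypothesis Hsum : forall s, 1 < s -> exists L, IsSum P (fun x => Rpower (w x) (- s)) L.

Lemma ln_weight_nonneg x : P x -> 0 <= ln (w x).
Proof.
  intros Hx; rewrite <- ln_1. destruct (Hw x Hx) as [H|H].
  - left; apply ln_increasing; lra.
  - rewrite <- H; lra.
Qed.

Lemma dirichlet_AbsConv : AbsConvRe1 P w.
Proof.
  intros s Hs; destruct (Hsum _ Hs) as [L HL]; exists L.
  apply IsSum_HasSumR; [intros; apply Cabs_nonneg|].
  eapply IsSum_ext; [| |exact HL]; [tauto | intros; simpl; rewrite Cabs_cpowneg; auto].
Qed.

Lemma dirichlet_HasSumC s : 1 < Re s -> exists L, HasSumC P (fun x => cpowneg (w x) s) L.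
Proof.
  intros Hs; destruct (Hsum _ Hs) as [L HL].
  eapply HasSumC_of_abs; [|exact HL]. intros x Hx; rewrite Cabs_cpowneg; apply Rle_refl.
Qed.

(** The inequality [1 + t <= e^t] gives [ln w <= w^eta / eta]: the logarithm from differentiation
    costs only [eta] in the exponent. *)
Lemma deriv_term_bound x s eta :
  P x -> 0 < eta ->
  Cabs (Cmul (mkC (- ln (w x)) 0) (cpowneg (w x) s))
    <= / eta * Rpower (w x) (- (Re s - eta)).
Proof.
  intros Hx He. rewrite Cabs_mul, Cabs_cpowneg.
  pose proof (ln_weight_nonneg x Hx) as Hl. set (lam := ln (w x)) in *.
  replace (Cabs (mkC (- lam) 0)) with lam.
  2:{ unfold Cabs; simpl Re; simpl Im. replace ((- lam) ^ 2 + 0 ^ 2) with (lam ^ 2) by ring.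
      rewrite sqrt_pow2; auto. }
  unfold Rpower; fold lam.
  replace (- (Re s - eta) * lam) with (eta * lam + - Re s * lam) by ring.
  rewrite exp_plus, <- Rmult_assoc. apply Rmult_le_compat_r; [left; apply exp_pos|].
  apply Rmult_le_reg_l with eta; auto. rewrite <- Rmult_assoc, Rinv_r by lra.
  pose proof (exp_ineq1_le (eta * lam)). lra.
Qed.

(** The exponent loses [3 eta]: two for the factor [(ln w)^2] of the quadratic remainder, one for
    [e^(|Re h| ln w) <= w^eta]. *)
Lemma remainder_term_bound x s h eta :
  P x -> 0 < eta -> Cabs h <= eta ->
  Cabs (Csub (Csub (cpowneg (w x) (Cadd s h)) (cpowneg (w x) s))
       (Cmul (Cmul (mkC (- ln (w x)) 0) (cpowneg (w x) s)) h))
  <= (5 * (Cabs h * Cabs h) / eta ^ 2) * Rpower (w x) (- (Re s - 3 * eta)).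
Proof.
  intros Hx He Hh. rewrite cpowneg_remainder, Cabs_mul, Cabs_cpowneg.
  pose proof (ln_weight_nonneg x Hx) as Hl. unfold Rpower. set (lam := ln (w x)) in *.
  pose proof (Cexp_remainder_bound (- Re h * lam) (- Im h * lam)) as Hb.
  set (Z := Cabs (mkC (exp (- Re h * lam) * cos (- Im h * lam) - 1 - - Re h * lam)
          (exp (- Re h * lam) * sin (- Im h * lam) - - Im h * lam))) in *.
  replace ((- Re h * lam) ^ 2 + (- Im h * lam) ^ 2) with (Cabs h * Cabs h * lam ^ 2) in Hb
    by (rewrite Cabs_sqr; ring).
  assert (H1 : exp (Rabs (- Re h * lam)) <= exp (eta * lam)).
  { apply exp_le_exp. rewrite Rabs_mult, Rabs_Ropp, (Rabs_right lam) by lra.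
    apply Rmult_le_compat_r; auto. eapply Rle_trans; [apply Rabs_Re_le | auto]. }
  pose proof (sqr_le_exp eta lam He Hl) as H2.
  replace (- (Re s - 3 * eta) * lam) with (- Re s * lam + (2 * eta * lam + eta * lam)) by ring.
  rewrite !exp_plus.
  set (A := exp (- Re s * lam)). assert (0 < A) by apply exp_pos.
  set (B := exp (2 * eta * lam)) in *. set (D := exp (eta * lam)) in *.
  assert (0 < D) by apply exp_pos.
  pose proof (Cabs_nonneg h). pose proof (exp_pos (Rabs (- Re h * lam))).
  assert (Z <= 5 * (Cabs h * Cabs h) * (B / eta ^ 2) * D).
  { eapply Rle_trans; [exact Hb|]. apply Rmult_le_compat; try lra; [|nra].
    apply Rmult_le_pos; [lra|]. apply Rmult_le_pos; nra. }
  replace (5 * (Cabs h * Cabs h) / eta ^ 2 * (A * (B * D)))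
    with (A * (5 * (Cabs h * Cabs h) * (B / eta ^ 2) * D)) by (field; lra).
  apply Rmult_le_compat_l; lra.
Qed.

(** The termwise remainders are [O(|h|^2)] with a summable majorant independent of [h]. Hence their
    sum divided by [h] tends to [0], and the sum of the termwise derivatives is the derivative. *)
Lemma dirichlet_Analytic : AnalyticRe1 P w.
Proof.
  set (F := fun s => epsilon (inhabits C0) (HasSumC P (fun x => cpowneg (w x) s))).
  assert (HF : forall s, 1 < Re s -> HasSumC P (fun x => cpowneg (w x) s) (F s)).
  { intros s Hs; apply epsilon_spec, dirichlet_HasSumC, Hs. }
  exists F; split; [exact HF|].
  (* A quarter of the distance to the line [Re = 1]: the worst exponent [Re s - 3 eta] equals
     [1 + eta], and [s + h] stays in the half-plane for [|h| < eta]. *)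
  intros s Hs. set (eta := (Re s - 1) / 4). assert (He : 0 < eta) by (unfold eta; lra).
  destruct (Hsum (Re s - eta)) as [L1 HL1]; [unfold eta; lra|].
  destruct (Hsum (Re s - 3 * eta)) as [M HM]; [unfold eta; lra|].
  destruct (HasSumC_of_abs P (fun x => Cmul (mkC (- ln (w x)) 0) (cpowneg (w x) s)) _ _
    (fun x Hx => deriv_term_bound x s eta Hx He)
    (IsSum_scal _ _ _ (/ eta) (Rlt_le _ _ (Rinv_0_lt_compat _ He)) HL1)) as [D HD].
  exists D. intros eps Heps.
  pose proof (IsSum_nonneg _ _ _ HM) as HM0.
  (* [10] is the [5] of the Taylor bound times the [2] lost in summing complex families; [+ 1] keeps
     [K] positive when [M = 0]. *)
  set (K := 10 * M / eta ^ 2 + 1).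
  assert (HK : 0 < K).
  { unfold K. assert (0 <= 10 * M / eta ^ 2); [|lra].
    apply Rmult_le_pos; [lra|]. left; apply Rinv_0_lt_compat; nra. }
  exists (Rmin eta (eps / K)); split.
  { apply Rmin_glb_lt; auto. apply Rdiv_lt_0_compat; auto. }
  intros h Hh Hd.
  assert (Hd1 : Cabs h < eta) by (eapply Rlt_le_trans; [exact Hd | apply Rmin_l]).
  assert (Hd2 : Cabs h < eps / K) by (eapply Rlt_le_trans; [exact Hd | apply Rmin_r]).
  pose proof (Cabs_pos h Hh) as Hp.
  assert (Hs' : 1 < Re (Cadd s h)).
  { simpl. pose proof (Rabs_Re_le h) as Hr.
    assert (Rabs (Re h) <= eta) as Hr' by lra. apply Rabs_le_between in Hr'.
    unfold eta in *; lra. }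
  pose proof (HasSumC_remainder P _ _ _ h _ _ _ (HF _ Hs') (HF _ Hs) HD) as HN.
  set (N := Csub (Csub (F (Cadd s h)) (F s)) (Cmul D h)) in *.
  assert (HN' : Cabs N <= 2 * ((5 * (Cabs h * Cabs h) / eta ^ 2) * M)).
  { eapply HasSumC_abs_le; [| |exact HN].
    - intros x Hx; apply remainder_term_bound with (eta := eta); auto; lra.
    - apply IsSum_scal; auto. apply Rmult_le_pos; [nra|].
      left; apply Rinv_0_lt_compat; nra. }
  replace (Csub (Cdiv (Csub (F (Cadd s h)) (F s)) h) D) with (Cdiv N h).
  2:{ unfold N. pose proof (Cabs_sqr h) as E2.
      assert (Re h ^ 2 + Im h ^ 2 <> 0) by nra.
      destruct (Csub (F (Cadd s h)) (F s)), D, h.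
      unfold Cdiv, Cinv, Cmul, Csub; simpl in *; f_equal; field; nra. }
  apply Rle_lt_trans with (K * Cabs h).
  - apply Cabs_div_bound; auto. eapply Rle_trans; [exact HN'|].
    replace (2 * (5 * (Cabs h * Cabs h) / eta ^ 2 * M))
      with ((10 * M / eta ^ 2) * Cabs h * Cabs h) by (field; lra).
    unfold K. nra.
  - apply Rlt_le_trans with (K * (eps / K)).
    + apply Rmult_lt_compat_l; auto.
    + right; field; lra.
Qed.
End Analytic.

(** * Poles at [s = 1] *)

Lemma limit_right_iff f l :
  limit1_in f (fun s => 1 < s) l 1 <->
  (forall eps, 0 < eps -> exists delta, 0 < delta /\
     forall s, 1 < s < 1 + delta -> Rabs (f s - l) < eps).
Proof.
  split; intros H eps He; destruct (H eps He) as (d & Hd & Hc); exists d; split; auto.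
  - intros s Hs; apply Hc. split; [lra|]. simpl; unfold Rdist; apply Rabs_def1; lra.
  - intros s [Hs1 Hs2]. simpl in *; unfold Rdist in *. apply Rabs_def2 in Hs2.
    apply Hc; lra.
Qed.

Lemma limit_right_ext f g l :
  (forall s, 1 < s -> f s = g s) ->
  limit1_in f (fun s => 1 < s) l 1 -> limit1_in g (fun s => 1 < s) l 1.
Proof.
  intros E; rewrite !limit_right_iff; intros H eps He.
  destruct (H eps He) as (d & Hd & Hc); exists d; split; auto.
  intros s Hs; rewrite <- E by lra; auto.
Qed.

Lemma limit_right_squeeze f g h l :
  (forall s, 1 < s -> f s <= g s <= h s) ->
  limit1_in f (fun s => 1 < s) l 1 -> limit1_in h (fun s => 1 < s) l 1 ->
  limit1_in g (fun s => 1 < s) l 1.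
Proof.
  intros E; rewrite !limit_right_iff; intros Hf Hh eps He.
  destruct (Hf eps He) as (d1 & Hd1 & Hc1); destruct (Hh eps He) as (d2 & Hd2 & Hc2).
  exists (Rmin d1 d2); split; [apply Rmin_glb_lt; auto|]. intros s Hs.
  pose proof (Rmin_l d1 d2); pose proof (Rmin_r d1 d2).
  assert (A1 : 1 < s < 1 + d1) by lra. assert (A2 : 1 < s < 1 + d2) by lra.
  apply Hc1, Rabs_def2 in A1; apply Hc2, Rabs_def2 in A2.
  specialize (E s ltac:(lra)). apply Rabs_def1; lra.
Qed.

Lemma limit_right_continuous f l :
  continuity_pt f 1 -> f 1 = l -> limit1_in f (fun s => 1 < s) l 1.
Proof.
  intros H <- eps He. destruct (H eps He) as (d & Hd & Hc); exists d; split; auto.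
  intros s [Hs1 Hs2]; apply Hc; split; auto. split; [exact I|]. intros E; lra.
Qed.

(** Convergence for every real [s > 1] is bundled with the limit, because both travel together
    through reindexing, unions, products and quotients. The value [l] is explicit since these
    operations act on it. *)
Definition HasPole {T} (P : T -> Prop) (w : T -> R) (mu : nat) (l : R) : Prop :=
  0 < l /\ exists Z : R -> R,
    (forall s, 1 < s -> IsSum P (fun x => Rpower (w x) (- s)) (Z s)) /\
    limit1_in (fun s => (s - 1) ^ mu * Z s) (fun s => 1 < s) l 1.

Lemma Rpower_pos x y : 0 < Rpower x y.
Proof. apply exp_pos. Qed.

(** Real [s > 1] decides everything: [|w^(-s)|] depends only on [Re s], which gives absolute
    convergence, and the same sums at nearby real exponents dominate the derivatives. *)
Lemma HasPole_DirichletProps {T} (P : T -> Prop) w mu l :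
  (forall x, P x -> 1 <= w x) -> HasPole P w mu l -> DirichletProps P w mu.
Proof.
  intros Hw (Hl & Z & HZ & Hlim).
  assert (Hs : forall s, 1 < s -> exists L, IsSum P (fun x => Rpower (w x) (- s)) L) by eauto.
  split; [|split].
  - apply dirichlet_AbsConv; auto.
  - apply dirichlet_Analytic; auto.
  - exists l; split; auto. intros eps He.
    apply limit_right_iff with (eps := eps) in Hlim as (d & Hd & Hc); auto.
    exists d; split; auto. intros sg L Hsg HL.
    replace L with (Z sg); [apply Hc; auto|].
    eapply IsSum_unique; [apply HZ; lra|].
    apply IsSum_HasSumR; [intros; left; apply Rpower_pos|].
    eapply HasSumR_ext; [|exact HL]. intros; simpl. apply Rabs_right.
    left; apply Rpower_pos.
Qed.

Lemma HasPole_bij {T U} (P : T -> Prop) (Q : U -> Prop) (h : T -> U) v w mu l :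
  (forall x, P x -> Q (h x)) ->
  (forall x y, P x -> P y -> h x = h y -> x = y) ->
  (forall y, Q y -> exists x, P x /\ h x = y) ->
  (forall x, P x -> v x = w (h x)) ->
  HasPole P v mu l <-> HasPole Q w mu l.
Proof.
  intros H1 H2 H3 E.
  split; intros (Hl & Z & HZ & Hlim); (split; [exact Hl|]); exists Z; split; auto; intros s Hs.
  - apply (IsSum_bij P Q h (fun y => Rpower (w y) (- s)) (Z s) H1 H2 H3).
    eapply IsSum_ext; [| |apply HZ, Hs]; [tauto|]. intros x Hx; simpl; rewrite E; auto.
  - specialize (HZ s Hs).
    apply (IsSum_bij P Q h (fun y => Rpower (w y) (- s)) (Z s) H1 H2 H3) in HZ.
    eapply IsSum_ext; [| |apply HZ]; [tauto|]. intros x Hx; simpl; rewrite E; auto.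
Qed.

Lemma HasPole_ext {T} (P Q : T -> Prop) v w mu l :
  (forall x, P x <-> Q x) -> (forall x, P x -> v x = w x) ->
  HasPole P v mu l -> HasPole Q w mu l.
Proof.
  intros H E. apply (HasPole_bij P Q (fun x => x)); auto.
  - intros x; apply H.
  - intros y Hy; exists y; split; auto; apply H; auto.
Qed.

Lemma HasPole_union {T} (P Q : T -> Prop) w mu l1 l2 :
  (forall x, P x -> Q x -> False) ->
  HasPole P w mu l1 -> HasPole Q w mu l2 -> HasPole (fun x => P x \/ Q x) w mu (l1 + l2).
Proof.
  intros Hd (Hl1 & Z1 & HZ1 & Hlim1) (Hl2 & Z2 & HZ2 & Hlim2). split; [lra|].
  exists (fun s => Z1 s + Z2 s); split.
  - intros s Hs; apply IsSum_union; auto.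
  - eapply limit_right_ext; [|apply (limit_plus _ _ _ _ _ _ Hlim1 Hlim2)].
    intros; simpl; ring.
Qed.

(** The series gets multiplied by [c^(-s)], which tends to [1 / c]. *)
Lemma HasPole_scale {T} (P : T -> Prop) w mu l c :
  0 < c -> (forall x, P x -> 0 < w x) -> HasPole P w mu l ->
  HasPole P (fun x => c * w x) mu (/ c * l).
Proof.
  intros Hc Hw (Hl & Z & HZ & Hlim). split.
  { apply Rmult_lt_0_compat; auto; apply Rinv_0_lt_compat; auto. }
  exists (fun s => Rpower c (- s) * Z s); split.
  - intros s Hs.
    eapply IsSum_ext; [| |apply IsSum_scal; [|apply HZ, Hs]]; [tauto| |].
    + intros x Hx; simpl. apply Rpower_mult_distr; auto.
    + left; apply Rpower_pos.
  - eapply limit_right_ext; [|apply (limit_mul (fun s => Rpower c (- s)) _ _ _ _ _) with (2 := Hlim)].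
    + intros; simpl; ring.
    + apply limit_right_continuous.
      * unfold Rpower; reg.
      * rewrite Rpower_Ropp, Rpower_1; auto.
Qed.

Lemma HasPole_prod {T U} (P : T -> Prop) (Q : U -> Prop) v w mu nu l1 l2 :
  (forall x, P x -> 0 < v x) -> (forall x, Q x -> 0 < w x) ->
  HasPole P v mu l1 -> HasPole Q w nu l2 ->
  HasPole (fun z => P (fst z) /\ Q (snd z)) (fun z => v (fst z) * w (snd z)) (mu + nu) (l1 * l2).
Proof.
  intros Hv Hw (Hl1 & Z1 & HZ1 & Hlim1) (Hl2 & Z2 & HZ2 & Hlim2).
  split; [apply Rmult_lt_0_compat; auto|].
  exists (fun s => Z1 s * Z2 s); split.
  - intros s Hs.
    eapply IsSum_ext; [| |apply (IsSum_product _ _ _ _ _ _) with (2 := HZ1 s Hs) (3 := HZ2 s Hs)].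
    + tauto.
    + intros [x y] [Hx Hy]; simpl in *. apply Rpower_mult_distr; auto.
    + intros; left; apply Rpower_pos.
  - eapply limit_right_ext; [|apply (limit_mul _ _ _ _ _ _ Hlim1 Hlim2)].
    intros s _; simpl. rewrite pow_add; ring.
Qed.

(** * Sums over arithmetic progressions *)

Lemma IsSum_nat_of_bound (g : nat -> R) M :
  (forall k, 0 <= g k) -> (forall N, RsumL g (seq 0 N) <= M) ->
  exists L, IsSum (fun _ => True) g L /\ L <= M.
Proof.
  intros H0 HM. apply IsSum_of_bound. intros l Hn _.
  apply Rle_trans with (RsumL g (seq 0 (S (list_max l)))); [|apply HM].
  apply RsumL_incl; auto. intros k Hk. apply in_seq.
  assert (H := proj1 (list_max_le l (list_max l)) (le_n _)).
  rewrite Forall_forall in H; specialize (H k Hk); lia.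
Qed.

Lemma RsumL_seq_S (g : nat -> R) N : RsumL g (seq 0 (S N)) = RsumL g (seq 0 N) + g N.
Proof. rewrite seq_S, RsumL_app; simpl; ring. Qed.

Lemma Rpower_neg_le_base x y t : 0 < x -> x <= y -> 0 <= t -> Rpower y (- t) <= Rpower x (- t).
Proof.
  intros Hx Hxy Ht. unfold Rpower; apply exp_le_exp.
  assert (ln x <= ln y).
  { destruct Hxy as [H| ->]; [left; apply ln_increasing; auto | lra]. }
  nra.
Qed.

Lemma Rpower_base1 t : Rpower 1 t = 1.
Proof. unfold Rpower; rewrite ln_1, Rmult_0_r; apply exp_0. Qed.

(** The mean value theorem for [x^(1 - t)]: one step of the comparison of a sum with the integral of
    [x^(-t)]. *)
Lemma Rpower_increment x h t :
  0 < x -> 0 < h -> 1 < t ->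
  (t - 1) * h * Rpower (x + h) (- t) <= Rpower x (1 - t) - Rpower (x + h) (1 - t)
    <= (t - 1) * h * Rpower x (- t).
Proof.
  intros Hx Hh Ht.
  destruct (MVT_cor2 (fun x => Rpower x (1 - t)) (fun x => (1 - t) * Rpower x (1 - t - 1))
    x (x + h)) as (c & E & Hc); [lra| |].
  { intros c Hc; apply derivable_pt_lim_power; lra. }
  replace (1 - t - 1) with (- t) in E by ring. simpl in E.
  replace (Rpower x (1 - t) - Rpower (x + h) (1 - t)) with ((t - 1) * h * Rpower c (- t))
    by lra.
  assert (0 < (t - 1) * h) by nra.
  split; apply Rmult_le_compat_l; try lra; apply Rpower_neg_le_base; lra.
Qed.

Lemma Rpower_neg_small e eps : 0 < e -> 0 < eps ->
  exists A, 0 < A /\ forall x, A <= x -> Rpower x (- e) < eps.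
Proof.
  intros He Heps. exists (exp ((1 - ln eps) / e)); split; [apply exp_pos|].
  intros x Hx. unfold Rpower. rewrite <- (exp_ln eps) by auto. apply exp_increasing.
  assert (H : (1 - ln eps) / e <= ln x).
  { rewrite <- (ln_exp ((1 - ln eps) / e)).
    destruct Hx as [Hx| <-]; [left; apply ln_increasing; auto; apply exp_pos | lra]. }
  apply Rmult_le_compat_l with (r := e) in H; [|lra].
  replace (e * ((1 - ln eps) / e)) with (1 - ln eps) in H by (field; lra). lra.
Qed.

Section Progression.
Variables mu i : nat.
Hypothesis Hmu : (1 <= mu)%nat.
Hypothesis Hi : (1 <= i)%nat.

Definition prog (k : nat) : R := INR (mu * k + i).

Lemma prog_ge1 k : 1 <= prog k.
Proof using Hi. clear Hmu; apply (le_INR 1); lia. Qed.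

Lemma prog_S k : prog (S k) = prog k + INR mu.
Proof. unfold prog; rewrite <- plus_INR; f_equal; lia. Qed.

Lemma step_ge1 : 1 <= INR mu.
Proof using Hmu. clear Hi; apply (le_INR 1); lia. Qed.

Lemma prog_zeta t : 1 < t -> exists L,
  IsSum (fun _ => True) (fun k => Rpower (prog k) (- t)) L /\
  Rpower (INR i) (1 - t) <= (t - 1) * INR mu * L <= Rpower (INR i) (1 - t) + (t - 1) * INR mu.
Proof.
  intros Ht. pose proof step_ge1 as Hm.
  set (g := fun k => Rpower (prog k) (- t)).
  set (q := (t - 1) * INR mu). assert (Hq : 0 < q) by (unfold q; nra).
  assert (Hp0 : prog 0 = INR i) by (unfold prog; f_equal; lia).
  assert (Hstep : forall k, q * g (S k) <= Rpower (prog k) (1 - t) - Rpower (prog (S k)) (1 - t) <= q * g k).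
  { intros k; unfold g, q; rewrite prog_S; apply Rpower_increment; auto; try lra.
    pose proof (prog_ge1 k); lra. }
  assert (Hlow : forall N, Rpower (INR i) (1 - t) - Rpower (prog N) (1 - t) <= q * RsumL g (seq 0 N)).
  { induction N as [|N IH].
    - simpl; rewrite Hp0; lra.
    - rewrite RsumL_seq_S. specialize (Hstep N). lra. }
  assert (Hup : forall N, q * RsumL g (seq 0 (S N)) <=
     q * g 0%nat + Rpower (INR i) (1 - t) - Rpower (prog N) (1 - t)).
  { induction N as [|N IH].
    - simpl; rewrite Hp0; lra.
    - rewrite RsumL_seq_S. specialize (Hstep N). lra. }
  assert (Hg0 : g 0%nat <= 1).
  { unfold g. rewrite <- (Rpower_base1 (- t)). apply Rpower_neg_le_base; try lra. apply prog_ge1. }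
  assert (Hg : forall k, 0 <= g k) by (intros; left; apply Rpower_pos).
  destruct (IsSum_nat_of_bound g ((Rpower (INR i) (1 - t) + q) / q)) as (L & HL & HLM).
  { exact Hg. }
  { intros N. apply Rle_trans with (RsumL g (seq 0 (S N))).
    - rewrite RsumL_seq_S. specialize (Hg N); lra.
    - apply Rmult_le_reg_l with q; auto.
      replace (q * ((Rpower (INR i) (1 - t) + q) / q)) with (Rpower (INR i) (1 - t) + q)
        by (field; lra).
      specialize (Hup N). pose proof (Rpower_pos (prog N) (1 - t)). nra. }
  exists L; split; [exact HL|]. fold q. split.
  (* The telescoped sum stops at [prog N]; its boundary term [(prog N)^(1 - t)] falls below any
     [eps] for large [N]. *)
  - apply le_epsilon; intros eps He.
    destruct (Rpower_neg_small (t - 1) eps) as (A & HA & Hs); [lra|auto|].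
    destruct (INR_unbounded A) as [N HN].
    assert (HNp : A <= prog N).
    { apply Rle_trans with (INR N); [lra|]. unfold prog; apply le_INR; nia. }
    apply Hs in HNp. replace (- (t - 1)) with (1 - t) in HNp by ring.
    specialize (Hlow N).
    assert (RsumL g (seq 0 N) <= L).
    { apply HL; [apply seq_NoDup | apply Forall_forall; auto]. }
    nra.
  - apply Rmult_le_compat_l with (r := q) in HLM; [|lra].
    replace (q * ((Rpower (INR i) (1 - t) + q) / q)) with (Rpower (INR i) (1 - t) + q) in HLM
      by (field; lra). exact HLM.
Qed.

(** A bound uniform in [t], for the error series [sum m^(-2s)], whose exponent stays at least [2] as
    [s] tends to [1]. *)
Lemma prog_zeta_le2 t : 2 <= t -> exists L,
  IsSum (fun _ => True) (fun k => Rpower (prog k) (- t)) L /\ L <= 2.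
Proof.
  intros Ht. destruct (prog_zeta t) as (L & HL & _ & Hu); [lra|].
  exists L; split; auto.
  assert (Rpower (INR i) (1 - t) <= 1).
  { rewrite <- (Rpower_base1 (- (t - 1))) at 2. replace (1 - t) with (- (t - 1)) by ring.
    apply Rpower_neg_le_base; try lra. apply (le_INR 1); lia. }
  pose proof step_ge1. assert (1 <= (t - 1) * INR mu) by nra. nra.
Qed.
End Progression.

(** * Lattice points in a cone *)

Lemma RsumL_seq_telescope (h : nat -> R) (F : nat -> R) e lo d :
  (forall l, (lo <= l < lo + d)%nat -> Rabs (h l - (F (S l) - F l)) <= e) ->
  Rabs (RsumL h (seq lo d) - (F (lo + d)%nat - F lo)) <= INR d * e.
Proof.
  induction d as [|d IH]; intros H.
  - simpl. rewrite Nat.add_0_r. unfold Rminus; rewrite Rplus_opp_r, Ropp_0, Rplus_0_r, Rabs_R0; lra.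
  - rewrite seq_S, RsumL_app, S_INR; simpl.
    specialize (IH (fun l Hl => H l ltac:(lia))). specialize (H (lo + d)%nat ltac:(lia)).
    replace (lo + S d)%nat with (S (lo + d)) by lia.
    apply Rabs_le_between in IH; apply Rabs_le_between in H. apply Rabs_le. lra.
Qed.

(** * One row of a cone at a time: Riemann sums for [1 / g] *)

Section Cone.
Variables mu i j : nat.
Variables lo hi : nat -> nat.
Variables g G : R -> R.
Variables al be d0 e0 : R.
Hypothesis Hmu : (1 <= mu)%nat.
Hypothesis Hi : (1 <= i)%nat.
Let m := prog mu i.
Let x (k l : nat) := INR (mu * l + j) / m k.
Hypothesis Hlohi : forall k, (lo k <= hi k)%nat.
Hypothesis Hlo : forall k, Rabs (INR (mu * lo k + j) - al * m k) <= e0.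
Hypothesis Hhi : forall k, Rabs (INR (mu * hi k + j) - be * m k) <= e0.
Hypothesis Hal : d0 <= al <= 3.
Hypothesis Hbe : d0 <= be <= 3.
Hypothesis Hxlo : forall k, d0 * m k <= INR (mu * lo k + j).
Hypothesis Hxhi : forall k, INR (mu * hi k + j) <= 3 * m k.
Hypothesis HG : forall t, d0 <= t <= 3 -> derivable_pt_lim G t (/ g t).
Hypothesis Hlip : forall t u, d0 <= t <= 3 -> d0 <= u <= 3 -> Rabs (/ g t - / g u) <= 2 * Rabs (t - u).
Hypothesis Hg1 : forall t, d0 <= t <= 3 -> Rabs (/ g t) <= 1.
Hypothesis Hg : forall k l, (lo k <= l < hi k)%nat -> 1 <= g (x k l) <= 2.
Hypothesis HGpos : G al < G be.

(** [c] is the integral of [1 / g] over the slopes from [al] to [be], times the density [1 / mu] of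
    points in a row. In [c1], [6] is the error of the Riemann sum and [2 * e0] that of its two
    ends. *)
Let c := (G be - G al) / INR mu.
Let c1 := 6 + 2 * e0.

Lemma cone_prog_pos k : 0 < m k.
Proof. pose proof (prog_ge1 mu i Hi k); unfold m; lra. Qed.

Lemma cone_G_lip t u : d0 <= t <= 3 -> d0 <= u <= 3 -> Rabs (G t - G u) <= Rabs (t - u).
Proof.
  assert (H : forall t u, d0 <= t <= 3 -> d0 <= u <= 3 -> t < u -> Rabs (G t - G u) <= Rabs (t - u)).
  { intros a b Ha Hb Hab.
    destruct (MVT_cor2 G (fun t => / g t) a b Hab) as (z & E & Hz).
    { intros z Hz; apply HG; lra. }
    rewrite Rabs_minus_sym, (Rabs_minus_sym a), E, Rabs_mult.
    rewrite <- (Rmult_1_l (Rabs (b - a))) at 2.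
    apply Rmult_le_compat_r; [apply Rabs_pos | apply Hg1; lra]. }
  intros Ht Hu. destruct (Rtotal_order t u) as [Htu|[->|Htu]]; auto.
  - unfold Rminus; rewrite !Rplus_opp_r; lra.
  - rewrite Rabs_minus_sym, (Rabs_minus_sym t); auto.
Qed.

Lemma cone_point_range k l : (lo k <= l <= hi k)%nat -> d0 <= x k l <= 3.
Proof.
  intros Hl. pose proof (cone_prog_pos k) as Hm. unfold x.
  assert (INR (mu * lo k + j) <= INR (mu * l + j)) by (apply le_INR; nia).
  assert (INR (mu * l + j) <= INR (mu * hi k + j)) by (apply le_INR; nia).
  specialize (Hxlo k); specialize (Hxhi k).
  split; apply Rmult_le_reg_r with (m k); auto; unfold Rdiv;
    rewrite Rmult_assoc, Rinv_l by lra; lra.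
Qed.

(** Along a row the slopes [x k l] advance by [st = mu / m], so [st] times the sum is a Riemann sum
    for the integral of [1 / g]. Each step errs by at most [2 st^2] by the Lipschitz hypothesis, and
    each end of the row misses its slope by at most [e0 / m]. Dividing by [st] leaves a bounded
    error. *)
Lemma cone_row_bound k :
  Rabs (RsumL (fun l => / g (x k l)) (seq (lo k) (hi k - lo k)) - c * m k) <= c1.
Proof.
  pose proof (cone_prog_pos k) as Hm. pose proof (step_ge1 mu Hmu) as Hmu1.
  set (st := INR mu / m k).
  assert (Hst : 0 < st) by (apply Rdiv_lt_0_compat; lra).
  assert (Hxs : forall l, x k (S l) - x k l = st).
  { intros l; unfold x, st.
    replace (mu * S l + j)%nat with (mu + (mu * l + j))%nat by lia.
    rewrite (plus_INR mu). field; lra. }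
  assert (H : Rabs (RsumL (fun l => st * / g (x k l)) (seq (lo k) (hi k - lo k)) -
     (G (x k (lo k + (hi k - lo k))%nat) - G (x k (lo k)))) <= INR (hi k - lo k) * (2 * st * st)).
  { apply (RsumL_seq_telescope _ (fun l => G (x k l))).
    intros l Hl.
    pose proof (cone_point_range k l ltac:(lia)) as R1.
    pose proof (cone_point_range k (S l) ltac:(lia)) as R2.
    destruct (MVT_cor2 G (fun t => / g t) (x k l) (x k (S l))) as (z & E & Hz).
    { specialize (Hxs l); lra. }
    { intros z Hz; apply HG; lra. }
    rewrite E, Hxs.
    replace (st * / g (x k l) - / g z * st) with ((/ g (x k l) - / g z) * st) by ring.
    rewrite Rabs_mult, (Rabs_right st) by lra. apply Rmult_le_compat_r; [lra|].
    eapply Rle_trans; [apply Hlip; lra|].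
    apply Rmult_le_compat_l; [lra|]. apply Rabs_le. specialize (Hxs l); lra. }
  rewrite RsumL_scal in H. specialize (Hlohi k).
  replace (lo k + (hi k - lo k))%nat with (hi k) in H by lia.
  set (S0 := RsumL (fun l => / g (x k l)) (seq (lo k) (hi k - lo k))) in *.
  assert (Ha : Rabs (G (x k (lo k)) - G al) <= e0 / m k).
  { eapply Rle_trans; [apply cone_G_lip; auto; apply cone_point_range; lia|].
    unfold x. replace (INR (mu * lo k + j) / m k - al)
      with ((INR (mu * lo k + j) - al * m k) * / m k) by (field; lra).
    rewrite Rabs_mult, (Rabs_right (/ m k)) by (left; apply Rinv_0_lt_compat; auto).
    apply Rmult_le_compat_r; auto. left; apply Rinv_0_lt_compat; auto. }
  assert (Hb : Rabs (G (x k (hi k)) - G be) <= e0 / m k).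
  { eapply Rle_trans; [apply cone_G_lip; auto; apply cone_point_range; lia|].
    unfold x. replace (INR (mu * hi k + j) / m k - be)
      with ((INR (mu * hi k + j) - be * m k) * / m k) by (field; lra).
    rewrite Rabs_mult, (Rabs_right (/ m k)) by (left; apply Rinv_0_lt_compat; auto).
    apply Rmult_le_compat_r; auto. left; apply Rinv_0_lt_compat; auto. }
  (* The row ends below slope [3], so the number of steps times [st] is at most [3]. *)
  assert (Hd : INR (hi k - lo k) * (2 * st * st) <= 6 * st).
  { assert (INR (hi k - lo k) * INR mu <= 3 * m k).
    { rewrite <- mult_INR. eapply Rle_trans; [|apply Hxhi]. apply le_INR; nia. }
    assert (INR (hi k - lo k) * st <= 3).
    { unfold st; apply Rmult_le_reg_r with (m k); auto.
      replace (INR (hi k - lo k) * (INR mu / m k) * m k) with (INR (hi k - lo k) * INR mu)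
        by (field; lra). lra. }
    nra. }
  assert (Hf : Rabs (st * (S0 - c * m k)) <= 6 * st + 2 * (e0 / m k)).
  { replace (st * (S0 - c * m k)) with (st * S0 - (G be - G al))
      by (unfold st, c; field; lra).
    apply Rabs_le_between in H; apply Rabs_le_between in Ha; apply Rabs_le_between in Hb.
    apply Rabs_le; lra. }
  rewrite Rabs_mult, (Rabs_right st) in Hf by lra.
  assert (He0 : 0 <= e0).
  { eapply Rle_trans; [apply Rabs_pos | apply (Hlo k)]. }
  assert (e0 / m k <= e0 * st).
  { unfold st, Rdiv; apply Rmult_le_compat_l; auto.
    rewrite <- (Rmult_1_l (/ m k)) at 1. apply Rmult_le_compat_r; auto.
    left; apply Rinv_0_lt_compat; auto. }
  unfold c1. apply Rmult_le_reg_l with st; auto. nra.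
Qed.

Let row s k := RsumL (fun l => Rpower (m k ^ 2 * g (x k l)) (- s)) (seq (lo k) (hi k - lo k)).

(** Write [(m^2 g)^(-s)] as [m^(-2s) g^(-1) g^(1 - s)]; the last factor lies between [2^(1 - s)] and
    [1] because [1 <= g <= 2]. *)
Lemma cone_term s k l : 1 < s -> (lo k <= l < hi k)%nat ->
  Rpower 2 (1 - s) * (Rpower (m k) (- (2 * s)) * / g (x k l))
    <= Rpower (m k ^ 2 * g (x k l)) (- s)
    <= Rpower (m k) (- (2 * s)) * / g (x k l).
Proof.
  intros Hs Hl. pose proof (cone_prog_pos k) as Hm. pose proof (Hg k l Hl) as Hgl.
  rewrite <- Rpower_mult_distr by nra.
  rewrite <- Rpower_pow, Rpower_mult by auto.
  replace (INR 2 * - s) with (- (2 * s)) by (simpl; ring).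
  replace (- s) with (-(1) + (1 - s)) by ring.
  rewrite Rpower_plus, (Rpower_Ropp (g (x k l)) 1), Rpower_1 by lra.
  assert (0 < / g (x k l)) by (apply Rinv_0_lt_compat; lra).
  set (A := Rpower (m k) _). assert (0 < A) by apply Rpower_pos.
  assert (Rpower 2 (1 - s) <= Rpower (g (x k l)) (1 - s)).
  { replace (1 - s) with (- (s - 1)) by ring; apply Rpower_neg_le_base; lra. }
  assert (Rpower (g (x k l)) (1 - s) <= 1).
  { rewrite <- (Rpower_base1 (- (s - 1))) at 2. replace (1 - s) with (- (s - 1)) by ring.
    apply Rpower_neg_le_base; lra. }
  assert (0 < A * / g (x k l)) by nra.
  rewrite <- !Rmult_assoc. split; nra.
Qed.

Lemma cone_row s k : 1 < s ->
  Rpower 2 (1 - s) * (c * Rpower (m k) (- (2 * s - 1)) - c1 * Rpower (m k) (- (2 * s)))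
    <= row s k <=
  c * Rpower (m k) (- (2 * s - 1)) + c1 * Rpower (m k) (- (2 * s)).
Proof.
  intros Hs. pose proof (cone_prog_pos k) as Hm.
  set (A := Rpower (m k) (- (2 * s))). assert (HA : 0 < A) by apply Rpower_pos.
  assert (E : Rpower (m k) (- (2 * s - 1)) = A * m k).
  { unfold A. rewrite <- (Rpower_1 (m k)) at 3 by auto. rewrite <- Rpower_plus; f_equal; ring. }
  rewrite E. pose proof (cone_row_bound k) as Hb. apply Rabs_le_between in Hb.
  set (S0 := RsumL (fun l => / g (x k l)) (seq (lo k) (hi k - lo k))) in *.
  pose proof (Rpower_pos 2 (1 - s)).
  assert (H1 : row s k <= A * S0).
  { unfold row, S0; rewrite <- RsumL_scal. apply RsumL_le. intros l Hl; apply in_seq in Hl.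
    apply cone_term; auto; lia. }
  assert (H2 : Rpower 2 (1 - s) * (A * S0) <= row s k).
  { unfold row, S0; rewrite <- !RsumL_scal. apply RsumL_le. intros l Hl; apply in_seq in Hl.
    apply cone_term; auto; lia. }
  split.
  - eapply Rle_trans; [|exact H2]. apply Rmult_le_compat_l; [lra|]. nra.
  - eapply Rle_trans; [exact H1|]. nra.
Qed.

Lemma cone_const_pos : 0 < c.
Proof. unfold c; apply Rdiv_lt_0_compat; [lra|]. pose proof (step_ge1 mu Hmu); lra. Qed.

(** Summing over the rows, the main term is [c] times the progression series with exponent
    [t = 2s - 1]. As [t - 1 = 2 (s - 1)], its residue is [1 / (2 mu)]. The error series has exponent
    [2s] and contributes at most [2 c1]. *)
Lemma cone_rows_sum s : 1 < s -> exists Z,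
  IsSum (fun _ => True) (row s) Z /\
  Rpower 2 (1 - s) * (c * (Rpower (INR i) (2 - 2 * s) / (2 * INR mu)) - 2 * c1 * (s - 1))
    <= (s - 1) * Z <=
  c * (Rpower (INR i) (2 - 2 * s) / (2 * INR mu) + (s - 1)) + 2 * c1 * (s - 1).
Proof.
  intros Hs. pose proof (step_ge1 mu Hmu) as Hmu1. pose proof cone_const_pos as Hc.
  destruct (prog_zeta mu i Hmu Hi (2 * s - 1)) as (A & HA & HA1); [lra|].
  destruct (prog_zeta_le2 mu i Hmu Hi (2 * s)) as (B & HB & HB2); [lra|].
  fold m in HA, HB.
  assert (He0 : 0 <= c1).
  { unfold c1. pose proof (Rle_trans _ _ _ (Rabs_pos _) (Hlo 0%nat)); lra. }
  set (rho := Rpower 2 (1 - s)). assert (Hrho : 0 < rho) by apply Rpower_pos.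
  destruct (IsSum_of_bound (fun _ => True) (row s) (c * A + c1 * B)) as (Z & HZ & HZu).
  { intros l Hn HP.
    apply Rle_trans with (c * RsumL (fun k => Rpower (m k) (- (2 * s - 1))) l
       + c1 * RsumL (fun k => Rpower (m k) (- (2 * s))) l).
    - rewrite <- !RsumL_scal, <- RsumL_plus. apply RsumL_le. intros k _; apply cone_row; auto.
    - apply Rplus_le_compat; apply Rmult_le_compat_l; try lra; [apply HA | apply HB]; auto. }
  exists Z; split; auto.
  (* The lower bound on [Z] is read as an upper bound on [c * A], which can be checked on finite
     sets of rows. *)
  assert (HZl : rho * (c * A - c1 * B) <= Z).
  { assert (H : c * A <= Z / rho + c1 * B).
    { apply IsSum_le_of_bound with (1 := IsSum_scal _ _ _ c (Rlt_le _ _ Hc) HA).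
      intros l Hn HP. rewrite RsumL_scal.
      assert (H1 : RsumL (row s) l <= Z) by (apply HZ; auto).
      assert (H2 : RsumL (fun k => Rpower (m k) (- (2 * s))) l <= B) by (apply HB; auto).
      assert (H3 : rho * (c * RsumL (fun k => Rpower (m k) (- (2 * s - 1))) l
         + (- c1) * RsumL (fun k => Rpower (m k) (- (2 * s))) l) <= RsumL (row s) l).
      { rewrite <- !RsumL_scal, <- RsumL_plus, <- RsumL_scal. apply RsumL_le.
        intros k _. replace (- c1 * Rpower (m k) (- (2 * s)))
          with (- (c1 * Rpower (m k) (- (2 * s)))) by ring. apply cone_row; auto. }
      assert (H4 : c * RsumL (fun k => Rpower (m k) (- (2 * s - 1))) l
         + (- c1) * RsumL (fun k => Rpower (m k) (- (2 * s))) l <= Z / rho).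
      { apply Rmult_le_reg_l with rho; auto.
        replace (rho * (Z / rho)) with Z by (field; lra). lra. }
      nra. }
    apply Rmult_le_compat_l with (r := rho) in H; [|lra].
    replace (rho * (Z / rho + c1 * B)) with (Z + rho * (c1 * B)) in H by (field; lra). lra. }
  replace (2 * s - 1 - 1) with (2 * (s - 1)) in HA1 by ring.
  replace (1 - (2 * s - 1)) with (2 - 2 * s) in HA1 by ring.
  set (I0 := Rpower (INR i) (2 - 2 * s)) in *.
  assert (HA2 : I0 / (2 * INR mu) <= (s - 1) * A <= I0 / (2 * INR mu) + (s - 1)).
  { split; apply Rmult_le_reg_r with (2 * INR mu); try lra.
    - replace (I0 / (2 * INR mu) * (2 * INR mu)) with I0 by (field; lra). lra.
    - replace ((I0 / (2 * INR mu) + (s - 1)) * (2 * INR mu)) with (I0 + (s - 1) * 2 * INR mu)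
        by (field; lra). lra. }
  assert (HB3 : c1 * B <= 2 * c1) by nra.
  split.
  - apply Rle_trans with ((s - 1) * (rho * (c * A - c1 * B))); [|apply Rmult_le_compat_l; lra].
    replace ((s - 1) * (rho * (c * A - c1 * B)))
      with (rho * (c * ((s - 1) * A) - (s - 1) * (c1 * B))) by ring.
    apply Rmult_le_compat_l; [lra|].
    assert ((s - 1) * (c1 * B) <= (s - 1) * (2 * c1)) by (apply Rmult_le_compat_l; lra).
    assert (c * (I0 / (2 * INR mu)) <= c * ((s - 1) * A)) by (apply Rmult_le_compat_l; lra).
    lra.
  - apply Rle_trans with ((s - 1) * (c * A + c1 * B)); [apply Rmult_le_compat_l; lra|].
    assert ((s - 1) * (c1 * B) <= (s - 1) * (2 * c1)) by (apply Rmult_le_compat_l; lra).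
    assert (c * ((s - 1) * A) <= c * (I0 / (2 * INR mu) + (s - 1))) by (apply Rmult_le_compat_l; lra).
    lra.
Qed.

Lemma cone_HasPole : HasPole (fun kl => (lo (fst kl) <= snd kl < hi (fst kl))%nat)
  (fun kl => prog mu i (fst kl) ^ 2 * g (INR (mu * snd kl + j) / prog mu i (fst kl))) 1
  (c / (2 * INR mu)).
Proof.
  pose proof (step_ge1 mu Hmu) as Hmu1. pose proof cone_const_pos as Hc.
  split; [apply Rdiv_lt_0_compat; lra|].
  set (Z := fun s => epsilon (inhabits 0) (IsSum (fun _ => True) (row s))).
  assert (HZ : forall s, 1 < s -> IsSum (fun _ => True) (row s) (Z s)).
  { intros s Hs; apply epsilon_spec. destruct (cone_rows_sum s Hs) as (L & HL & _); eauto. }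
  exists Z; split.
  - intros s Hs.
    eapply IsSum_ext; [| |apply (IsSum_sigma (fun _ => True)
      (fun k l => (lo k <= l < hi k)%nat)
      (fun kl => Rpower (m (fst kl) ^ 2 * g (x (fst kl) (snd kl))) (- s)) (row s) (Z s))].
    + intros [k l]; simpl; tauto.
    + reflexivity.
    + intros k _; simpl.
      eapply IsSum_ext with (P := fun l => In l (seq (lo k) (hi k - lo k))).
      * intros l; rewrite in_seq. specialize (Hlohi k); lia.
      * reflexivity.
      * apply IsSum_finite; [apply seq_NoDup|]. intros; left; apply Rpower_pos.
    + apply HZ, Hs.
  (* Both enclosing functions are continuous at [s = 1] with the common value [c / (2 mu)]. *)
  - apply limit_right_squeeze with
      (f := fun s => Rpower 2 (1 - s) *
         (c * (Rpower (INR i) (2 - 2 * s) / (2 * INR mu)) - 2 * c1 * (s - 1)))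
      (h := fun s => c * (Rpower (INR i) (2 - 2 * s) / (2 * INR mu) + (s - 1)) + 2 * c1 * (s - 1)).
    { intros s Hs. destruct (cone_rows_sum s Hs) as (L & HL & Hb).
      rewrite (IsSum_unique _ _ _ _ (HZ s Hs) HL), pow_1. exact Hb. }
    + apply limit_right_continuous.
      * unfold Rpower; reg.
      * replace (2 - 2 * 1) with 0 by ring. replace (1 - 1) with 0 by ring.
        rewrite !Rpower_O; [field; lra | apply lt_0_INR; lia | lra].
    + apply limit_right_continuous.
      * unfold Rpower; reg.
      * replace (2 - 2 * 1) with 0 by ring. replace (1 - 1) with 0 by ring.
        rewrite !Rpower_O; [field; lra | apply lt_0_INR; lia].
Qed.
End Cone.

(** * The cone [n <= m < sqrt 3 n] in residue classes modulo 2 *)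

Definition in_cone (m n : nat) : Prop := (n <= m)%nat /\ (m * m < 3 * n * n)%nat.

(** The inner root is [r = floor (m / sqrt 3)], and the rounding makes this the least [l] with
    [2 l + j > r]. Likewise [cone_upper] is the least [l] with [2 l + j > m], so it is an excluded
    end. *)
Definition cone_lower (j m : nat) : nat := ((Nat.sqrt (m * m / 3) + 2 - j) / 2)%nat.
Definition cone_upper (j m : nat) : nat := ((m + 2 - j) / 2)%nat.

Lemma sqrt_third_spec m : let r := Nat.sqrt (m * m / 3) in
  (3 * r * r <= m * m)%nat /\ (m * m < 3 * (r + 1) * (r + 1))%nat /\ (r <= m)%nat.
Proof.
  intros r. pose proof (Nat.sqrt_spec (m * m / 3) ltac:(lia)) as [H1 H2]. fold r in H1, H2.
  pose proof (Nat.div_mod_eq (m * m) 3). pose proof (Nat.mod_upper_bound (m * m) 3 ltac:(lia)).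
  nia.
Qed.

Lemma cone_bounds_spec j m l : (j <= 1)%nat ->
  (cone_lower j m <= l < cone_upper j m)%nat <-> in_cone m (2 * l + j).
Proof.
  intros Hj. unfold cone_lower, cone_upper, in_cone.
  pose proof (sqrt_third_spec m) as (H1 & H2 & H3).
  set (r := Nat.sqrt (m * m / 3)) in *. clearbody r.
  pose proof (Nat.div_mod_eq (r + 2 - j) 2). pose proof (Nat.mod_upper_bound (r + 2 - j) 2 ltac:(lia)).
  pose proof (Nat.div_mod_eq (m + 2 - j) 2). pose proof (Nat.mod_upper_bound (m + 2 - j) 2 ltac:(lia)).
  assert (E : (m * m < 3 * (2 * l + j) * (2 * l + j) <-> r + 1 <= 2 * l + j)%nat).
  { split; intros; [|nia].
    apply Nat.nlt_ge; intros Hlt. assert (2 * l + j <= r)%nat by lia. nia. }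
  rewrite E; clear E H1 H2. lia.
Qed.

Lemma cone_lower_upper_bounds j m : (j <= 1)%nat ->
  let r := Nat.sqrt (m * m / 3) in
  (r + 1 <= 2 * cone_lower j m + j <= r + 2)%nat /\
  (m + 1 <= 2 * cone_upper j m + j <= m + 2)%nat /\ (cone_lower j m <= cone_upper j m)%nat.
Proof.
  intros Hj r. unfold cone_lower, cone_upper. pose proof (sqrt_third_spec m) as (_ & _ & H3).
  fold r in H3 |- *. clearbody r.
  pose proof (Nat.div_mod_eq (r + 2 - j) 2). pose proof (Nat.mod_upper_bound (r + 2 - j) 2 ltac:(lia)).
  pose proof (Nat.div_mod_eq (m + 2 - j) 2). pose proof (Nat.mod_upper_bound (m + 2 - j) 2 ltac:(lia)).
  lia.
Qed.

Lemma sqrt3_bounds : 1 < sqrt 3 < 2 /\ sqrt 3 * sqrt 3 = 3.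
Proof.
  assert (E : sqrt 3 * sqrt 3 = 3) by (apply sqrt_sqrt; lra).
  pose proof (sqrt_pos 3). split; [|exact E]. nra.
Qed.

Lemma inv_sqrt3_bounds : / 2 < / sqrt 3 < 1 /\ sqrt 3 * / sqrt 3 = 1.
Proof.
  destruct sqrt3_bounds as [[H1 H2] _]. split; [|apply Rinv_r; lra].
  split; [apply Rinv_lt_contravar; nra|].
  rewrite <- Rinv_1. apply Rinv_lt_contravar; lra.
Qed.

(** Even first coordinates are represented by [i = 2], since rows must start at a positive [m]. *)
Definition coset_cone (i j : nat) (mn : nat * nat) : Prop :=
  in_cone (fst mn) (snd mn) /\
  exists k l, fst mn = (2 * k + i)%nat /\ snd mn = (2 * l + j)%nat.

Section CosetCone.
Variables g G : R -> R.
Hypothesis HG : forall t, / 2 <= t <= 3 -> derivable_pt_lim G t (/ g t).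
Hypothesis Hlip : forall t u, / 2 <= t <= 3 -> / 2 <= u <= 3 ->
  Rabs (/ g t - / g u) <= 2 * Rabs (t - u).
Hypothesis Hg1 : forall t, / 2 <= t <= 3 -> Rabs (/ g t) <= 1.
Hypothesis Hg : forall t, / sqrt 3 <= t <= 1 -> 1 <= g t <= 2.
Hypothesis HGpos : G (/ sqrt 3) < G 1.

Lemma coset_cone_HasPole i j : (1 <= i)%nat -> (j <= 1)%nat -> exists l,
  HasPole (coset_cone i j) (fun mn => INR (fst mn) ^ 2 * g (INR (snd mn) / INR (fst mn))) 1 l.
Proof.
  intros Hi Hj. eexists.
  destruct sqrt3_bounds as [[B1 B2] B3]. destruct inv_sqrt3_bounds as [[C1 C2] C3].
  set (a := / sqrt 3) in *.
  assert (Ha : 3 * (a * a) = 1).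
  { rewrite <- B3. replace (sqrt 3 * sqrt 3 * (a * a)) with ((sqrt 3 * a) * (sqrt 3 * a)) by ring.
    rewrite C3; ring. }
  assert (Hr : forall m, a * INR m <= INR (Nat.sqrt (m * m / 3)) + 1 /\
     INR (Nat.sqrt (m * m / 3)) <= a * INR m).
  { intros m. pose proof (sqrt_third_spec m) as (H1 & H2 & _).
    set (r := Nat.sqrt (m * m / 3)) in *. clearbody r.
    apply le_INR in H1. apply lt_INR in H2.
    rewrite !mult_INR, plus_INR in H2. rewrite !mult_INR in H1.
    replace (INR 3) with 3 in H1, H2 by (simpl; ring). replace (INR 1) with 1 in H2 by reflexivity.
    pose proof (pos_INR r); pose proof (pos_INR m).
    assert (0 <= a * INR m) by nra.
    assert (INR m * INR m = 3 * (a * INR m) * (a * INR m)).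
    { replace (3 * (a * INR m) * (a * INR m)) with (3 * (a * a) * (INR m * INR m)) by ring.
      rewrite Ha; ring. }
    split; apply Rnot_lt_le; intros Hlt; nra. }
  (* Slopes run from [a = 1 / sqrt 3] to [1], and [d0 = 1 / 2] lies below [a]. The two ends
     overshoot by at most [2], which [e0 = 3] covers; the upper one may reach [m + 2 <= 3 m], hence
     the interval up to [3]. *)
  eapply HasPole_bij with
    (P := fun kl => (cone_lower j (2 * fst kl + i) <= snd kl < cone_upper j (2 * fst kl + i))%nat)
    (h := fun kl => ((2 * fst kl + i)%nat, (2 * snd kl + j)%nat));
  [ | | | | eapply (cone_HasPole 2 i j (fun k => cone_lower j (2 * k + i))
       (fun k => cone_upper j (2 * k + i)) g G a 1 (/ 2) 3)]; try lia; auto; try lra.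
  - intros [k l] H; simpl in *. apply cone_bounds_spec in H; auto.
    split; simpl; eauto.
  - intros [k l] [k' l'] _ _ E; simpl in E. inversion E. f_equal; lia.
  - intros [m n] [H1 (k & l & E1 & E2)]; simpl in *; subst. exists (k, l); split; auto.
    apply cone_bounds_spec; auto.
  - intros k. apply (cone_lower_upper_bounds j (2 * k + i) Hj).
  - intros k. unfold prog. set (m := (2 * k + i)%nat).
    destruct (cone_lower_upper_bounds j m Hj) as [[H1 H2] _]. destruct (Hr m) as [H3 H4].
    apply le_INR in H1, H2. rewrite plus_INR in H1. rewrite (plus_INR _ 2) in H2.
    simpl (INR 1) in *; simpl (INR 2) in *. apply Rabs_le; lra.
  - intros k. unfold prog. set (m := (2 * k + i)%nat).
    destruct (cone_lower_upper_bounds j m Hj) as [_ [[H1 H2] _]].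
    apply le_INR in H1, H2. rewrite plus_INR in H1. rewrite (plus_INR m 2) in H2.
    simpl (INR 1) in *; simpl (INR 2) in *. apply Rabs_le; lra.
  - intros k. unfold prog. set (m := (2 * k + i)%nat).
    destruct (cone_lower_upper_bounds j m Hj) as [[H1 H2] _]. destruct (Hr m) as [H3 H4].
    apply le_INR in H1. rewrite plus_INR in H1. simpl (INR 1) in *.
    pose proof (pos_INR m). nra.
  - intros k. pose proof (prog_ge1 2 i Hi k) as Hm. unfold prog in *. set (m := (2 * k + i)%nat) in *.
    destruct (cone_lower_upper_bounds j m Hj) as [_ [[H1 H2] _]].
    apply le_INR in H2. rewrite (plus_INR m 2) in H2. simpl (INR 2) in *. lra.
  - intros k l Hl. pose proof (prog_ge1 2 i Hi k) as Hm. unfold prog in *.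
    apply cone_bounds_spec in Hl as [H1 H2]; auto.
    set (m := (2 * k + i)%nat) in *. set (n := (2 * l + j)%nat) in *.
    apply le_INR in H1. apply lt_INR in H2. rewrite !mult_INR in H2.
    replace (INR 3) with 3 in H2 by (simpl; ring).
    pose proof (pos_INR n). apply Hg.
    split; apply Rmult_le_reg_r with (INR m); try lra;
      unfold Rdiv; rewrite Rmult_assoc, Rinv_l by lra; [|lra].
    rewrite Rmult_1_r. apply Rnot_lt_le; intros Hlt.
    assert (INR m * INR m = 3 * (a * INR m) * (a * INR m)).
    { replace (3 * (a * INR m) * (a * INR m)) with (3 * (a * a) * (INR m * INR m)) by ring.
      rewrite Ha; ring. }
    nra.
Qed.
End CosetCone.

(** The difference has the factor [(t + u) / ((1 + t^2) (1 + u^2))], bounded through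
    [(t + 1)^2 >= 0] and [(t - 1)^2 >= 0]. *)
Lemma inv_sqr1_lip t u : Rabs (/ (1 + t ^ 2) - / (1 + u ^ 2)) <= 2 * Rabs (t - u).
Proof.
  assert (0 < 1 + t ^ 2) by (pose proof (pow2_ge_0 t); lra). assert (0 < 1 + u ^ 2) by (pose proof (pow2_ge_0 u); lra).
  replace (/ (1 + t ^ 2) - / (1 + u ^ 2)) with (- (t - u) * ((t + u) / ((1 + t ^ 2) * (1 + u ^ 2))))
    by (field; nra).
  rewrite Rabs_mult, Rabs_Ropp.
  assert (Rabs ((t + u) / ((1 + t ^ 2) * (1 + u ^ 2))) <= 2).
  { apply Rabs_le. assert (HD : 0 < (1 + t ^ 2) * (1 + u ^ 2)) by nra.
    split; apply Rmult_le_reg_r with ((1 + t ^ 2) * (1 + u ^ 2)); auto;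
      unfold Rdiv; rewrite Rmult_assoc, Rinv_l by lra.
    - assert (0 <= (t + 1) ^ 2) by apply pow2_ge_0. assert (0 <= (u + 1) ^ 2) by apply pow2_ge_0.
      assert (0 <= t ^ 2 * u ^ 2) by (apply Rmult_le_pos; apply pow2_ge_0). pose proof (pow2_ge_0 t); pose proof (pow2_ge_0 u). lra.
    - assert (0 <= (t - 1) ^ 2) by apply pow2_ge_0. assert (0 <= (u - 1) ^ 2) by apply pow2_ge_0.
      assert (0 <= t ^ 2 * u ^ 2) by (apply Rmult_le_pos; apply pow2_ge_0). pose proof (pow2_ge_0 t); pose proof (pow2_ge_0 u). lra. }
  pose proof (Rabs_pos (t - u)). nra.
Qed.

Lemma inv_sqr1_le1 t : Rabs (/ (1 + t ^ 2)) <= 1.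
Proof.
  assert (0 < 1 + t ^ 2) by (pose proof (pow2_ge_0 t); lra).
  rewrite Rabs_right by (left; apply Rinv_0_lt_compat; lra).
  rewrite <- Rinv_1 at 2. apply Rinv_le_contravar; nra.
Qed.

Definition cone_d (mn : nat * nat) : R := 2 * INR (fst mn) * INR (snd mn).
Definition cone_m (mn : nat * nat) : R := INR (fst mn) ^ 2 + INR (snd mn) ^ 2.

Lemma coset_cone_pos i j mn : coset_cone i j mn -> 0 < INR (fst mn) /\ 0 < INR (snd mn).
Proof. intros [[H1 H2] _]; split; apply lt_0_INR; nia. Qed.

(** With [t = n / m] one has [2mn = m^2 (2t)], and [1 / (2t)] has antiderivative [ln t / 2]. *)
Lemma coset_cone_d_HasPole i j : (1 <= i)%nat -> (j <= 1)%nat ->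
  exists l, HasPole (coset_cone i j) cone_d 1 l.
Proof.
  intros Hi Hj. destruct inv_sqrt3_bounds as [[C1 C2] _].
  destruct (coset_cone_HasPole (fun t => 2 * t) (fun t => / 2 * ln t)) with (i := i) (j := j)
    as [l Hl]; auto.
  - intros t Ht. replace (/ (2 * t)) with (/ 2 * / t) by (field; lra).
    apply derivable_pt_lim_scal, derivable_pt_lim_ln; lra.
  - intros t u Ht Hu.
    replace (/ (2 * t) - / (2 * u)) with (- (t - u) * / (2 * t * u)) by (field; lra).
    rewrite Rabs_mult, Rabs_Ropp.
    assert (Rabs (/ (2 * t * u)) <= 2).
    { assert (0 < 2 * t * u) by nra.
      rewrite Rabs_right by (left; apply Rinv_0_lt_compat; auto).
      replace 2 with (/ / 2) at 2 by field. apply Rinv_le_contravar; nra. }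
    pose proof (Rabs_pos (t - u)). nra.
  - intros t Ht. rewrite Rabs_right by (left; apply Rinv_0_lt_compat; lra).
    rewrite <- Rinv_1. apply Rinv_le_contravar; lra.
  - intros t Ht; lra.
  - assert (ln (/ sqrt 3) < ln 1) by (apply ln_increasing; lra). lra.
  - exists l. eapply HasPole_ext; [| |exact Hl]; [tauto|].
    intros mn H; apply coset_cone_pos in H. unfold cone_d; simpl. field; lra.
Qed.

(** Here [m^2 + n^2 = m^2 (1 + t^2)], with antiderivative [atan]. *)
Lemma coset_cone_m_HasPole i j : (1 <= i)%nat -> (j <= 1)%nat ->
  exists l, HasPole (coset_cone i j) cone_m 1 l.
Proof.
  intros Hi Hj. destruct inv_sqrt3_bounds as [[C1 C2] _].
  destruct (coset_cone_HasPole (fun t => 1 + t ^ 2) atan) with (i := i) (j := j)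
    as [l Hl]; auto.
  - intros t Ht; apply derivable_pt_lim_atan.
  - intros; apply inv_sqr1_lip.
  - intros; apply inv_sqr1_le1.
  - intros t Ht; nra.
  - apply atan_increasing; lra.
  - exists l. eapply HasPole_ext; [| |exact Hl]; [tauto|].
    intros mn H; apply coset_cone_pos in H. unfold cone_m; simpl. field; lra.
Qed.

(** * Gaussian integers up to units *)

(* A set of representatives of the nonzero Gaussian integers modulo units. *)
Definition quarter (z : Z * Z) : Prop := (0 < fst z /\ - fst z < snd z <= fst z)%Z.
Definition gnorm (z : Z * Z) : R := IZR (sqn (fst z) (snd z)).

(** The quarter plane is itself a cone. The shift [y = l - x] makes the column index [l] run over
    [1, ..., 2x], so slopes lie in [[0, 2]] and the norm is [x^2 (1 + (t - 1)^2)]. Starting at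
    [l = 1] leaves out the ray [y = -x], an associate of [y = x]. *)
Lemma quarter_HasPole : exists l, HasPole quarter gnorm 1 l.
Proof.
  eexists.
  eapply HasPole_bij with
    (P := fun kl => (1 <= snd kl < 2 * (1 * fst kl + 1) + 1)%nat)
    (h := fun kl => (Z.of_nat (fst kl + 1), (Z.of_nat (snd kl) - Z.of_nat (fst kl + 1))%Z));
  [ | | | | eapply (cone_HasPole 1 1 0 (fun k => 1%nat) (fun k => (2 * (1 * k + 1) + 1)%nat)
      (fun t => 1 + (t - 1) ^ 2) (fun t => atan (t - 1)) 0 2 0 1)]; try lia; auto; try lra.
  - intros [k l]; unfold quarter; simpl; lia.
  - intros [k l] [k' l'] _ _ E; simpl in E; inversion E. f_equal; lia.
  - intros [x y] [H1 H2]; simpl in *.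
    exists (Z.to_nat (x - 1), Z.to_nat (y + x)); simpl; split; [lia|]. f_equal; lia.
  - intros [k l] _; unfold gnorm, sqn; cbv [fst snd].
    replace (1 * k + 1)%nat with (k + 1)%nat by lia. replace (1 * l + 0)%nat with l by lia.
    unfold prog. replace (1 * k + 1)%nat with (k + 1)%nat by lia.
    rewrite plus_IZR, !mult_IZR, minus_IZR, <- !INR_IZR_INZ.
    assert (0 < INR (k + 1)) by (apply lt_0_INR; lia). field; lra.
  - intros k; unfold prog. simpl (INR (1 * 1 + 0)). apply Rabs_le; lra.
  - intros k; unfold prog. replace (1 * (2 * (1 * k + 1) + 1) + 0)%nat with (2 * (1 * k + 1) + 1)%nat by lia.
    rewrite (plus_INR _ 1), (mult_INR 2). simpl (INR 1); simpl (INR 2). apply Rabs_le; lra.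
  - intros k; unfold prog. rewrite Rmult_0_l. apply pos_INR.
  - intros k; pose proof (prog_ge1 1 1 (le_n 1) k) as Hp. unfold prog in *.
    replace (1 * (2 * (1 * k + 1) + 1) + 0)%nat with (2 * (1 * k + 1) + 1)%nat by lia.
    rewrite (plus_INR _ 1), (mult_INR 2). simpl (INR 1); simpl (INR 2). lra.
  - intros t _. replace (/ (1 + (t - 1) ^ 2)) with (/ (1 + (t - 1) ^ 2) * 1) by ring.
    apply (derivable_pt_lim_comp (fun t => t - 1) atan); [|apply derivable_pt_lim_atan].
    enough (H : derivable_pt_lim (fun t => t - 1) t (1 - 0)) by (rewrite Rminus_0_r in H; exact H).
    apply (derivable_pt_lim_minus id (fct_cte 1));
      [apply derivable_pt_lim_id | apply derivable_pt_lim_const].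
  - intros t u _ _. replace (t - u) with ((t - 1) - (u - 1)) by ring. apply inv_sqr1_lip.
  - intros t _; apply inv_sqr1_le1.
  - intros k l Hl. pose proof (prog_ge1 1 1 (le_n 1) k) as Hp. unfold prog in *.
    replace (1 * l + 0)%nat with l by lia.
    assert (H1 : INR l <= 2 * INR (1 * k + 1)).
    { change 2 with (INR 2) at 1. rewrite <- mult_INR. apply le_INR; lia. }
    pose proof (pos_INR l). set (m := INR (1 * k + 1)) in *.
    enough (Hu : -1 <= INR l / m - 1 <= 1).
    { pose proof (pow2_ge_0 (INR l / m - 1)). set (u := INR l / m - 1) in *. clearbody u. nra. }
    assert (0 <= INR l / m) by (apply Rmult_le_pos; [lra | left; apply Rinv_0_lt_compat; lra]).
    assert (INR l / m <= 2); [|lra].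
    apply Rmult_le_reg_r with m; [lra|]. unfold Rdiv; rewrite Rmult_assoc, Rinv_l by lra. lra.
  - apply atan_increasing; lra.
Qed.

(** * Coprime pairs in the cone *)

Lemma limit_finite_sum {T} (f : R -> T -> R) (l : list T) :
  (forall x, limit1_in (fun s => f s x) (fun s => 1 < s) (f 1 x) 1) ->
  limit1_in (fun s => RsumL (f s) l) (fun s => 1 < s) (RsumL (f 1) l) 1.
Proof.
  intros H; induction l as [|x l IH]; simpl.
  - apply limit_right_continuous; [reg | reflexivity].
  - apply limit_plus; auto.
Qed.

(** [D] decreases in [s], so [D s <= D 1]; from below, a finite partial sum nearly exhausts [D 1]
    and is continuous in [s]. *)
Lemma odd_zeta_limit (D : R -> R) :
  (forall s, 1 <= s -> IsSum (fun _ => True) (fun k => Rpower (prog 2 1 k) (- (2 * s))) (D s)) ->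
  limit1_in D (fun s => 1 < s) (D 1) 1.
Proof.
  intros HD. apply limit_right_iff; intros eps He.
  destruct (proj2 (HD 1 ltac:(lra)) (eps / 2)) as (l & Hn & HP & Hlt); [lra|].
  assert (Hlim := limit_finite_sum (fun s k => Rpower (prog 2 1 k) (- (2 * s))) l
    ltac:(intros k; apply limit_right_continuous; [unfold Rpower; reg | reflexivity])).
  apply limit_right_iff with (eps := eps / 2) in Hlim as (d & Hd & Hc); [|lra].
  exists d; split; auto. intros s Hs. specialize (Hc s Hs).
  apply Rabs_def2 in Hc.
  assert (RsumL (fun k => Rpower (prog 2 1 k) (- (2 * s))) l <= D s) by (apply HD; auto; lra).
  assert (D s <= D 1).
  { apply IsSum_le_of_bound with (1 := HD s ltac:(lra)). intros l' Hn' HP'.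
    apply Rle_trans with (RsumL (fun k => Rpower (prog 2 1 k) (- (2 * 1))) l');
      [|apply HD; auto; lra].
    apply RsumL_le; intros k _. pose proof (prog_ge1 2 1 ltac:(lia) k) as Hp.
    unfold Rpower; apply exp_le_exp.
    assert (0 <= ln (prog 2 1 k)).
    { rewrite <- ln_1. destruct Hp as [Hp|Hp]; [left; apply ln_increasing; lra | rewrite <- Hp; lra]. }
    nra. }
  apply Rabs_def1; lra.
Qed.

(** The layer [d = 1] is a copy of the series over [P], which therefore converges. Then the whole
    series factors as [D s] times it, and [D s >= 1] permits division. *)
Lemma HasPole_quotient {T} (P : T -> Prop) w mu l :
  (forall x, P x -> 0 < w x) ->
  HasPole (fun z : nat * T => True /\ P (snd z))
    (fun z => prog 2 1 (fst z) ^ 2 * w (snd z)) mu l ->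
  exists l', HasPole P w mu l'.
Proof.
  intros Hw (Hl & Z & HZ & Hlim).
  set (D := fun s => epsilon (inhabits 0)
    (IsSum (fun _ => True) (fun k => Rpower (prog 2 1 k) (- (2 * s))))).
  assert (HD : forall s, 1 <= s ->
    IsSum (fun _ => True) (fun k => Rpower (prog 2 1 k) (- (2 * s))) (D s)).
  { intros s Hs; apply epsilon_spec.
    destruct (prog_zeta 2 1 ltac:(lia) ltac:(lia) (2 * s)) as (L & HL & _); [lra|]; eauto. }
  assert (Hp0 : prog 2 1 0 = 1) by reflexivity.
  assert (HD1 : forall s, 1 <= s -> 1 <= D s).
  { intros s Hs. pose proof (IsSum_ge_term _ _ _ 0%nat (HD s Hs) I) as H; simpl in H.
    rewrite Hp0, Rpower_base1 in H; exact H. }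
  assert (HW : forall s, 1 < s -> IsSum P (fun x => Rpower (w x) (- s)) (Z s / D s)).
  { intros s Hs. specialize (HZ s Hs).
    destruct (IsSum_of_bound P (fun x => Rpower (w x) (- s)) (Z s)) as (W & HW & _).
    { intros l0 Hn HP.
      replace (RsumL (fun x => Rpower (w x) (- s)) l0) with
        (RsumL (fun z : nat * T => Rpower (prog 2 1 (fst z) ^ 2 * w (snd z)) (- s))
           (map (pair 0%nat) l0)).
      - apply HZ.
        + apply NoDup_map_NoDup_ForallPairs; auto. intros y y' _ _ E; congruence.
        + apply Forall_map. eapply Forall_impl; [|exact HP]; simpl; auto.
      - rewrite RsumL_map; apply RsumL_ext; intros x _; cbv [fst snd].
        rewrite Hp0; f_equal; ring. }
    replace (Z s / D s) with W; auto.
    assert (E : Z s = D s * W).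
    { eapply IsSum_unique; [exact HZ|].
      eapply IsSum_ext; [| |apply (IsSum_product _ _ _ _ _ _) with (2 := HD s ltac:(lra)) (3 := HW)].
      - tauto.
      - intros [k x] [_ Hx]; cbv [fst snd] in *.
        pose proof (prog_ge1 2 1 ltac:(lia) k) as Hp.
        rewrite <- Rpower_mult_distr by (auto; nra).
        f_equal. rewrite <- Rpower_pow, Rpower_mult by lra. f_equal. simpl; ring.
      - intros; left; apply Rpower_pos. }
    rewrite E. specialize (HD1 s ltac:(lra)). field; lra. }
  pose proof (HD1 1 ltac:(lra)) as HD11.
  exists (l * / D 1). split.
  { apply Rmult_lt_0_compat; auto. apply Rinv_0_lt_compat; lra. }
  exists (fun s => Z s / D s); split; auto.
  eapply limit_right_ext; [|apply (limit_mul _ (fun s => / D s) _ _ _ _ Hlim)].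
  - intros s Hs; simpl. unfold Rdiv; ring.
  - apply limit_inv; [apply odd_zeta_limit; auto | lra].
Qed.

(** One term is continuous at [1], so a positive power of [s - 1] kills it. This serves to count the
    diagonal pair [(1, 1)] once when a half cone is reflected. *)
Lemma HasPole_remove {T} (P : T -> Prop) w mu l x0 :
  P x0 -> HasPole P w (S mu) l -> HasPole (fun x => P x /\ x <> x0) w (S mu) l.
Proof.
  intros H0 (Hl & Z & HZ & Hlim). split; auto.
  exists (fun s => Z s - Rpower (w x0) (- s)); split.
  - intros s Hs. specialize (HZ s Hs).
    destruct (IsSum_of_bound (fun x => P x /\ x <> x0) (fun x => Rpower (w x) (- s)) (Z s))
      as (W & HW & _).
    { intros l0 Hn HP; apply HZ; auto. revert HP; apply Forall_impl; tauto. }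
    replace (Z s - Rpower (w x0) (- s)) with W; auto.
    assert (H1 : IsSum (fun x => In x [x0]) (fun x => Rpower (w x) (- s)) (RsumL (fun x => Rpower (w x) (- s)) [x0])).
    { apply IsSum_finite; [repeat constructor; simpl; auto|]. intros; left; apply Rpower_pos. }
    assert (H2 := IsSum_union _ _ _ _ _
      (fun x (Hx : P x /\ x <> x0) (Hy : In x [x0]) =>
         match Hy with or_introl E => proj2 Hx (eq_sym E) | or_intror F => F end) HW H1).
    assert (E : Z s = W + RsumL (fun x => Rpower (w x) (- s)) [x0]).
    { eapply IsSum_unique; [exact HZ|]. eapply IsSum_ext; [| |exact H2]; auto.
      intros x; simpl. destruct (classic (x = x0)) as [->|]; intuition congruence. }
    rewrite E; simpl; ring.
  - assert (Hc : limit1_in (fun s => (s - 1) ^ S mu * Rpower (w x0) (- s)) (fun s => 1 < s) 0 1).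
    { apply limit_right_continuous; [unfold Rpower; reg|]. simpl; ring. }
    replace l with (l - 0) by ring.
    eapply limit_right_ext; [|apply (limit_minus _ _ _ _ _ _ Hlim Hc)].
    intros; simpl; ring.
Qed.

(* The gcd of [2ab] and [a^2 + b^2] when [a] and [b] are coprime. *)
Definition kap (a b : nat) : nat := if (Nat.odd a && Nat.odd b)%bool then 2 else 1.

Definition cop_cone (ab : nat * nat) : Prop :=
  Nat.gcd (fst ab) (snd ab) = 1%nat /\ in_cone (fst ab) (snd ab).

Definition cop_sym_cone (ab : nat * nat) : Prop :=
  Nat.gcd (fst ab) (snd ab) = 1%nat /\
  (fst ab * fst ab < 3 * snd ab * snd ab)%nat /\ (snd ab * snd ab < 3 * fst ab * fst ab)%nat.

Lemma odd_2k1 k : Nat.odd (2 * k + 1) = true.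
Proof. apply Nat.odd_spec; exists k; reflexivity. Qed.

Lemma kap_odd_mul k a b : kap ((2 * k + 1) * a) ((2 * k + 1) * b) = kap a b.
Proof.
  unfold kap. rewrite !Nat.odd_mul, odd_2k1. reflexivity.
Qed.

Lemma kap_sym a b : kap a b = kap b a.
Proof. unfold kap; rewrite Bool.andb_comm; reflexivity. Qed.

Lemma odd_repr n : Nat.odd n = true -> exists k, n = (2 * k + 1)%nat.
Proof. intros H; apply Nat.odd_spec in H; exact H. Qed.

Lemma even_repr n : Nat.odd n = false -> exists k, n = (2 * k)%nat.
Proof.
  intros H. rewrite <- Nat.negb_even in H. apply Bool.negb_false_iff, Nat.even_spec in H. exact H.
Qed.

Lemma odd_2k k : Nat.odd (2 * k) = false.
Proof. rewrite <- Nat.negb_even, Nat.even_even; reflexivity. Qed.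

Section CoprimeCone.
Variable v : nat * nat -> R.
Hypothesis Hv : forall a b, (0 < a)%nat -> (0 < b)%nat -> 0 < v (a, b).
Hypothesis Hhom : forall d a b, v ((d * a)%nat, (d * b)%nat) = INR d ^ 2 * v (a, b).
Hypothesis Hsym : forall a b, v (a, b) = v (b, a).
Hypothesis Hpole : forall i j, (1 <= i)%nat -> (j <= 1)%nat ->
  exists l, HasPole (coset_cone i j) v 1 l.

(** For [v = 2ab] and [v = a^2 + b^2] on coprime pairs these are the numerator [p] and the
    denominator [q] in lowest terms. *)
Definition redw (ab : nat * nat) : R := v ab / INR (kap (fst ab) (snd ab)).

Definition not_both_even_cone (ab : nat * nat) : Prop :=
  in_cone (fst ab) (snd ab) /\ (Nat.odd (fst ab) = true \/ Nat.odd (snd ab) = true).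

Lemma in_cone_pos a b : in_cone a b -> (0 < a)%nat /\ (0 < b)%nat.
Proof. intros [H1 H2]; nia. Qed.

Lemma kap_cases a b : INR (kap a b) = 1 \/ INR (kap a b) = 2.
Proof. unfold kap; destruct (Nat.odd a && Nat.odd b)%bool; simpl; auto. Qed.

Lemma redw_pos a b : (0 < a)%nat -> (0 < b)%nat -> 0 < redw (a, b).
Proof.
  intros Ha Hb. apply Rdiv_lt_0_compat; auto. destruct (kap_cases a b); simpl; lra.
Qed.

(** Three parity classes remain, and [kap] is constant on each: [2] on odd-odd, which rescales the
    weight by [1 / 2], and [1] on the two mixed classes. *)
Lemma not_both_even_HasPole : exists l, HasPole not_both_even_cone redw 1 l.
Proof.
  destruct (Hpole 1 1) as [l1 H1]; try lia. destruct (Hpole 1 0) as [l2 H2]; try lia.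
  destruct (Hpole 2 1) as [l3 H3]; try lia.
  apply (HasPole_scale _ _ _ _ (/ 2)) in H1; [|lra|].
  2:{ intros [a b] [H _]; apply in_cone_pos in H; simpl in *; apply Hv; tauto. }
  apply (HasPole_ext _ (coset_cone 1 1) _ redw) in H1; [|tauto|].
  2:{ intros [a b] [_ (k & l & E1 & E2)]; cbv [fst snd] in *; subst.
      unfold redw, kap; cbv [fst snd]. rewrite !odd_2k1; simpl. lra. }
  apply (HasPole_ext _ (coset_cone 1 0) _ redw) in H2; [|tauto|].
  2:{ intros [a b] [_ (k & l & E1 & E2)]; cbv [fst snd] in *; subst.
      unfold redw, kap; cbv [fst snd]. replace (2 * l + 0)%nat with (2 * l)%nat by lia.
      rewrite odd_2k, Bool.andb_false_r; simpl. lra. }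
  apply (HasPole_ext _ (coset_cone 2 1) _ redw) in H3; [|tauto|].
  2:{ intros [a b] [_ (k & l & E1 & E2)]; cbv [fst snd] in *; subst.
      unfold redw, kap; cbv [fst snd]. replace (2 * k + 2)%nat with (2 * (k + 1))%nat by lia.
      rewrite odd_2k; simpl. lra. }
  eexists; eapply HasPole_ext; [| |eapply HasPole_union;
    [|eapply HasPole_union; [|exact H1|exact H2]|exact H3]]; [|auto| |].
  2:{ intros x [[_ (k & l & E1 & E2)]|[_ (k & l & E1 & E2)]] [_ (k' & l' & E3 & E4)]; lia. }
  2:{ intros x [_ (k & l & E1 & E2)] [_ (k' & l' & E3 & E4)]; lia. }
  intros [a b]; unfold not_both_even_cone, coset_cone; cbv [fst snd]. split.
  - intros [[[Hc (k & l & -> & ->)]|[Hc (k & l & -> & ->)]]|[Hc (k & l & -> & ->)]];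
      (split; [exact Hc|]); rewrite ?odd_2k1; auto.
  - intros [Hc Ho]. pose proof (in_cone_pos _ _ Hc) as [Ha Hb].
    destruct (Nat.odd a) eqn:Ea, (Nat.odd b) eqn:Eb; try (destruct Ho; discriminate).
    + destruct (odd_repr _ Ea) as [k ->]; destruct (odd_repr _ Eb) as [l ->].
      left; left; split; auto; exists k, l; lia.
    + destruct (odd_repr _ Ea) as [k ->]; destruct (even_repr _ Eb) as [l ->].
      left; right; split; auto; exists k, l; lia.
    + destruct (even_repr _ Ea) as [k ->]; destruct (odd_repr _ Eb) as [l ->].
      right; split; auto; exists (k - 1)%nat, l; lia.
Qed.

(** A pair with an odd entry is uniquely an odd [d] times a coprime pair. Its weight is [d^2] times
    the weight of the coprime pair, as [kap] does not see odd factors. *)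
Lemma cop_cone_HasPole : exists l, HasPole cop_cone redw 1 l.
Proof.
  destruct not_both_even_HasPole as [l Hl].
  eapply HasPole_quotient.
  { intros [a b] [_ H]; apply in_cone_pos in H; simpl in H; apply redw_pos; tauto. }
  eapply (HasPole_bij _ not_both_even_cone
    (fun z : nat * (nat * nat) => ((2 * fst z + 1) * fst (snd z), (2 * fst z + 1) * snd (snd z))%nat)
    _ redw); [| | | |exact Hl].
  - intros [k [a b]] [_ [Hg [H1 H2]]]; unfold not_both_even_cone, in_cone; cbv [fst snd] in *.
    split; [nia|]. rewrite !Nat.odd_mul, !odd_2k1; simpl.
    destruct (Nat.odd a) eqn:Ea, (Nat.odd b) eqn:Eb; auto. exfalso.
    destruct (even_repr _ Ea) as [x ->]; destruct (even_repr _ Eb) as [y ->].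
    rewrite Nat.gcd_mul_mono_l in Hg. lia.
  - intros [k [a b]] [k' [a' b']] [_ [Hg [H1 H2]]] [_ [Hg' [H1' H2']]] E.
    cbv [fst snd] in *. apply pair_equal_spec in E as [E1 E2].
    assert (Hd : (2 * k + 1 = 2 * k' + 1)%nat).
    { pose proof (Nat.gcd_mul_mono_l a b (2 * k + 1)) as G1.
      pose proof (Nat.gcd_mul_mono_l a' b' (2 * k' + 1)) as G2.
      rewrite Hg in G1; rewrite Hg', <- E1, <- E2 in G2. lia. }
    assert (k = k') by lia. subst k'. f_equal. f_equal; nia.
  - intros [a b] [Hc Ho]; cbv [fst snd] in *. pose proof (in_cone_pos _ _ Hc) as [Ha Hb].
    set (d := Nat.gcd a b).
    destruct (Nat.gcd_divide_l a b) as [a' Ea]; destruct (Nat.gcd_divide_r a b) as [b' Eb].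
    fold d in Ea, Eb. assert (Hd0 : (0 < d)%nat) by nia.
    assert (Hd : Nat.odd d = true).
    { destruct Ho as [Ho|Ho]; [rewrite Ea in Ho | rewrite Eb in Ho];
        rewrite Nat.odd_mul in Ho; apply andb_prop in Ho; tauto. }
    destruct (odd_repr _ Hd) as [k Ek].
    exists (k, (a', b')); unfold cop_cone; cbv [fst snd]. rewrite <- Ek. split.
    + split; auto. split.
      * assert (d * Nat.gcd a' b' = d)%nat; [|nia].
        rewrite <- Nat.gcd_mul_mono_l, (Nat.mul_comm d a'), (Nat.mul_comm d b'), <- Ea, <- Eb.
        reflexivity.
      * clear Ek Hd Ho. destruct Hc as [H1 H2]. rewrite Ea, Eb in H1, H2. split; nia.
    + rewrite (Nat.mul_comm d a'), (Nat.mul_comm d b'), <- Ea, <- Eb; reflexivity.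
  - intros [k [a b]] _; unfold redw; cbv [fst snd]. rewrite Hhom, kap_odd_mul.
    unfold prog. destruct (kap_cases a b) as [-> | ->]; field.
Qed.

Lemma redw_sym a b : redw (a, b) = redw (b, a).
Proof. unfold redw; cbv [fst snd]; rewrite Hsym, kap_sym; reflexivity. Qed.

(** The symmetric cone is the half [b <= a] together with the reflection of its off-diagonal part;
    the only coprime pair on the diagonal is [(1, 1)]. *)
Lemma cop_sym_cone_HasPole : exists l, HasPole cop_sym_cone redw 1 l.
Proof.
  destruct cop_cone_HasPole as [l Hl].
  assert (H1 : HasPole (fun x => cop_cone x /\ x <> (1%nat, 1%nat)) redw 1 l).
  { apply HasPole_remove; auto. unfold cop_cone, in_cone; simpl; repeat split; lia. }
  assert (Hlt : forall a b, Nat.gcd a b = 1%nat -> (a, b) <> (1%nat, 1%nat) -> (b <= a)%nat -> (b < a)%nat).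
  { intros a b Hg Hn Hle. destruct (Nat.eq_dec a b) as [->|]; [|lia].
    rewrite Nat.gcd_diag in Hg. subst; congruence. }
  assert (H2 : HasPole (fun x => cop_sym_cone x /\ (fst x < snd x)%nat) redw 1 l).
  { eapply (HasPole_bij (fun x => cop_cone x /\ x <> (1%nat, 1%nat))
      (fun x => cop_sym_cone x /\ (fst x < snd x)%nat) (fun ab => (snd ab, fst ab)));
      [| | | |exact H1].
    - intros [a b] [[Hg [H2 H3]] Hn]; unfold cop_sym_cone; cbv [fst snd] in *.
      apply Hlt in Hn; auto. rewrite Nat.gcd_comm; repeat split; auto; nia.
    - intros [a b] [c d] _ _ E; cbv [fst snd] in E; inversion E; reflexivity.
    - intros [a b] [[Hg [H2 H3]] Hn]; cbv [fst snd] in *. exists (b, a).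
      unfold cop_cone, in_cone; cbv [fst snd]. rewrite Nat.gcd_comm.
      repeat split; auto; try lia. intros E; inversion E; lia.
    - intros [a b] _; apply redw_sym. }
  eexists; eapply HasPole_ext; [| |eapply HasPole_union; [|exact Hl|exact H2]]; [|auto|].
  2:{ intros [a b] [Hg [H3 H4]] [_ H5]; simpl in *; lia. }
  intros [a b]; unfold cop_cone, cop_sym_cone, in_cone; cbv [fst snd]. split.
  - intros [[Hg [H3 H4]]|[H3 _]]; auto. repeat split; auto. nia.
  - intros [Hg [H3 H4]]. destruct (Nat.le_gt_cases b a); auto.
Qed.
End CoprimeCone.

(** * Parametrization of [S] *)

Definition toS (ab : nat * nat) : nat * nat :=
  let (a, b) := ab in ((2 * a * b / kap a b)%nat, ((a * a + b * b) / kap a b)%nat).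

Lemma coprime_not_both_even a b : Nat.gcd a b = 1%nat ->
  (exists c d, a = 2 * c + 1 /\ b = 2 * d + 1 /\ kap a b = 2)%nat \/
  (exists c d, a = 2 * c + 1 /\ b = 2 * d /\ kap a b = 1)%nat \/
  (exists c d, a = 2 * c /\ b = 2 * d + 1 /\ kap a b = 1)%nat.
Proof.
  intros Hg. unfold kap.
  destruct (Nat.odd a) eqn:Ea, (Nat.odd b) eqn:Eb; simpl.
  - destruct (odd_repr _ Ea) as [c ->], (odd_repr _ Eb) as [d ->]. left; exists c, d; auto.
  - destruct (odd_repr _ Ea) as [c ->], (even_repr _ Eb) as [d ->]. right; left; exists c, d; auto.
  - destruct (even_repr _ Ea) as [c ->], (odd_repr _ Eb) as [d ->]. right; right; exists c, d; auto.
  - destruct (even_repr _ Ea) as [c ->], (even_repr _ Eb) as [d ->].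
    rewrite Nat.gcd_mul_mono_l in Hg; lia.
Qed.

Lemma toS_spec a b p q : Nat.gcd a b = 1%nat -> toS (a, b) = (p, q) ->
  (kap a b * p = 2 * a * b /\ kap a b * q = a * a + b * b)%nat.
Proof.
  intros Hg E; unfold toS in E; apply pair_equal_spec in E as [<- <-].
  destruct (coprime_not_both_even a b Hg) as [(c & d & Ea & Eb & ->)|[(c & d & _ & _ & ->)|(c & d & _ & _ & ->)]].
  - split; symmetry; apply Nat.Div0.div_exact.
    + replace (2 * a * b)%nat with (a * b * 2)%nat by ring. apply Nat.Div0.mod_mul.
    + subst a b. replace ((2 * c + 1) * (2 * c + 1) + (2 * d + 1) * (2 * d + 1))%nat with
        ((2 * c * c + 2 * c + 2 * d * d + 2 * d + 1) * 2)%nat by ring. apply Nat.Div0.mod_mul.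
  - rewrite !Nat.div_1_r; lia.
  - rewrite !Nat.div_1_r; lia.
Qed.

Lemma coprime_cross a b a' b' :
  (0 < b)%nat -> Nat.gcd a b = 1%nat -> Nat.gcd a' b' = 1%nat ->
  (a * b' = a' * b)%nat -> a = a' /\ b = b'.
Proof.
  intros Hb Hg Hg' E.
  assert (b = b').
  { apply Nat.divide_antisym.
    - apply Nat.gauss with a; [exists a'; lia | rewrite Nat.gcd_comm; auto].
    - apply Nat.gauss with a'; [exists a; lia | rewrite Nat.gcd_comm; auto]. }
  subst; split; auto; nia.
Qed.

Lemma rel_prime_gcd_1 a b :
  rel_prime (Z.of_nat a) (Z.of_nat b) <-> Nat.gcd a b = 1%nat.
Proof.
  split.
  - intros [_ _ H].
    destruct (Nat.gcd_divide_l a b) as [x Hx], (Nat.gcd_divide_r a b) as [y Hy].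
    assert (D : (Z.of_nat (Nat.gcd a b) | 1)%Z)
      by (apply H; [exists (Z.of_nat x) | exists (Z.of_nat y)]; lia).
    apply Z.divide_1_r_nonneg in D; lia.
  - intros H. constructor; try apply Z.divide_1_l. intros x [u Hu] [v Hv].
    assert (D : Nat.divide (Z.abs_nat x) (Nat.gcd a b)).
    { apply Nat.gcd_greatest; [exists (Z.abs_nat u) | exists (Z.abs_nat v)]; nia. }
    rewrite H in D. apply Nat.divide_1_r in D. exists x. nia.
Qed.

(** Both [a] and [b] are prime to [a^2 + b^2], hence so is [ab]. The leftover factor [2] is
    cancelled by [kap] when both are odd, and otherwise [a^2 + b^2] is odd. *)
Lemma gcd_toS a b p q : Nat.gcd a b = 1%nat -> toS (a, b) = (p, q) -> Nat.gcd p q = 1%nat.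
Proof.
  intros Hg E. destruct (toS_spec a b p q Hg E) as [E1 E2].
  assert (Ha : Nat.gcd a (a * a + b * b) = 1%nat).
  { apply rel_prime_gcd_1. apply rel_prime_gcd_1 in Hg.
    pose proof (rel_prime_mult _ _ _ Hg Hg) as H. apply rel_prime_bezout in H as [s t H].
    (* From [s a + t b^2 = 1] follows [(s - t a) a + t (a^2 + b^2) = 1]. *)
    apply bezout_rel_prime. apply Bezout_intro with (s - t * Z.of_nat a)%Z t.
    rewrite Nat2Z.inj_add, !Nat2Z.inj_mul. lia. }
  assert (Hb : Nat.gcd b (a * a + b * b) = 1%nat).
  { apply rel_prime_gcd_1. rewrite Nat.gcd_comm in Hg. apply rel_prime_gcd_1 in Hg.
    pose proof (rel_prime_mult _ _ _ Hg Hg) as H. apply rel_prime_bezout in H as [s t H].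
    apply bezout_rel_prime. apply Bezout_intro with (s - t * Z.of_nat b)%Z t.
    rewrite Nat2Z.inj_add, !Nat2Z.inj_mul. lia. }
  apply rel_prime_gcd_1 in Ha, Hb.
  pose proof (rel_prime_mult _ _ _ (rel_prime_sym _ _ Ha) (rel_prime_sym _ _ Hb)) as Hab.
  apply rel_prime_gcd_1.
  destruct (coprime_not_both_even a b Hg) as
    [(c & d & Ea & Eb & K)|[(c & d & Ea & Eb & K)|(c & d & Ea & Eb & K)]]; rewrite K in *.
  - replace (Z.of_nat p) with (Z.of_nat a * Z.of_nat b)%Z by lia.
    apply rel_prime_sym. apply rel_prime_div with (Z.of_nat (a * a + b * b)); auto.
    exists 2%Z; lia.
  - assert (H2 : rel_prime (Z.of_nat (a * a + b * b)) 2).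
    { apply bezout_rel_prime.
      apply Bezout_intro with 1%Z (- (2 * Z.of_nat c * Z.of_nat c + 2 * Z.of_nat c + 2 * Z.of_nat d * Z.of_nat d))%Z.
      subst a b. lia. }
    pose proof (rel_prime_mult _ _ _ H2 Hab) as H. apply rel_prime_sym.
    replace (Z.of_nat q) with (Z.of_nat (a * a + b * b)) by lia.
    replace (Z.of_nat p) with (2 * (Z.of_nat a * Z.of_nat b))%Z by lia. exact H.
  - assert (H2 : rel_prime (Z.of_nat (a * a + b * b)) 2).
    { apply bezout_rel_prime.
      apply Bezout_intro with 1%Z (- (2 * Z.of_nat c * Z.of_nat c + 2 * Z.of_nat d + 2 * Z.of_nat d * Z.of_nat d))%Z.
      subst a b. lia. }
    pose proof (rel_prime_mult _ _ _ H2 Hab) as H. apply rel_prime_sym.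
    replace (Z.of_nat q) with (Z.of_nat (a * a + b * b)) by lia.
    replace (Z.of_nat p) with (2 * (Z.of_nat a * Z.of_nat b))%Z by lia. exact H.
Qed.

Lemma toS_inS ab : cop_cone ab -> inS (toS ab).
Proof.
  destruct ab as [a b]. intros [Hg [H1 H2]]; cbv [fst snd] in *.
  destruct (toS (a, b)) as [p q] eqn:E. pose proof (gcd_toS _ _ _ _ Hg E) as Hpq.
  destruct (toS_spec _ _ _ _ Hg E) as [E1 E2].
  destruct (Nat.eq_dec a b) as [Eab|Hab].
  - left. subst b. rewrite Nat.gcd_diag in Hg. subst a. inversion E; auto.
  - right. assert (Hlt : (b < a)%nat) by lia.
    assert (Hk : (kap a b = 1 \/ kap a b = 2)%nat) by (unfold kap; destruct (_ && _)%bool; auto).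
    assert (Hr : exists r, (kap a b * r = a * a - b * b)%nat).
    { destruct (coprime_not_both_even a b Hg) as [(c & d & Ea & Eb & ->)|[(c & d & _ & _ & ->)|(c & d & _ & _ & ->)]].
      - exists (2 * (c * c + c) - 2 * (d * d + d))%nat. subst; nia.
      - exists (a * a - b * b)%nat; lia.
      - exists (a * a - b * b)%nat; lia. }
    destruct Hr as [r Hr].
    assert (Ha : (b * b < a * a)%nat) by nia.
    assert (HA : (a * a = kap a b * r + b * b)%nat) by lia.
    (* The lower bound on [p / q] is the cone condition: [16 a^2 b^2 - 3 (a^2 + b^2)^2 = (3 a^2 -
       b^2) (3 b^2 - a^2)]. *)
    assert (HC : (3 * (kap a b * q) * (kap a b * q) < 4 * (kap a b * p) * (kap a b * p))%nat).
    { rewrite E1, E2. assert (b * b < 3 * (a * a))%nat by nia.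
      zify. nia. }
    split; [auto|]. split; [|split].
    + destruct Hk as [K|K]; rewrite K in *; lia.
    + assert (kap a b * p < kap a b * q)%nat; [|nia].
      rewrite E1, E2. nia.
    + exists r.
      assert ((kap a b * r) * (kap a b * r) + (kap a b * p) * (kap a b * p) = (kap a b * q) * (kap a b * q))%nat.
      { rewrite E1, E2. rewrite Hr. zify. nia. }
      destruct Hk as [K|K]; rewrite K in *; lia.
Qed.

(** Equality of the two fractions factors as [(a b' - a' b) (a a' - b b') = 0]. The first factor
    gives equal coprime pairs; in the half cone the second vanishes only if both pairs are
    diagonal. *)
Lemma toS_inj x y : cop_cone x -> cop_cone y -> toS x = toS y -> x = y.
Proof.
  destruct x as [a b], y as [a' b']. intros [Hg [H1 H2]] [Hg' [H1' H2']] E; cbv [fst snd] in *.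
  destruct (toS (a', b')) as [p q] eqn:E'.
  destruct (toS_spec _ _ _ _ Hg E) as [E1 E2]. destruct (toS_spec _ _ _ _ Hg' E') as [E3 E4].
  assert (Hb : (0 < b)%nat) by nia. assert (Hb' : (0 < b')%nat) by nia.
  assert (X : ((a * a + b * b) * (a' * b') = (a' * a' + b' * b') * (a * b))%nat).
  { assert (K1 : (kap a b = 1 \/ kap a b = 2)%nat) by (unfold kap; destruct (_ && _)%bool; auto).
    assert (K2 : (kap a' b' = 1 \/ kap a' b' = 2)%nat) by (unfold kap; destruct (_ && _)%bool; auto).
    destruct K1 as [K1|K1], K2 as [K2|K2]; rewrite K1 in *; rewrite K2 in *; nia. }
  assert (F : ((Z.of_nat a * Z.of_nat b' - Z.of_nat a' * Z.of_nat b) *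
              (Z.of_nat a * Z.of_nat a' - Z.of_nat b * Z.of_nat b') = 0)%Z) by nia.
  apply Z.mul_eq_0 in F as [F|F].
  - destruct (coprime_cross a b a' b') as [-> ->]; auto. lia.
  - assert (a = b /\ a' = b') as [-> ->] by nia.
    rewrite Nat.gcd_diag in Hg, Hg'; subst; auto.
Qed.

(** From [r = (a^2 - b^2) / kap] one gets [q + r = 2 a^2 / kap], so [(q + r) : p = a : b], and the
    pair is found by reducing [(q + r, p)]. *)
Lemma toS_surj y : inS y -> exists x, cop_cone x /\ toS x = y.
Proof.
  destruct y as [p q]. intros [[-> ->]|(Hpq & H3 & Hlt & r & Hr)].
  - exists (1%nat, 1%nat); split; [|reflexivity]. unfold cop_cone, in_cone; simpl; lia.
  - assert (Hp : (0 < p)%nat) by nia.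
    set (d := Nat.gcd (q + r) p).
    destruct (Nat.gcd_divide_l (q + r) p) as [a Ea]; destruct (Nat.gcd_divide_r (q + r) p) as [b Eb].
    fold d in Ea, Eb. assert (Hd : (0 < d)%nat) by nia.
    assert (Hg : Nat.gcd a b = 1%nat).
    { assert (d * Nat.gcd a b = d)%nat; [|nia].
      rewrite <- Nat.gcd_mul_mono_l, (Nat.mul_comm d a), (Nat.mul_comm d b), <- Ea, <- Eb.
      reflexivity. }
    (* [3 q^2 < 4 p^2] says [4 r^2 < q^2]. Since [p^2 = (q - r) (q + r)], the cone condition
       [(q + r)^2 < 3 p^2] is then again [2 r < q]. *)
    assert (H2r : (2 * r < q)%nat) by nia.
    assert (Hsq : ((q + r) * (q + r) < 3 * p * p)%nat) by nia.
    assert (Hcone : in_cone a b).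
    { split; [nia|]. rewrite Ea in Hsq. rewrite Eb in Hsq. nia. }
    exists (a, b); split; [split; auto|].
    destruct (toS (a, b)) as [p' q'] eqn:E.
    pose proof (gcd_toS _ _ _ _ Hg E) as Hpq'. destruct (toS_spec _ _ _ _ Hg E) as [E1 E2].
    assert (Hk : (kap a b = 1 \/ kap a b = 2)%nat) by (unfold kap; destruct (_ && _)%bool; auto).
    assert (X : (2 * a * b * q = (a * a + b * b) * p)%nat).
    { assert (d * d * (2 * a * b * q) = d * d * ((a * a + b * b) * p))%nat; [|nia].
      replace (d * d * (2 * a * b * q))%nat with (2 * (a * d) * (b * d) * q)%nat by ring.
      replace (d * d * ((a * a + b * b) * p))%nat with (((a * d) * (a * d) + (b * d) * (b * d)) * p)%nat by ring.
      rewrite <- Ea, <- Eb. nia. }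
    destruct (coprime_cross p q p' q') as [-> ->]; auto; try lia.
Qed.

Lemma redw_d_toS ab : cop_cone ab -> redw cone_d ab = INR (fst (toS ab)).
Proof.
  destruct ab as [a b]; intros [Hg _]; cbv [fst snd] in Hg.
  destruct (toS (a, b)) as [p q] eqn:E. destruct (toS_spec _ _ _ _ Hg E) as [E1 _].
  apply (f_equal INR) in E1. rewrite !mult_INR in E1. unfold redw, cone_d; cbv [fst snd].
  replace (2 * INR a * INR b) with (INR (kap a b) * INR p) by (rewrite E1; simpl; ring).
  destruct (kap_cases a b) as [-> | ->]; field.
Qed.

Lemma redw_m_toS ab : cop_cone ab -> redw cone_m ab = INR (snd (toS ab)).
Proof.
  destruct ab as [a b]; intros [Hg _]; cbv [fst snd] in Hg.
  destruct (toS (a, b)) as [p q] eqn:E. destruct (toS_spec _ _ _ _ Hg E) as [_ E1].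
  apply (f_equal INR) in E1. rewrite plus_INR, !mult_INR in E1. unfold redw, cone_m; cbv [fst snd].
  replace (INR a ^ 2 + INR b ^ 2) with (INR (kap a b) * INR q) by (rewrite E1; simpl; ring).
  destruct (kap_cases a b) as [-> | ->]; field.
Qed.

Lemma cone_d_pos a b : (0 < a)%nat -> (0 < b)%nat -> 0 < cone_d (a, b).
Proof.
  intros Ha Hb; apply lt_0_INR in Ha, Hb. unfold cone_d; cbv [fst snd]. nra.
Qed.

Lemma cone_m_pos a b : (0 < a)%nat -> (0 < b)%nat -> 0 < cone_m (a, b).
Proof.
  intros Ha Hb; apply lt_0_INR in Ha, Hb. unfold cone_m; cbv [fst snd]. nra.
Qed.

Lemma cone_d_hom d a b : cone_d ((d * a)%nat, (d * b)%nat) = INR d ^ 2 * cone_d (a, b).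
Proof. unfold cone_d; cbv [fst snd]; rewrite !mult_INR; ring. Qed.

Lemma cone_m_hom d a b : cone_m ((d * a)%nat, (d * b)%nat) = INR d ^ 2 * cone_m (a, b).
Proof. unfold cone_m; cbv [fst snd]; rewrite !mult_INR; ring. Qed.

Lemma cone_d_sym a b : cone_d (a, b) = cone_d (b, a).
Proof. unfold cone_d; cbv [fst snd]; ring. Qed.

Lemma cone_m_sym a b : cone_m (a, b) = cone_m (b, a).
Proof. unfold cone_m; cbv [fst snd]; ring. Qed.

Lemma inS_ge1 pq : inS pq -> 1 <= INR (fst pq) /\ 1 <= INR (snd pq).
Proof.
  destruct pq as [p q]; intros H.
  assert (1 <= p /\ 1 <= q)%nat as [H1 H2].
  { destruct H as [[-> ->]|(_ & H3 & H4 & _)]; [lia | nia]. }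
  apply le_INR in H1, H2; auto.
Qed.

Lemma W_d_props : DirichletProps inS (fun pq => INR (fst pq)) 1.
Proof.
  destruct (cop_cone_HasPole cone_d cone_d_pos cone_d_hom coset_cone_d_HasPole) as [l Hl].
  apply HasPole_DirichletProps with l; [intros; apply inS_ge1; auto|].
  exact (proj1 (HasPole_bij _ _ toS _ (fun pq => INR (fst pq)) _ _ toS_inS toS_inj toS_surj redw_d_toS) Hl).
Qed.

Lemma W_m_props : DirichletProps inS (fun pq => INR (snd pq)) 1.
Proof.
  destruct (cop_cone_HasPole cone_m cone_m_pos cone_m_hom coset_cone_m_HasPole) as [l Hl].
  apply HasPole_DirichletProps with l; [intros; apply inS_ge1; auto|].
  exact (proj1 (HasPole_bij _ _ toS _ (fun pq => INR (snd pq)) _ _ toS_inS toS_inj toS_surj redw_m_toS) Hl).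
Qed.

(** * Well-rounded lattices *)

Open Scope Z_scope.

(* The lattice spanned by the sides of the rhombus with diagonals [a g] and [i b g],
   that is, by [(a + i b) g / 2] and [(a - i b) g / 2]. *)
Definition in_rhombic (a b g1 g2 X Y : Z) : Prop :=
  exists m n, 2 * X = (m + n) * (a * g1) - (m - n) * (b * g2) /\
              2 * Y = (m + n) * (a * g2) + (m - n) * (b * g1).

(* The two coordinates of [g = (1 + i) h] for [k = 2], of [g = 2 h] otherwise. *)
Definition diag1 (k : nat) (h : Z * Z) : Z :=
  if (k =? 2)%nat then fst h - snd h else 2 * fst h.
Definition diag2 (k : nat) (h : Z * Z) : Z :=
  if (k =? 2)%nat then fst h + snd h else 2 * snd h.

Lemma coprime_parity a b : Nat.gcd a b = 1%nat ->
  (exists c d, Z.of_nat a = 2 * c + 1 /\ Z.of_nat b = 2 * d + 1 /\ kap a b = 2%nat) \/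
  (exists c d, Z.of_nat a = 2 * c + 1 /\ Z.of_nat b = 2 * d /\ kap a b = 1%nat) \/
  (exists c d, Z.of_nat a = 2 * c /\ Z.of_nat b = 2 * d + 1 /\ kap a b = 1%nat).
Proof.
  intros Hg. destruct (coprime_not_both_even a b Hg) as
    [(c & d & Ea & Eb & K)|[(c & d & Ea & Eb & K)|(c & d & Ea & Eb & K)]];
    rewrite K; [left | right; left | right; right]; exists (Z.of_nat c), (Z.of_nat d); lia.
Qed.

(** The halved sides [(a + i b) g / 2] are integral: [g] is even, or [a], [b] are both odd and
    [(a + i b) (1 + i)] is divisible by [2]. *)
Lemma rhombic_sides a b h : Nat.gcd a b = 1%nat ->
  let A := Z.of_nat a in let B := Z.of_nat b in
  let g1 := diag1 (kap a b) h in let g2 := diag2 (kap a b) h in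
  exists u1 u2 v1 v2,
    2 * u1 = A * g1 - B * g2 /\ 2 * u2 = A * g2 + B * g1 /\
    2 * v1 = A * g1 + B * g2 /\ 2 * v2 = A * g2 - B * g1.
Proof.
  intros Hg A B. destruct h as [x y].
  destruct (coprime_parity a b Hg) as
    [(c & d & Ea & Eb & ->)|[(c & d & Ea & Eb & ->)|(c & d & Ea & Eb & ->)]];
    unfold diag1, diag2; simpl fst; simpl snd; simpl Nat.eqb; cbv iota.
  - unfold A, B; rewrite Ea, Eb.
    exists ((c - d) * x - (c + d + 1) * y), ((c + d + 1) * x + (c - d) * y),
           ((c + d + 1) * x - (c - d) * y), ((c - d) * x + (c + d + 1) * y).
    repeat split; ring.
  - exists (A * x - B * y), (A * y + B * x), (A * x + B * y), (A * y - B * x).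
    repeat split; ring.
  - exists (A * x - B * y), (A * y + B * x), (A * x + B * y), (A * y - B * x).
    repeat split; ring.
Qed.

Lemma diag_norm k h : (k = 1 \/ k = 2)%nat ->
  Z.of_nat k * sqn (diag1 k h) (diag2 k h) = 4 * sqn (fst h) (snd h).
Proof.
  intros [-> | ->]; unfold diag1, diag2, sqn; simpl Nat.eqb; cbv iota; ring.
Qed.

(** * Norms and minimal vectors of a rhombic lattice *)

Section Rhombic.
Variables a b g1 g2 u1 u2 v1 v2 : Z.
Hypothesis Ha : 0 < a.
Hypothesis Hb : 0 < b.
Hypothesis Hab : a * a < 3 * b * b.
Hypothesis Hba : b * b < 3 * a * a.
Hypothesis Hg : 0 < sqn g1 g2.
Hypothesis Hu1 : 2 * u1 = a * g1 - b * g2.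
Hypothesis Hu2 : 2 * u2 = a * g2 + b * g1.
Hypothesis Hv1 : 2 * v1 = a * g1 + b * g2.
Hypothesis Hv2 : 2 * v2 = a * g2 - b * g1.

Lemma rhombic_span X Y :
  in_rhombic a b g1 g2 X Y <-> exists m n, X = m * u1 + n * v1 /\ Y = m * u2 + n * v2.
Proof. split; intros (m & n & E1 & E2); exists m, n; split; lia. Qed.

Lemma rhombic_det : 2 * (u1 * v2 - u2 * v1) = - (a * b * sqn g1 g2).
Proof.
  assert (4 * (u1 * v2 - u2 * v1) = (2 * u1) * (2 * v2) - (2 * u2) * (2 * v1)) by ring.
  rewrite Hu1, Hu2, Hv1, Hv2 in H. unfold sqn. lia.
Qed.

(** In the orthogonal diagonals, [m u + n v] has coefficients [(m + n) / 2] and [(m - n) / 2], so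
    there is no mixed term. *)
Lemma rhombic_norm m n :
  4 * sqn (m * u1 + n * v1) (m * u2 + n * v2) =
  sqn g1 g2 * ((m + n) * (m + n) * (a * a) + (m - n) * (m - n) * (b * b)).
Proof.
  assert (4 * sqn (m * u1 + n * v1) (m * u2 + n * v2) =
    (m * (2 * u1) + n * (2 * v1)) * (m * (2 * u1) + n * (2 * v1)) +
    (m * (2 * u2) + n * (2 * v2)) * (m * (2 * u2) + n * (2 * v2))) by (unfold sqn; ring).
  rewrite H, Hu1, Hu2, Hv1, Hv2. unfold sqn; ring.
Qed.

Lemma rhombic_norm_u : 4 * sqn u1 u2 = sqn g1 g2 * (a * a + b * b).
Proof.
  pose proof (rhombic_norm 1 0) as H.
  replace (1 * u1 + 0 * v1) with u1 in H by ring. replace (1 * u2 + 0 * v2) with u2 in H by ring.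
  rewrite H; ring.
Qed.

Lemma rhombic_norm_v : 4 * sqn v1 v2 = sqn g1 g2 * (a * a + b * b).
Proof.
  pose proof (rhombic_norm 0 1) as H.
  replace (0 * u1 + 1 * v1) with v1 in H by ring. replace (0 * u2 + 1 * v2) with v2 in H by ring.
  rewrite H; ring.
Qed.

(** If [m + n] and [m - n] are nonzero, both squares are at least [1]. If one vanishes, the other is
    even and its square is at least [4]; then [a^2 < 3 b^2] or [b^2 < 3 a^2] makes the inequality
    strict. So the only minimal vectors are the sides and their opposites. *)
Lemma rhombic_coef_min m n : (m, n) <> (0, 0) ->
  a * a + b * b <= (m + n) * (m + n) * (a * a) + (m - n) * (m - n) * (b * b) /\
  (a * a + b * b = (m + n) * (m + n) * (a * a) + (m - n) * (m - n) * (b * b) ->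
   (m = 0 /\ (n = 1 \/ n = -1)) \/ (n = 0 /\ (m = 1 \/ m = -1))).
Proof.
  intros Hmn.
  assert (Hmn' : m <> 0 \/ n <> 0).
  { destruct (Z.eq_dec m 0), (Z.eq_dec n 0); subst; auto. }
  assert (PA : 0 < a * a) by nia. assert (PB : 0 < b * b) by nia.
  destruct (Z.eq_dec (m + n) 0) as [E|E]; [|destruct (Z.eq_dec (m - n) 0) as [F|F]].
  - replace n with (- m) in * by lia.
    assert (1 <= m * m) by nia.
    replace ((m + - m) * (m + - m) * (a * a) + (m - - m) * (m - - m) * (b * b))
      with (4 * (m * m) * (b * b)) by ring.
    split; [|intros; exfalso]; nia.
  - replace n with m in * by lia.
    assert (1 <= m * m) by nia.
    replace ((m + m) * (m + m) * (a * a) + (m - m) * (m - m) * (b * b))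
      with (4 * (m * m) * (a * a)) by ring.
    split; [|intros; exfalso]; nia.
  - assert (P : 1 <= (m + n) * (m + n)) by nia. assert (Q : 1 <= (m - n) * (m - n)) by nia.
    split; [nia|]. intros H.
    assert ((m + n) * (m + n) = 1) by nia. assert ((m - n) * (m - n) = 1) by nia.
    assert (m + n = 1 \/ m + n = -1) by nia. assert (m - n = 1 \/ m - n = -1) by nia.
    lia.
Qed.

Lemma rhombic_min X Y : in_rhombic a b g1 g2 X Y -> (X, Y) <> (0, 0) ->
  sqn u1 u2 <= sqn X Y /\
  (sqn X Y = sqn u1 u2 ->
    (X, Y) = (u1, u2) \/ (X, Y) = (- u1, - u2) \/ (X, Y) = (v1, v2) \/ (X, Y) = (- v1, - v2)).
Proof.
  intros H HXY. apply rhombic_span in H as (m & n & -> & ->).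
  assert (Hmn : (m, n) <> (0, 0)).
  { intros E; inversion E; subst; apply HXY; f_equal; ring. }
  destruct (rhombic_coef_min m n Hmn) as [H1 H2].
  pose proof (rhombic_norm m n) as E. pose proof rhombic_norm_u as Eu. split.
  - nia.
  - intros E'. rewrite E', Eu in E.
    assert (a * a + b * b = (m + n) * (m + n) * (a * a) + (m - n) * (m - n) * (b * b)) as E2.
    { apply Z.mul_reg_l with (sqn g1 g2); lia. }
    destruct (H2 E2) as [[-> [-> | ->]]|[-> [-> | ->]]].
    + right; right; left; f_equal; ring.
    + right; right; right; f_equal; ring.
    + left; f_equal; ring.
    + right; left; f_equal; ring.
Qed.

Lemma rhombic_det_neq0 : u1 * v2 - u2 * v1 <> 0.
Proof. pose proof rhombic_det. assert (0 < a * b * sqn g1 g2) by nia. lia. Qed.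

Lemma rhombic_mem_u : in_rhombic a b g1 g2 u1 u2.
Proof. exists 1, 0; lia. Qed.

Lemma rhombic_mem_v : in_rhombic a b g1 g2 v1 v2.
Proof. exists 0, 1; lia. Qed.
End Rhombic.

(** * The lattice of an index, its determinant and its minimum *)

Definition lat_of (z : (nat * nat) * (Z * Z)) : ZLat := fun X Y =>
  let '((a, b), h) := z in
  if excluded_middle_informative
       (in_rhombic (Z.of_nat a) (Z.of_nat b) (diag1 (kap a b) h) (diag2 (kap a b) h) X Y)
  then true else false.

Lemma lat_of_spec a b h X Y : lat_of ((a, b), h) X Y = true <->
  in_rhombic (Z.of_nat a) (Z.of_nat b) (diag1 (kap a b) h) (diag2 (kap a b) h) X Y.
Proof.
  unfold lat_of. destruct (excluded_middle_informative _); split; auto; discriminate.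
Qed.

Definition wr_index (z : (nat * nat) * (Z * Z)) : Prop := cop_sym_cone (fst z) /\ quarter (snd z).

Lemma kap_12 a b : (kap a b = 1 \/ kap a b = 2)%nat.
Proof. unfold kap; destruct (_ && _)%bool; auto. Qed.

Lemma quarter_sqn_pos h : quarter h -> 0 < sqn (fst h) (snd h).
Proof. destruct h as [x y]; unfold quarter, sqn; simpl; nia. Qed.

Lemma diag_norm_pos k h : (k = 1 \/ k = 2)%nat -> 0 < sqn (fst h) (snd h) ->
  0 < sqn (diag1 k h) (diag2 k h).
Proof. intros Hk Hh. pose proof (diag_norm k h Hk). nia. Qed.

Lemma cop_sym_cone_Z a b : cop_sym_cone (a, b) ->
  0 < Z.of_nat a /\ 0 < Z.of_nat b /\
  Z.of_nat a * Z.of_nat a < 3 * Z.of_nat b * Z.of_nat b /\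
  Z.of_nat b * Z.of_nat b < 3 * Z.of_nat a * Z.of_nat a.
Proof. intros [_ [H1 H2]]; cbv [fst snd] in *. nia. Qed.

(** One basis is an integral combination of the other. Applied both ways, this makes [latdet]
    independent of the basis that [epsilon] picks. *)
Lemma basis_det_divide (L : ZLat) u1 u2 v1 v2 u1' u2' v1' v2' :
  IsBasis L ((u1, u2), (v1, v2)) -> IsBasis L ((u1', u2'), (v1', v2')) ->
  (u1 * v2 - u2 * v1 | u1' * v2' - u2' * v1').
Proof.
  intros [_ H1] [_ H2].
  assert (Hu : L u1' u2' = true) by (apply H2; exists 1, 0; lia).
  assert (Hv : L v1' v2' = true) by (apply H2; exists 0, 1; lia).
  apply H1 in Hu as (p & q & -> & ->); apply H1 in Hv as (r & s & -> & ->).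
  exists (p * s - q * r); ring.
Qed.

Lemma latdet_basis (L : ZLat) u1 u2 v1 v2 :
  IsBasis L ((u1, u2), (v1, v2)) -> latdet L = IZR (Z.abs (u1 * v2 - u2 * v1)).
Proof.
  intros H. unfold latdet.
  assert (Hs : IsBasis L (epsilon (inhabits ((0, 0), (0, 0))) (IsBasis L)))
    by (apply epsilon_spec; eauto).
  destruct (epsilon _ _) as [[x1 x2] [y1 y2]]. f_equal.
  apply Z.divide_antisym_nonneg; try lia; apply Z.divide_abs_l, Z.divide_abs_r;
    eapply basis_det_divide; eauto.
Qed.

Lemma latmin2_spec (L : ZLat) x y : L x y = true -> (x, y) <> (0, 0) ->
  (forall x' y', L x' y' = true -> (x', y') <> (0, 0) -> sqn x y <= sqn x' y') ->
  latmin2 L = IZR (sqn x y).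
Proof.
  intros H1 H2 H3. unfold latmin2. f_equal.
  set (Q := fun m : Z => (exists x y, L x y = true /\ (x, y) <> (0, 0) /\ sqn x y = m) /\
    (forall x y, L x y = true -> (x, y) <> (0, 0) -> m <= sqn x y)).
  assert (HQ : Q (epsilon (inhabits 0) Q)).
  { apply epsilon_spec. exists (sqn x y); split; eauto 10. }
  destruct HQ as [(x' & y' & A & B & C) D].
  apply Z.le_antisymm; auto. rewrite <- C; auto.
Qed.

Lemma lat_of_data z : wr_index z ->
  WRZ2 (lat_of z) /\
  latdet (lat_of z) = (redw cone_d (fst z) * gnorm (snd z))%R /\
  latmin2 (lat_of z) = (redw cone_m (fst z) * gnorm (snd z))%R.
Proof.
  destruct z as [[a b] h]; intros [Hc Hh]; cbv [fst snd] in *.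
  pose proof (cop_sym_cone_Z a b Hc) as (Ha & Hb & Hab & Hba).
  destruct Hc as [Hgcd _]; cbv [fst snd] in Hgcd.
  pose proof (quarter_sqn_pos h Hh) as Hn.
  pose proof (diag_norm (kap a b) h (kap_12 a b)) as Hdn.
  pose proof (diag_norm_pos (kap a b) h (kap_12 a b) Hn) as Hgp.
  destruct (rhombic_sides a b h Hgcd) as (u1 & u2 & v1 & v2 & E1 & E2 & E3 & E4).
  set (A := Z.of_nat a) in *. set (B := Z.of_nat b) in *.
  set (g1 := diag1 (kap a b) h) in *. set (g2 := diag2 (kap a b) h) in *.
  assert (Hbas : IsBasis (lat_of ((a, b), h)) ((u1, u2), (v1, v2))).
  { split.
    - apply (rhombic_det_neq0 A B g1 g2 u1 u2 v1 v2); auto.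
    - intros X Y. rewrite lat_of_spec. apply (rhombic_span A B g1 g2); auto. }
  assert (Hmu : lat_of ((a, b), h) u1 u2 = true)
    by (apply lat_of_spec; apply (rhombic_mem_u A B g1 g2 u1 u2); auto).
  assert (Hmv : lat_of ((a, b), h) v1 v2 = true)
    by (apply lat_of_spec; apply (rhombic_mem_v A B g1 g2 v1 v2); auto).
  assert (Hdet := rhombic_det A B g1 g2 u1 u2 v1 v2 E1 E2 E3 E4).
  assert (Hd0 := rhombic_det_neq0 A B g1 g2 u1 u2 v1 v2 Ha Hb Hgp E1 E2 E3 E4).
  assert (Hnu := rhombic_norm_u A B g1 g2 u1 u2 v1 v2 E1 E2 E3 E4).
  assert (Hnv := rhombic_norm_v A B g1 g2 u1 u2 v1 v2 E1 E2 E3 E4).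
  assert (Hmin : forall x y, lat_of ((a, b), h) x y = true -> (x, y) <> (0, 0) ->
     sqn u1 u2 <= sqn x y).
  { intros x y Hx Hxy. apply lat_of_spec in Hx.
    apply (rhombic_min A B g1 g2 u1 u2 v1 v2); auto. }
  assert (Hk : IZR (Z.of_nat (kap a b)) = 1%R \/ IZR (Z.of_nat (kap a b)) = 2%R).
  { destruct (kap_12 a b) as [-> | ->]; simpl; auto. }
  split; [split|split].
  - eexists; exact Hbas.
  - exists u1, u2, v1, v2. repeat split; auto. lia.
  - rewrite (latdet_basis _ _ _ _ _ Hbas).
    assert (E : Z.of_nat (kap a b) * Z.abs (u1 * v2 - u2 * v1) = 2 * A * B * sqn (fst h) (snd h)).
    { assert (0 < A * B * sqn g1 g2) by nia.
      assert (2 * Z.abs (u1 * v2 - u2 * v1) = A * B * sqn g1 g2) by lia.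
      assert (2 * (Z.of_nat (kap a b) * Z.abs (u1 * v2 - u2 * v1)) =
        A * B * (Z.of_nat (kap a b) * sqn g1 g2)) by nia.
      rewrite Hdn in *. lia. }
    apply (f_equal IZR) in E. rewrite !mult_IZR in E.
    unfold redw, cone_d, gnorm; cbv [fst snd]. rewrite !INR_IZR_INZ. fold A B.
    destruct h as [x y]; cbv [fst snd] in *.
    destruct Hk as [Hk|Hk]; rewrite Hk in *; lra.
  - rewrite (latmin2_spec _ u1 u2); auto.
    2:{ intros E; inversion E; subst. apply Hd0; ring. }
    assert (E : Z.of_nat (kap a b) * sqn u1 u2 = (A * A + B * B) * sqn (fst h) (snd h)).
    { assert (4 * (Z.of_nat (kap a b) * sqn u1 u2) =
        (Z.of_nat (kap a b) * sqn g1 g2) * (A * A + B * B)) by nia.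
      rewrite Hdn in *. lia. }
    apply (f_equal IZR) in E. rewrite !mult_IZR, plus_IZR, !mult_IZR in E.
    unfold redw, cone_m, gnorm; cbv [fst snd]. rewrite !INR_IZR_INZ. fold A B.
    destruct h as [x y]; cbv [fst snd] in *.
    destruct Hk as [Hk|Hk]; rewrite Hk in *; simpl; lra.
Qed.

(** * Distinct indices give distinct lattices *)

Lemma sqr_mul_eq a b a' b' N N' :
  0 < a -> 0 < b -> 0 < a' -> 0 < b' -> 0 < N -> 0 < N' ->
  a * a * N = a' * a' * N' -> b * b * N = b' * b' * N' -> a * b' = a' * b.
Proof.
  intros Ha Hb Ha' Hb' HN HN' E1 E2.
  assert (E : (a * b') * (a * b') = (a' * b) * (a' * b)).
  { apply Z.mul_reg_l with (N * N'); [nia|].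
    replace (N * N' * (a * b' * (a * b'))) with ((a * a * N) * (b' * b' * N')) by ring.
    rewrite <- E2, E1. ring. }
  assert (0 < a * b') by nia. assert (0 < a' * b) by nia. nia.
Qed.

Lemma coprime_cross_Z a b a' b' :
  (0 < b)%nat -> Nat.gcd a b = 1%nat -> Nat.gcd a' b' = 1%nat ->
  Z.of_nat a * Z.of_nat b' = Z.of_nat a' * Z.of_nat b -> a = a' /\ b = b'.
Proof. intros; apply coprime_cross; auto. lia. Qed.

(** The four alternatives say [g = e g'] with [e] equal to [1], [-1], [i], [-i]. As [g] is a fixed
    multiple of [h], the same unit relates [h] to [h'], and [quarter] contains only one associate of
    each. *)
Lemma diag_inj_sign k h h' : (k = 1 \/ k = 2)%nat -> quarter h -> quarter h' ->
  (diag1 k h = diag1 k h' /\ diag2 k h = diag2 k h') \/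
  (diag1 k h = - diag1 k h' /\ diag2 k h = - diag2 k h') \/
  (diag1 k h = - diag2 k h' /\ diag2 k h = diag1 k h') \/
  (diag1 k h = diag2 k h' /\ diag2 k h = - diag1 k h') -> h = h'.
Proof.
  destruct h as [x y], h' as [x' y']. unfold quarter, diag1, diag2; cbv [fst snd].
  intros [-> | ->]; simpl Nat.eqb; cbv iota; intros H H' E; f_equal; lia.
Qed.

Lemma scaled_eq a b g1 g2 h1 h2 e :
  0 < a -> a = b -> (e = 1 \/ e = -1) -> a * g1 = e * (b * h1) -> a * g2 = e * (b * h2) ->
  g1 = e * h1 /\ g2 = e * h2.
Proof. intros Ha <- He E1 E2. split; apply Z.mul_reg_l with a; lia. Qed.

(** Equal lattices have the same four minimal vectors, so the sides agree up to order and signs.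
    Hence the diagonals, as sums and differences of the sides, agree up to sign or are interchanged;
    norms then determine [a : b], and [g] up to a unit. *)
Lemma lat_of_inj z z' : wr_index z -> wr_index z' -> lat_of z = lat_of z' -> z = z'.
Proof.
  destruct z as [[a b] h], z' as [[a' b'] h'].
  intros [Hc Hh] [Hc' Hh'] EL; cbv [fst snd] in *.
  pose proof (cop_sym_cone_Z a b Hc) as (Ha & Hb & Hab & Hba).
  destruct Hc as [Hgcd _]; cbv [fst snd] in Hgcd.
  pose proof (diag_norm_pos (kap a b) h (kap_12 a b) (quarter_sqn_pos h Hh)) as Hgp.
  destruct (rhombic_sides a b h Hgcd) as (u1 & u2 & v1 & v2 & E1 & E2 & E3 & E4).
  pose proof (cop_sym_cone_Z a' b' Hc') as (Ha' & Hb' & Hab' & Hba').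
  destruct Hc' as [Hgcd' _]; cbv [fst snd] in Hgcd'.
  pose proof (diag_norm_pos (kap a' b') h' (kap_12 a' b') (quarter_sqn_pos h' Hh')) as Hgp'.
  destruct (rhombic_sides a' b' h' Hgcd') as (u1' & u2' & v1' & v2' & E1' & E2' & E3' & E4').
  set (g1 := diag1 (kap a b) h) in *. set (g2 := diag2 (kap a b) h) in *.
  set (g1' := diag1 (kap a' b') h') in *. set (g2' := diag2 (kap a' b') h') in *.
  set (A := Z.of_nat a) in *. set (B := Z.of_nat b) in *.
  set (A' := Z.of_nat a') in *. set (B' := Z.of_nat b') in *.
  assert (HL : forall X Y, in_rhombic A B g1 g2 X Y <-> in_rhombic A' B' g1' g2' X Y).
  { intros X Y. eapply iff_trans; [symmetry; apply (lat_of_spec a b h)|].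
    rewrite EL; apply lat_of_spec. }
  assert (Hd0 := rhombic_det_neq0 A B g1 g2 u1 u2 v1 v2 Ha Hb Hgp E1 E2 E3 E4).
  assert (Hd0' := rhombic_det_neq0 A' B' g1' g2' u1' u2' v1' v2' Ha' Hb' Hgp' E1' E2' E3' E4').
  assert (Mu := rhombic_mem_u A B g1 g2 u1 u2 E1 E2).
  assert (Mv := rhombic_mem_v A B g1 g2 v1 v2 E3 E4).
  assert (Mu' := rhombic_mem_u A' B' g1' g2' u1' u2' E1' E2').
  assert (Nu : (u1, u2) <> (0, 0)) by (intros E; inversion E; subst; apply Hd0; ring).
  assert (Nv : (v1, v2) <> (0, 0)) by (intros E; inversion E; subst; apply Hd0; ring).
  assert (Nu' : (u1', u2') <> (0, 0)).
  { intros E; inversion E as [[F1 F2]]; apply Hd0'; rewrite F1, F2; ring. }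
  assert (Euv : sqn u1 u2 = sqn v1 v2).
  { pose proof (rhombic_norm_u A B g1 g2 u1 u2 v1 v2 E1 E2 E3 E4).
    pose proof (rhombic_norm_v A B g1 g2 u1 u2 v1 v2 E1 E2 E3 E4). lia. }
  destruct (rhombic_min A' B' g1' g2' u1' u2' v1' v2' Ha' Hb' Hab' Hba' Hgp' E1' E2' E3' E4'
     u1 u2 (proj1 (HL _ _) Mu) Nu) as [Lu Cu].
  destruct (rhombic_min A' B' g1' g2' u1' u2' v1' v2' Ha' Hb' Hab' Hba' Hgp' E1' E2' E3' E4'
     v1 v2 (proj1 (HL _ _) Mv) Nv) as [Lv Cv].
  destruct (rhombic_min A B g1 g2 u1 u2 v1 v2 Ha Hb Hab Hba Hgp E1 E2 E3 E4
     u1' u2' (proj2 (HL _ _) Mu') Nu') as [Lu' _].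
  specialize (Cu ltac:(lia)). specialize (Cv ltac:(lia)).
  assert (Key : exists e e', (e = 1 \/ e = -1) /\ (e' = 1 \/ e' = -1) /\
    ((A * g1 = e * (A' * g1') /\ A * g2 = e * (A' * g2') /\
      B * g1 = e' * (B' * g1') /\ B * g2 = e' * (B' * g2')) \/
     (A * g1 = e * (B' * - g2') /\ A * g2 = e * (B' * g1') /\
      B * g1 = e' * (A' * - g2') /\ B * g2 = e' * (A' * g1')))).
  { assert (S1 : A * g1 = u1 + v1) by lia. assert (S2 : A * g2 = u2 + v2) by lia.
    assert (S3 : B * g1 = u2 - v2) by lia. assert (S4 : B * g2 = v1 - u1) by lia.
    assert (S1' : A' * g1' = u1' + v1') by lia. assert (S2' : A' * g2' = u2' + v2') by lia.
    assert (S3' : B' * g1' = u2' - v2') by lia. assert (S4' : B' * g2' = v1' - u1') by lia.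
    rewrite S1, S2, S3, S4.
    replace (B' * - g2') with (u1' - v1') by lia. replace (A' * - g2') with (- u2' - v2') by lia.
    rewrite S1', S2', S3', S4'.
    clear - Cu Cv Hd0.
    destruct Cu as [E|[E|[E|E]]]; inversion E; clear E; subst;
    destruct Cv as [E|[E|[E|E]]]; inversion E; clear E; subst;
    try (exfalso; apply Hd0; ring);
    first
     [ exists 1, 1; split; [lia|split; [lia|]]; (left; lia) || (right; lia)
     | exists 1, (-1); split; [lia|split; [lia|]]; (left; lia) || (right; lia)
     | exists (-1), 1; split; [lia|split; [lia|]]; (left; lia) || (right; lia)
     | exists (-1), (-1); split; [lia|split; [lia|]]; (left; lia) || (right; lia) ]. }
  destruct Key as (e & e' & He & He' & [(K1 & K2 & K3 & K4)|(K1 & K2 & K3 & K4)]).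
  - assert (N1 : A * A * sqn g1 g2 = A' * A' * sqn g1' g2').
    { replace (A * A * sqn g1 g2) with ((A * g1) * (A * g1) + (A * g2) * (A * g2)) by (unfold sqn; ring).
      rewrite K1, K2. unfold sqn. destruct He as [-> | ->]; ring. }
    assert (N2 : B * B * sqn g1 g2 = B' * B' * sqn g1' g2').
    { replace (B * B * sqn g1 g2) with ((B * g1) * (B * g1) + (B * g2) * (B * g2)) by (unfold sqn; ring).
      rewrite K3, K4. unfold sqn. destruct He' as [-> | ->]; ring. }
    pose proof (sqr_mul_eq _ _ _ _ _ _ Ha Hb Ha' Hb' Hgp Hgp' N1 N2) as X.
    destruct (coprime_cross_Z a b a' b') as [Ea Eb]; auto; [lia|].
    assert (EA : A = A') by (unfold A, A'; congruence).
    destruct (scaled_eq A A' g1 g2 g1' g2' e) as [G1 G2]; auto.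
    subst a' b'. f_equal. apply (diag_inj_sign (kap a b)); auto using kap_12.
    fold g1 g2 g1' g2'. destruct He as [-> | ->]; [left | right; left]; lia.
  - assert (N1 : A * A * sqn g1 g2 = B' * B' * sqn g1' g2').
    { replace (A * A * sqn g1 g2) with ((A * g1) * (A * g1) + (A * g2) * (A * g2)) by (unfold sqn; ring).
      rewrite K1, K2. unfold sqn. destruct He as [-> | ->]; ring. }
    assert (N2 : B * B * sqn g1 g2 = A' * A' * sqn g1' g2').
    { replace (B * B * sqn g1 g2) with ((B * g1) * (B * g1) + (B * g2) * (B * g2)) by (unfold sqn; ring).
      rewrite K3, K4. unfold sqn. destruct He' as [-> | ->]; ring. }
    pose proof (sqr_mul_eq _ _ _ _ _ _ Ha Hb Hb' Ha' Hgp Hgp' N1 N2) as X.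
    destruct (coprime_cross_Z a b b' a') as [Ea Eb]; auto; [lia| |].
    { rewrite Nat.gcd_comm; auto. }
    assert (EA : A = B') by (unfold A, B'; congruence).
    destruct (scaled_eq A B' g1 g2 (- g2') g1' e) as [G1 G2]; auto.
    assert (EK : kap a' b' = kap a b) by (subst; apply kap_sym).
    (* Interchanged diagonals would force [g = i g'] or [g = - i g'] with the same [kap]. By
       uniqueness of associates [h = h'], so [g = g'], which leaves only [g = 0]. *)
    exfalso. assert (Ehh : h = h').
    { apply (diag_inj_sign (kap a b)); auto using kap_12.
      unfold g1', g2' in G1, G2; rewrite EK in G1, G2. fold g1 g2.
      destruct He as [-> | ->]; [right; right; left | right; right; right]; lia. }
    subst h'. unfold g1', g2' in G1, G2; rewrite EK in G1, G2.
    fold g1 in G1, G2; fold g2 in G1, G2. unfold sqn in Hgp.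
    assert (Z1 : g1 = 0) by lia. assert (Z2 : g2 = 0) by lia.
    rewrite Z1, Z2 in Hgp. lia.
Qed.

(** * Every well-rounded sublattice comes from an index *)

Lemma lattice_comb L x y x' y' p q : IsFullSublattice L ->
  L x y = true -> L x' y' = true -> L (p * x + q * x') (p * y + q * y') = true.
Proof.
  intros [[[u1 u2] [v1 v2]] [_ H]] H1 H2.
  apply H in H1 as (a & c & -> & ->); apply H in H2 as (a' & c' & -> & ->).
  apply H. exists (p * a + q * a'), (p * c + q * c'). split; ring.
Qed.

Lemma nearest_multiple P D : D <> 0 -> exists m, 2 * Z.abs (P - m * D) <= Z.abs D.
Proof.
  intros HD. exists (Z.sgn D * ((2 * P + Z.abs D) / (2 * Z.abs D))).
  pose proof (Z.div_mod (2 * P + Z.abs D) (2 * Z.abs D) ltac:(lia)) as E.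
  pose proof (Z.mod_pos_bound (2 * P + Z.abs D) (2 * Z.abs D) ltac:(lia)) as M.
  set (k := (2 * P + Z.abs D) / (2 * Z.abs D)) in *.
  replace (Z.sgn D * k * D) with (k * Z.abs D) by (rewrite <- (Z.sgn_abs D); ring).
  lia.
Qed.

(** Two independent minimal vectors form a basis: subtracting a rounded combination leaves a lattice
    vector with coefficients at most [1/2] in absolute value. Its norm is at most [(S + |T|) / 2],
    where [T] is the scalar product of the two and [S] their norm. As [|T| < S], this is below the
    minimum unless the vector is zero. *)
Lemma wr_span L u1 u2 v1 v2 X Y :
  IsFullSublattice L -> L u1 u2 = true -> L v1 v2 = true -> u1 * v2 - u2 * v1 <> 0 ->
  sqn u1 u2 = sqn v1 v2 ->
  (forall x y, L x y = true -> (x, y) <> (0, 0) -> sqn u1 u2 <= sqn x y) ->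
  L X Y = true -> exists m n, X = m * u1 + n * v1 /\ Y = m * u2 + n * v2.
Proof.
  intros HL Hu Hv HD Huv Hmin HX.
  set (D := u1 * v2 - u2 * v1) in *.
  (* By Cramer's rule the two determinants are [D] times the coefficients of [(X, Y)] on [u] and
     [v]. *)
  destruct (nearest_multiple (X * v2 - Y * v1) D HD) as [m Hm].
  destruct (nearest_multiple (u1 * Y - u2 * X) D HD) as [n Hn].
  exists m, n.
  set (P := X * v2 - Y * v1 - m * D) in *. set (Q := u1 * Y - u2 * X - n * D) in *.
  set (X' := X - m * u1 - n * v1). set (Y' := Y - m * u2 - n * v2).
  assert (HX' : L X' Y' = true).
  { pose proof (lattice_comb L _ _ _ _ m n HL Hu Hv) as H.
    pose proof (lattice_comb L _ _ _ _ 1 (-1) HL HX H) as H'.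
    unfold X', Y'. rewrite <- H'. f_equal; ring. }
  destruct (excluded_middle_informative ((X', Y') = (0, 0))) as [E|E].
  { inversion E. unfold X', Y' in *. lia. }
  exfalso. specialize (Hmin X' Y' HX' E).
  set (T := u1 * v1 + u2 * v2). set (S := sqn u1 u2) in *.
  (* Lagrange's identity for two vectors of equal norm; [D <> 0] then yields [|T| < S]. *)
  assert (HS : S * S = T * T + D * D).
  { rewrite Huv at 2. unfold S, T, D, sqn; ring. }
  assert (F : D * D * sqn X' Y' = (P * P + Q * Q) * S + 2 * (P * Q) * T).
  { assert (F1 : D * X' = P * u1 + Q * v1) by (unfold X', P, Q, D; ring).
    assert (F2 : D * Y' = P * u2 + Q * v2) by (unfold Y', P, Q, D; ring).
    replace (D * D * sqn X' Y') with ((D * X') * (D * X') + (D * Y') * (D * Y')) by (unfold sqn; ring).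
    rewrite F1, F2.
    replace ((P * P + Q * Q) * S) with (P * P * S + Q * Q * sqn v1 v2) by (rewrite <- Huv; ring).
    unfold S, T, sqn; ring. }
  clearbody P Q T. clear - F HS Hm Hn Hmin HD.
  assert (HS0 : 0 <= S) by (unfold S, sqn; nia). clearbody S D.
  set (N := sqn X' Y') in *. clearbody N.
  assert (D2 : 0 < D * D) by nia.
  assert (P2 : 4 * (P * P) <= D * D) by nia.
  assert (Q2 : 4 * (Q * Q) <= D * D) by nia.
  assert (PQ : 4 * Z.abs (P * Q) <= D * D).
  { rewrite Z.abs_mul. nia. }
  assert (TS : Z.abs T < S) by nia.
  assert (PQT : (P * Q) * T <= Z.abs (P * Q) * Z.abs T) by (rewrite <- Z.abs_mul; lia).
  assert (PQT2 : 4 * (Z.abs (P * Q) * Z.abs T) <= D * D * Z.abs T) by nia.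
  assert (D * D * S <= D * D * N) by nia.
  assert (4 * ((P * P + Q * Q) * S) <= 2 * (D * D) * S) by nia.
  assert (D * D * Z.abs T < D * D * S) by nia.
  lia.
Qed.

(** Write [e = k c] with [c] primitive. A vector orthogonal to [c] is an integral multiple [l] of
    [i c], by Bezout. The common divisor [d] of [k] and [l] moves into [g = d c], and [s] is the
    sign of [l]. *)
Lemma orthogonal_multiple e1 e2 f1 f2 :
  (e1, e2) <> (0, 0) -> (f1, f2) <> (0, 0) -> e1 * f1 + e2 * f2 = 0 ->
  exists (a b : nat) g1 g2 s, (s = 1 \/ s = -1) /\ (0 < a)%nat /\ (0 < b)%nat /\
    Nat.gcd a b = 1%nat /\
    e1 = Z.of_nat a * g1 /\ e2 = Z.of_nat a * g2 /\
    f1 = s * (- (Z.of_nat b * g2)) /\ f2 = s * (Z.of_nat b * g1).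
Proof.
  intros He Hf Hef.
  set (k := Z.gcd e1 e2).
  assert (Hk : 0 < k).
  { pose proof (Z.gcd_nonneg e1 e2). assert (k <> 0); [|lia].
    intros E. apply Z.gcd_eq_0 in E as [-> ->]. congruence. }
  destruct (Z.gcd_divide_l e1 e2) as [c1 C1]; destruct (Z.gcd_divide_r e1 e2) as [c2 C2].
  fold k in C1, C2.
  destruct (Z.gcd_bezout e1 e2 k eq_refl) as (x & y & B0). clearbody k.
  rewrite C1, C2 in B0, Hef.
  assert (B : x * c1 + y * c2 = 1).
  { apply Z.mul_reg_l with k; [lia|]. lia. }
  assert (O : c1 * f1 + c2 * f2 = 0).
  { apply Z.mul_reg_l with k; [lia|]. lia. }
  set (l := x * f2 - y * f1).
  assert (F2 : f2 = l * c1).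
  { unfold l. transitivity ((x * c1 + y * c2) * f2); [rewrite B; ring|].
    replace ((x * f2 - y * f1) * c1) with (x * c1 * f2 - y * (c1 * f1)) by ring.
    replace (c1 * f1) with (- (c2 * f2)) by lia. ring. }
  assert (F1 : f1 = - (l * c2)).
  { unfold l. transitivity ((x * c1 + y * c2) * f1); [rewrite B; ring|].
    replace (- ((x * f2 - y * f1) * c2)) with (y * c2 * f1 - x * (c2 * f2)) by ring.
    replace (c2 * f2) with (- (c1 * f1)) by lia. ring. }
  assert (Hl : l <> 0).
  { intros E. apply Hf. rewrite F1, F2, E. reflexivity. }
  set (d := Nat.gcd (Z.to_nat k) (Z.abs_nat l)).
  destruct (Nat.gcd_divide_l (Z.to_nat k) (Z.abs_nat l)) as [a Ea].
  destruct (Nat.gcd_divide_r (Z.to_nat k) (Z.abs_nat l)) as [b Eb].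
  fold d in Ea, Eb.
  assert (Hd : (0 < d)%nat) by nia.
  exists a, b, (Z.of_nat d * c1), (Z.of_nat d * c2), (Z.sgn l).
  assert (Ek : k = Z.of_nat a * Z.of_nat d) by lia.
  assert (El : l = Z.sgn l * (Z.of_nat b * Z.of_nat d)) by (rewrite <- Nat2Z.inj_mul, <- Eb; lia).
  split; [lia|]. split; [nia|]. split; [nia|]. split.
  { assert (d * Nat.gcd a b = d)%nat; [|nia].
    rewrite <- Nat.gcd_mul_mono_l, (Nat.mul_comm d a), (Nat.mul_comm d b), <- Ea, <- Eb.
    reflexivity. }
  repeat split.
  - rewrite C1, Ek; ring.
  - rewrite C2, Ek; ring.
  - rewrite F1, El at 1; ring.
  - rewrite F2, El at 1; ring.
Qed.

(** Irrationality of [sqrt 3], by divisibility by [3]. Minimality gives only [a^2 <= 3 b^2];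
    equality would be a hexagonal lattice, which does not exist in the square lattice. *)
Lemma sqr_neq_3sqr a b : Nat.gcd a b = 1%nat -> (a * a <> 3 * b * b)%nat.
Proof.
  intros Hg E.
  assert (Ha : exists c, a = (3 * c)%nat).
  { exists (a / 3)%nat. pose proof (Nat.div_mod_eq a 3) as D.
    pose proof (Nat.mod_upper_bound a 3 ltac:(lia)).
    set (c := (a / 3)%nat) in *. set (r := (a mod 3)%nat) in *. clearbody c r.
    assert (r = 0 \/ r = 1 \/ r = 2)%nat as [-> | [-> | ->]] by lia; [lia| |]; exfalso; subst a; lia. }
  destruct Ha as [c ->].
  assert (Hb : exists c, b = (3 * c)%nat).
  { exists (b / 3)%nat. pose proof (Nat.div_mod_eq b 3) as D.
    pose proof (Nat.mod_upper_bound b 3 ltac:(lia)).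
    set (e := (b / 3)%nat) in *. set (r := (b mod 3)%nat) in *. clearbody e r.
    assert (r = 0 \/ r = 1 \/ r = 2)%nat as [-> | [-> | ->]] by lia; [lia| |]; exfalso; subst b; lia. }
  destruct Hb as [e ->]. rewrite Nat.gcd_mul_mono_l in Hg. lia.
Qed.

(** Converse of [rhombic_sides]: integrality of one side [(a + i b) g / 2] forces [g] to be
    divisible by [1 + i] if [a], [b] are both odd, and by [2] otherwise. *)
Lemma diag_surj a b g1 g2 u1 u2 :
  Nat.gcd a b = 1%nat ->
  2 * u1 = Z.of_nat a * g1 - Z.of_nat b * g2 -> 2 * u2 = Z.of_nat a * g2 + Z.of_nat b * g1 ->
  exists h, g1 = diag1 (kap a b) h /\ g2 = diag2 (kap a b) h.
Proof.
  intros Hg E1 E2.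
  assert (Hpar : forall n, n = 2 * (n / 2) \/ n = 2 * (n / 2) + 1).
  { intros n. pose proof (Z.div_mod n 2 ltac:(lia)). pose proof (Z.mod_pos_bound n 2 ltac:(lia)). lia. }
  destruct (coprime_parity a b Hg) as
    [(c & d & Ea & Eb & ->)|[(c & d & Ea & Eb & ->)|(c & d & Ea & Eb & ->)]];
    unfold diag1, diag2; simpl Nat.eqb; cbv iota; rewrite Ea, Eb in E1, E2.
  - exists ((g1 + g2) / 2, (g2 - g1) / 2); cbv [fst snd].
    destruct (Hpar (g1 + g2)), (Hpar (g2 - g1)); lia.
  - exists (g1 / 2, g2 / 2); cbv [fst snd]. destruct (Hpar g1), (Hpar g2); lia.
  - exists (g1 / 2, g2 / 2); cbv [fst snd]. destruct (Hpar g1), (Hpar g2); lia.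
Qed.

Lemma in_rhombic_opp a b g1 g2 X Y :
  in_rhombic a b g1 g2 X Y -> in_rhombic a b (- g1) (- g2) X Y.
Proof. intros (m & n & E1 & E2); exists (- m), (- n); lia. Qed.

Lemma in_rhombic_rot a b g1 g2 X Y :
  in_rhombic a b g1 g2 X Y -> in_rhombic b a (- g2) g1 X Y.
Proof. intros (m & n & E1 & E2); exists (- n), m; lia. Qed.

Lemma in_rhombic_rot' a b g1 g2 X Y :
  in_rhombic a b g1 g2 X Y -> in_rhombic b a g2 (- g1) X Y.
Proof. intros (m & n & E1 & E2); exists n, (- m); lia. Qed.

Lemma diag_rot k x y :
  diag1 k (- y, x) = - diag2 k (x, y) /\ diag2 k (- y, x) = diag1 k (x, y) /\
  diag1 k (- x, - y) = - diag1 k (x, y) /\ diag2 k (- x, - y) = - diag2 k (x, y) /\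
  diag1 k (y, - x) = diag2 k (x, y) /\ diag2 k (y, - x) = - diag1 k (x, y).
Proof. unfold diag1, diag2; destruct (k =? 2)%nat; cbv [fst snd]; lia. Qed.

Lemma rotate_to_quarter a b h :
  cop_sym_cone (a, b) -> h <> (0, 0) ->
  exists z, wr_index z /\ lat_of z = lat_of ((a, b), h).
Proof.
  destruct h as [x y]; intros Hc Hh.
  assert (Hc' : cop_sym_cone (b, a)).
  { destruct Hc as [H1 [H2 H3]]; cbv [fst snd] in *. repeat split; auto.
    cbv [fst snd]; rewrite Nat.gcd_comm; auto. }
  assert (Hxy : x <> 0 \/ y <> 0).
  { destruct (Z.eq_dec x 0), (Z.eq_dec y 0); subst; auto. }
  destruct (diag_rot (kap a b) x y) as (R1 & R2 & R3 & R4 & R5 & R6).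
  assert (Hext : forall z, (forall X Y, lat_of z X Y = true <-> lat_of ((a, b), (x, y)) X Y = true) ->
     lat_of z = lat_of ((a, b), (x, y))).
  { intros z H. apply functional_extensionality; intros X; apply functional_extensionality; intros Y.
    specialize (H X Y). destruct (lat_of z X Y), (lat_of _ X Y); intuition congruence. }
  assert (Hq : quarter (x, y) \/ quarter (- y, x) \/ quarter (- x, - y) \/ quarter (y, - x)).
  { unfold quarter; cbv [fst snd]; lia. }
  destruct Hq as [Hq|[Hq|[Hq|Hq]]].
  - exists ((a, b), (x, y)); split; [split; auto | reflexivity].
  - exists ((b, a), (- y, x)); split; [split; auto|]. apply Hext; intros X Y.
    rewrite !lat_of_spec, (kap_sym b a), R1, R2. split.
    + intros H; apply in_rhombic_rot' in H. rewrite Z.opp_involutive in H. exact H.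
    + apply in_rhombic_rot.
  - exists ((a, b), (- x, - y)); split; [split; auto|]. apply Hext; intros X Y.
    rewrite !lat_of_spec, R3, R4. split.
    + intros H; apply in_rhombic_opp in H. rewrite !Z.opp_involutive in H. exact H.
    + apply in_rhombic_opp.
  - exists ((b, a), (y, - x)); split; [split; auto|]. apply Hext; intros X Y.
    rewrite !lat_of_spec, (kap_sym b a), R5, R6. split.
    + intros H; apply in_rhombic_rot in H. rewrite Z.opp_involutive in H. exact H.
    + apply in_rhombic_rot'.
Qed.

Lemma lat_of_surj L : WRZ2 L -> exists z, wr_index z /\ lat_of z = L.
Proof.
  intros [HL (u1 & u2 & v1 & v2 & Hu & Hv & HD & Huv & Hmin)].
  assert (Hspan : forall X Y, L X Y = true <-> exists m n, X = m * u1 + n * v1 /\ Y = m * u2 + n * v2).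
  { intros X Y; split.
    - intros HX; apply (wr_span L u1 u2 v1 v2); auto.
    - intros (m & n & -> & ->). apply lattice_comb; auto. }
  destruct (orthogonal_multiple (u1 + v1) (u2 + v2) (u1 - v1) (u2 - v2))
    as (a & b & g1 & g2 & s & Hs & Ha & Hb & Hg & E1 & E2 & E3 & E4).
  { intros E; inversion E. apply HD. replace v1 with (- u1) by lia. replace v2 with (- u2) by lia. ring. }
  { intros E; inversion E. apply HD. replace v1 with u1 by lia. replace v2 with u2 by lia. ring. }
  { unfold sqn in Huv. lia. }
  assert (Hu' : sqn u1 u2 <= sqn (u1 + v1) (u2 + v2)).
  { apply Hmin.
    - replace (u1 + v1) with (1 * u1 + 1 * v1) by ring. replace (u2 + v2) with (1 * u2 + 1 * v2) by ring.
      apply lattice_comb; auto.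
    - intros E; inversion E. apply HD. replace v1 with (- u1) by lia. replace v2 with (- u2) by lia. ring. }
  assert (Hv' : sqn u1 u2 <= sqn (u1 - v1) (u2 - v2)).
  { apply Hmin.
    - replace (u1 - v1) with (1 * u1 + (-1) * v1) by ring. replace (u2 - v2) with (1 * u2 + (-1) * v2) by ring.
      apply lattice_comb; auto.
    - intros E; inversion E. apply HD. replace v1 with u1 by lia. replace v2 with u2 by lia. ring. }
  (* The parallelogram law turns the minimality of the sides against each diagonal into
     [a^2 <= 3 b^2] and [b^2 <= 3 a^2]. *)
  assert (Hpar : sqn (u1 + v1) (u2 + v2) + sqn (u1 - v1) (u2 - v2) = 4 * sqn u1 u2).
  { unfold sqn in *; lia. }
  set (A := Z.of_nat a) in *. set (B := Z.of_nat b) in *.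
  assert (Ne : sqn (u1 + v1) (u2 + v2) = A * A * sqn g1 g2) by (rewrite E1, E2; unfold sqn; ring).
  assert (Nf : sqn (u1 - v1) (u2 - v2) = B * B * sqn g1 g2).
  { rewrite E3, E4; unfold sqn; destruct Hs as [-> | ->]; ring. }
  assert (HN : 0 < sqn g1 g2).
  { assert (0 <= sqn g1 g2) by (unfold sqn; nia). assert (sqn g1 g2 <> 0); [|lia].
    intros E. assert (g1 = 0) by (unfold sqn in E; nia). assert (g2 = 0) by (unfold sqn in E; nia).
    subst g1 g2. apply HD. replace v1 with (- u1) by lia. replace v2 with (- u2) by lia. ring. }
  assert (Hcone : cop_sym_cone (a, b)).
  { pose proof (sqr_neq_3sqr a b Hg). rewrite Nat.gcd_comm in Hg.
    pose proof (sqr_neq_3sqr b a Hg). rewrite Nat.gcd_comm in Hg.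
    rewrite Ne, Nf in *.
    assert (A * A <= 3 * (B * B)).
    { apply Z.mul_le_mono_pos_r with (sqn g1 g2); auto. lia. }
    assert (B * B <= 3 * (A * A)).
    { apply Z.mul_le_mono_pos_r with (sqn g1 g2); auto. lia. }
    split; [exact Hg|]. cbv [fst snd]. unfold A, B in *. lia. }
  (* The sign [s] decides which of [u], [v] is the side [(a + i b) g / 2]. *)
  assert (Hw : exists w1 w2, 2 * w1 = A * g1 - B * g2 /\ 2 * w2 = A * g2 + B * g1).
  { destruct Hs as [-> | ->]; [exists u1, u2 | exists v1, v2]; lia. }
  destruct Hw as (w1 & w2 & W1 & W2).
  destruct (diag_surj a b g1 g2 w1 w2 Hg W1 W2) as (h & Eg1 & Eg2).
  destruct (rotate_to_quarter a b h Hcone) as (z & Hz & Ez).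
  { intros ->. unfold diag1, diag2 in *; simpl in *.
    destruct (kap a b =? 2)%nat; subst; unfold sqn in HN; lia. }
  exists z; split; auto. rewrite Ez.
  apply functional_extensionality; intros X; apply functional_extensionality; intros Y.
  assert (H : lat_of ((a, b), h) X Y = true <-> L X Y = true).
  { rewrite lat_of_spec, <- Eg1, <- Eg2, Hspan. fold A B. split.
    - intros (m & n & F1 & F2). destruct Hs as [-> | ->]; [exists m, n | exists n, m]; lia.
    - intros (m & n & F1 & F2). destruct Hs as [-> | ->]; [exists m, n | exists n, m]; lia. }
  destruct (lat_of ((a, b), h) X Y), (L X Y); intuition congruence.
Qed.

Close Scope Z_scope.

(** * The zeta functions as products of two series with simple poles *)

Lemma cop_sym_cone_pos ab : cop_sym_cone ab -> (0 < fst ab)%nat /\ (0 < snd ab)%nat.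
Proof. intros [_ [H1 H2]]; nia. Qed.

Lemma gnorm_pos h : quarter h -> (0 < gnorm h)%R.
Proof. intros H; apply IZR_lt, quarter_sqn_pos, H. Qed.

Lemma wr_HasPole v (w : ZLat -> R) :
  (forall a b, (0 < a)%nat -> (0 < b)%nat -> 0 < v (a, b))%R ->
  (exists l, HasPole cop_sym_cone (redw v) 1 l) ->
  (forall z, wr_index z -> w (lat_of z) = redw v (fst z) * gnorm (snd z))%R ->
  exists l, HasPole WRZ2 w 2 l.
Proof.
  intros Hv [l1 H1] Hw. destruct quarter_HasPole as [l2 H2].
  assert (Hp : forall ab, cop_sym_cone ab -> (0 < redw v ab)%R).
  { intros [a b] H; apply cop_sym_cone_pos in H as [Ha Hb]. apply redw_pos; auto. }
  pose proof (HasPole_prod _ _ _ _ _ _ _ _ Hp gnorm_pos H1 H2) as H.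
  exists (l1 * l2)%R.
  refine (proj1 (HasPole_bij wr_index WRZ2 lat_of _ w _ _ _ lat_of_inj lat_of_surj _) H).
  - intros z Hz; apply lat_of_data, Hz.
  - intros z Hz; symmetry; apply Hw, Hz.
Qed.

Lemma wr_weights_ge1 L : WRZ2 L -> (1 <= latdet L)%R /\ (1 <= latmin2 L)%R.
Proof.
  intros [[[[u1 u2] [v1 v2]] Hb] (x1 & x2 & y1 & y2 & Hx & Hy & HD & _ & Hmin)]. split.
  - rewrite (latdet_basis _ _ _ _ _ Hb). destruct Hb as [Hd _]. apply (IZR_le 1). lia.
  - assert (Hn : (x1, x2) <> (0, 0)%Z).
    { intros E; inversion E; subst. apply HD; ring. }
    rewrite (latmin2_spec L x1 x2); auto. apply (IZR_le 1).
    assert (x1 <> 0 \/ x2 <> 0)%Z.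
    { destruct (Z.eq_dec x1 0), (Z.eq_dec x2 0); subst; auto. }
    unfold sqn; nia.
Qed.

Open Scope R_scope.

Theorem theorem1p5 :
  (* W_d(s) = sum_{p/q in S} p^{-s} *)
  DirichletProps inS (fun pq => INR (fst pq)) 1 /\
  (* W_m(s) = sum_{p/q in S} q^{-s} *)
  DirichletProps inS (fun pq => INR (snd pq)) 1 /\
  (* zeta_{WR(Z^2)}(s) = sum_{L in WR(Z^2)} det(L)^{-s} *)
  DirichletProps WRZ2 latdet 2 /\
  (* zeta^m_{WR(Z^2)}(s) = sum_{L in WR(Z^2)} |L|^{-2s} = sum (|L|^2)^{-s} *)
  DirichletProps WRZ2 latmin2 2.
Proof.
  split; [apply W_d_props|]. split; [apply W_m_props|]. split.
  - destruct (wr_HasPole cone_d latdet cone_d_pos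
      (cop_sym_cone_HasPole cone_d cone_d_pos cone_d_hom cone_d_sym coset_cone_d_HasPole)
      (fun z Hz => proj1 (proj2 (lat_of_data z Hz)))) as [l Hl].
    apply HasPole_DirichletProps with l; auto. intros L H; apply wr_weights_ge1, H.
  - destruct (wr_HasPole cone_m latmin2 cone_m_pos
      (cop_sym_cone_HasPole cone_m cone_m_pos cone_m_hom cone_m_sym coset_cone_m_HasPole)
      (fun z Hz => proj2 (proj2 (lat_of_data z Hz)))) as [l Hl].
    apply HasPole_DirichletProps with l; auto. intros L H; apply wr_weights_ge1, H.
Qed.
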